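(* Let $a_1,\ldots,a_n\in C^\infty(\mathbb{T}^n)$ be real-valued, let $X_j=\partial_{t_j}+a_j(t)\partial_x$ for $j\in\{1,\ldots,n\}$ be the associated real vector fields on $\mathbb{T}^{n+1}=\mathbb{T}^n_t\times\mathbb{T}_x$, let $\mathcal{X}=\{X_1,\ldots,X_n\}$ and $P=\sum_{j=1}^n X_j^2$. Let $u\in\mathcal{D}'(\mathbb{T}^{n+1})$. Then $Pu\in C^\infty(\mathbb{T}^{n+1})$ if and only if $X_ju\in C^\infty(\mathbb{T}^{n+1})$ for every $j\in\{1,\ldots,n\}$. In particular, the system $\mathcal{X}$ is globally hypoelliptic in $\mathbb{T}^{n+1}$ if and only if the operator $P$ is globally hypoelliptic in $\mathbb{T}^{n+1}$.
   Context: $\mathbb{T}=\mathbb{R}/2\pi\mathbb{Z}$, and $(t,x)=(t_1,\ldots,t_n,x)$ are the standard angular coordinates on $\mathbb{T}^{n+1}$. The vector fields $X_j$ are not assumed to commute. $\mathcal{D}'(\mathbb{T}^{N})$ is the space of distributions on $\mathbb{T}^N$. A system (set) $\mathcal{S}$ of linear partial differential operators on $\mathbb{T}^N$ is globally hypoelliptic in $\mathbb{T}^N$ if whenever $u\in\mathcal{D}'(\mathbb{T}^N)$ and $Qu\in C^\infty(\mathbb{T}^N)$ for every $Q\in\mathcal{S}$, one has $u\in C^\infty(\mathbb{T}^N)$; a single operator $Q$ is globally hypoelliptic if $\{Q\}$ is. *)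

(* Defs.v *)
From HB Require Import structures.
From mathcomp Require Import all_boot all_order all_algebra.
From mathcomp Require Import complex.
From mathcomp Require Import all_classical all_reals all_analysis.
Import numFieldNormedType.Exports.
Import Order.TTheory GRing.Theory Num.Theory.

Set Implicit Arguments.
Unset Strict Implicit.
Unset Printing Implicit Defensive.

Local Open Scope classical_set_scope.
Local Open Scope complex_scope.
Local Open Scope ring_scope.

(* Functions on the torus (R / 2 pi Z)^N are functions of the angular          *)
(* coordinates, that is, functions on R^N that are 2 pi-periodic in each       *)
(* variable.                                                                   *)
Section RealFunctions.
Context {R : realType} {N : nat}.
Implicit Types (f : 'rV[R]_N -> R) (j : 'I_N) (s : seq 'I_N).

Definition pderiv j f : 'rV[R]_N -> R := fun y => 'D_(delta_mx 0 j) f y.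

Definition iter_pderiv s f : 'rV[R]_N -> R := foldr pderiv f s.

(* 'D_v f is a junk value where f has no derivative along v, hence the         *)
(* derivability clause.                                                        *)
Definition smooth f : Prop :=
  forall s, continuous (iter_pderiv s f) /\
    forall j y, derivable (iter_pderiv s f) y (delta_mx 0 j).

Definition periodic2pi f : Prop :=
  forall j y, f (y + (2 * pi) *: delta_mx 0 j) = f y.

Definition Cinfty f : Prop := smooth f /\ periodic2pi f.

End RealFunctions.

(* The integral over T^N, as an iterated Lebesgue integral over [0, 2 pi]^N.   *)
Fixpoint torus_integral {R : realType} (N : nat) : ('rV[R]_N -> R) -> R :=
  match N return ('rV[R]_N -> R) -> R with
  | 0 => fun f => f 0
  | M.+1 => fun f =>
      \int[@lebesgue_measure R]_(r in `[0, 2 * pi])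
        torus_integral (fun y : 'rV[R]_M => f (row_mx (const_mx r : 'rV_1) y))
  end.

Section ComplexFunctions.
Context {R : realType} {N : nat}.
Implicit Types (f phi : 'rV[R]_N -> R[i]) (j : 'I_N) (s : seq 'I_N) (k : nat).

Definition re_fun f : 'rV[R]_N -> R := fun y => complex.Re (f y).
Definition im_fun f : 'rV[R]_N -> R := fun y => complex.Im (f y).

Definition CinftyC f : Prop := Cinfty (re_fun f) /\ Cinfty (im_fun f).

Definition pderivC j f : 'rV[R]_N -> R[i] :=
  fun y => pderiv j (re_fun f) y +i* pderiv j (im_fun f) y.

Definition iter_pderivC s f : 'rV[R]_N -> R[i] := foldr pderivC f s.

Definition torus_integralC f : R[i] :=
  torus_integral (re_fun f) +i* torus_integral (im_fun f).

Definition Ck_norm k f : R :=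
  sup [set Normc.normc (iter_pderivC s f y)
      | s in [set s : seq 'I_N | (size s <= k)%N] & y in [set: 'rV[R]_N]].

End ComplexFunctions.

(* A distribution is represented by a functional on all functions R^N -> C;    *)
(* only its values on C^oo(T^N) are meaningful, those elsewhere are junk: they *)
(* are unconstrained, and nothing below depends on them.                       *)
Definition functional (R : realType) (N : nat) : Type :=
  ('rV[R]_N -> R[i]) -> R[i].

Section Distributions.
Context {R : realType} {N : nat}.
Implicit Types (u : functional R N) (j : 'I_N).

Definition is_distribution u : Prop :=
  (forall (c : R[i]) (phi psi : 'rV[R]_N -> R[i]),
     CinftyC phi -> CinftyC psi ->
     u (fun y => c * phi y + psi y) = c * u phi + u psi) /\
  (exists (k : nat) (C : R), forall phi, CinftyC phi ->
     Normc.normc (u phi) <= C * Ck_norm k phi).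

Definition is_smooth_distribution u : Prop :=
  exists f : 'rV[R]_N -> R[i], CinftyC f /\
    forall phi, CinftyC phi -> u phi = torus_integralC (fun y => f y * phi y).

Definition distr_deriv j u : functional R N := fun phi => - u (pderivC j phi).

Definition distr_mul (b : 'rV[R]_N -> R) u : functional R N :=
  fun phi => u (fun y => (b y)%:C * phi y).

Definition globally_hypoelliptic
    (S : set (functional R N -> functional R N)) : Prop :=
  forall u, is_distribution u ->
    (forall Q, S Q -> is_smooth_distribution (Q u)) -> is_smooth_distribution u.

End Distributions.

(* A point of T^{n+1} is y = (t, x) with t = lsubmx y and x = y 0 (rshift n 0). *)
Section VectorFields.
Context {R : realType} {n : nat}.
Implicit Types (a : 'I_n -> 'rV[R]_n -> R) (u : functional R (n + 1)).

Definition vfield a (j : 'I_n) u : functional R (n + 1) :=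
  fun phi => distr_deriv (lshift 1 j) u phi +
    distr_mul (fun y => a j (lsubmx y)) (distr_deriv (rshift n 0) u) phi.

Definition sum_squares a u : functional R (n + 1) :=
  fun phi => \sum_(j < n) vfield a j (vfield a j u) phi.

End VectorFields.

(* Main.v *)
(** Expand in Fourier series. On the frequency [(xi_t, k)] the functional [u]
    takes the value [u(e_(xi_t,k))], and the transposed operator maps [b e_xi]
    to [- |xi_t|^2 b e_xi] plus terms of order at most one in [xi_t] whose
    coefficients are polynomial in [k]. Bootstrapping from the finite order of [u],
    smoothness of [P u] hence makes [u(b e_(xi_t,k))] decay rapidly in [xi_t], with
    constants polynomial in [k]. So the mode [G_k] of [u] at frequency [k] in [x]
    is a smooth function, of polynomial growth in [k], and since the [X_j] are
    real and divergence free, testing [P u] on the conjugate of [G_k] gives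
    [\sum_j \int |X_j G_k|^2 = - \int (P u) conj G_k]. The right-hand side decays
    rapidly in [k], and so do the Fourier coefficients of [X_j u] by Bessel's
    inequality; interpolating with their decay in [xi_t] they decay rapidly in all
    frequencies, so [X_j u] is smooth. The converse is integration by parts. *)
Require Import Defs.
From HB Require Import structures.
From mathcomp Require Import all_boot all_order all_algebra.
From mathcomp Require Import complex.
From mathcomp Require Import ring lra.
From mathcomp Require Import all_classical all_reals all_analysis.
Import numFieldNormedType.Exports.
Import Order.TTheory GRing.Theory Num.Theory.

Set Implicit Arguments.
Unset Strict Implicit.
Unset Printing Implicit Defensive.

Local Open Scope classical_set_scope.
Local Open Scope complex_scope.
Local Open Scope ring_scope.

(** * Continuous periodic functions and the integral over the torus *)

Section ContinuousPeriodic.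
Context {R : realType} {N : nat}.
Implicit Types (f g : 'rV[R]_N -> R) (j : 'I_N).

(** Since the [a_j] vary with t, applying [X_j] to an exponential returns other smooth multiples of
    it, so the bootstrap must treat all multipliers [b] at once. [P] is not elliptic in x: each
    round gains one power of |xi_t| and pays powers of k. This loss is affordable because [X_j]
    commutes with the derivative in x. In the energy identity [P u] then meets a function of a
    single x-frequency, and integration by parts in x beats any power of k. The energy controls
    [X_j G_k] but not [G_k], which is why regularity comes out for [X_j u] and not for [u].
    Everything is read off from values at exponentials, so the exponentials must be shown to
    determine a smooth function. This is done by a Korovkin argument: products of the bumps (1 +
    cos) / 2 concentrate at a point, and an exact recurrence for their integrals measures how
    fast. *)

Definition cper f : Prop := continuous f /\ periodic2pi f.

Lemma periodic2piZ f j (k : int) y : periodic2pi f ->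
  f (y + (2 * pi * k%:~R) *: delta_mx 0 j) = f y.
Proof.
move=> pf.
have posn (n : nat) z : f (z + (2 * pi * n%:R) *: delta_mx 0 j) = f z.
  elim: n z => [|n IH] z; first by rewrite mulr0 scale0r addr0.
  by rewrite -[n.+1%:R]natr1 mulrDr mulr1 scalerDl addrA pf.
case: k => n; first exact: posn.
rewrite NegzE mulrNz -pmulrn mulrN.
by rewrite -[LHS](posn n.+1) -addrA -scalerDl addNr scale0r addr0.
Qed.

Lemma periodic2pi_lattice f (k : 'rV[int]_N) y : periodic2pi f ->
  f (y + (2 * pi) *: map_mx intr k) = f y.
Proof.
move=> pf; rewrite (row_sum_delta (map_mx intr k)) scaler_sumr.
elim/big_rec: _ y => [|j z _ IH] y; first by rewrite addr0.
by rewrite addrA IH scalerA mxE periodic2piZ.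
Qed.

Definition fundamental_box : set 'rV[R]_N :=
  [set y | forall j, `[0, 2 * pi]%classic (y ord0 j)].

Lemma compact_box : compact fundamental_box.
Proof. by apply: (@rV_compact R N (fun=> `[0, 2 * pi]%classic)) => _; exact: segment_compact. Qed.

Lemma lattice_reduce (y : 'rV[R]_N) :
  exists k : 'rV[int]_N, fundamental_box (y + (2 * pi) *: map_mx intr k).
Proof.
exists (\row_j - Num.floor (y ord0 j / (2 * pi))) => j /=.
have p0 : (0 : R) < 2 * pi by rewrite mulr_gt0 ?pi_gt0.
rewrite in_itv /= !mxE mulrNz; set t := y _ _.
have := floor_itv (t / (2 * pi)).
rewrite ler_pdivlMr// ltr_pdivrMr// mulrDl mul1r => /andP[h1 h2].
by apply/andP; split; rewrite mulrN mulrC; lra.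
Qed.

Lemma cper_bounded f : cper f -> exists B : R, 0 <= B /\ forall y, `|f y| <= B.
Proof.
move=> [cf pf].
have /compact_bounded[M [_ HM]] : compact (f @` fundamental_box).
  apply: continuous_compact compact_box.
  exact: continuous_subspaceT.
exists (`|M| + 1); split; first by rewrite addr_ge0.
move=> y; have [k Hk] := lattice_reduce y.
rewrite -(periodic2pi_lattice k y pf); apply: HM.
  by rewrite (le_lt_trans (ler_norm _)) // ltrDl.
by exists (y + 2 * pi *: map_mx intr k).
Qed.

(** Compactness gives one radius for all base points of the fundamental box. Any other base point is
    moved into the box by a lattice translation, applied to both points so that their distance is
    unchanged. *)
Lemma cper_unif f (e : R) : cper f -> 0 < e ->
  exists2 d : R, 0 < d & forall y z, `|y - z| < d -> `|f y - f z| < e.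
Proof.
move=> [cf pf] e0.
pose P (d : R) (y : 'rV[R]_N) := forall z, `|y - z| < d -> `|f y - f z| < e.
have /compact_near_coveringP nc := compact_box.
have : \forall d \near 0^'+, fundamental_box `<=` P d.
  apply: nc => x _.
  have /cvgrPdist_lt/(_ (e / 2)) := cf x.
  rewrite divr_gt0// => /(_ isT)/nbhs_ballP[d /= d0 Hd].
  (* Half the radius for each of the moves from [x] to [y] and from [y] to [z] keeps both points in
     the ball where [f] is close to [f x]. *)
  exists (ball x (d / 2), [set t | 0 < t < d / 2]).
    split; first by apply: nbhsx_ballx; rewrite divr_gt0.
    near=> t; apply/andP; split; near: t.
      exact: nbhs_right_gt.
    by apply: nbhs_right_lt; rewrite divr_gt0.
  move=> [y t] /= [xy /andP[t0 td]] z yz.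
  have xy' : `|x - y| < d / 2 by move: xy; rewrite -ball_normE.
  have h1 : `|f x - f y| < e / 2.
    by apply: Hd; rewrite -ball_normE /=; lra.
  have h2 : `|f x - f z| < e / 2.
    apply: Hd; rewrite -ball_normE /=.
    have := ler_normD (x - y) (y - z); rewrite addrA subrK => h; lra.
  have := ler_normB (f x - f z) (f x - f y).
  have -> : f x - f z - (f x - f y) = f y - f z by ring.
  lra.
move=> [d /= d0 Hd].
have d2 : 0 < d / 2 by rewrite divr_gt0.
exists (d / 2) => // y z yz.
have [k Hk] := lattice_reduce y.
rewrite -(periodic2pi_lattice k y pf) -(periodic2pi_lattice k z pf).
apply: (Hd (d/2)) => //=; last by rewrite opprD addrACA subrr addr0.
by rewrite sub0r normrN gtr0_norm//; lra.
Unshelve. all: by end_near.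
Qed.

Lemma continuous_epsilon f :
  (forall y (e : R), 0 < e -> exists2 d : R, 0 < d &
     forall z, `|y - z| < d -> `|f y - f z| < e) -> continuous f.
Proof.
move=> H y; apply/(@cvgrPdist_lt _ _ _ (nbhs y) (nbhs_filter y)) => e e0.
have [d d0 Hd] := H y e e0.
by apply/nbhs_ballP; exists d => //= z; rewrite -ball_normE /=; exact: Hd.
Qed.

Lemma cperD f g : cper f -> cper g -> cper (fun y => f y + g y).
Proof.
move=> [cf pf] [cg pg]; split; first by move=> x; exact: (continuousD (cf x) (cg x)).
by move=> j y; rewrite pf pg.
Qed.

Lemma cperM f g : cper f -> cper g -> cper (fun y => f y * g y).
Proof.
move=> [cf pf] [cg pg]; split; first by move=> x; exact: (continuousM (cf x) (cg x)).
by move=> j y; rewrite pf pg.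
Qed.

Lemma cperZ (c : R) f : cper f -> cper (fun y => c * f y).
Proof.
move=> [cf pf]; split; last by move=> j y; rewrite pf.
by move=> x; exact: (continuousM (@cst_continuous _ _ c x) (cf x)).
Qed.

Lemma cper_cst (c : R) : cper (fun _ => c).
Proof. by split => //; exact: cst_continuous. Qed.

End ContinuousPeriodic.

(** * The iterated integral of continuous periodic functions *)

Section TorusIntegral.
Context {R : realType}.

Definition slice M (f : 'rV[R]_(1 + M) -> R) (r : R) : 'rV[R]_M -> R :=
  fun y => f (row_mx (const_mx r : 'rV_1) y).

Lemma row_norm_le M (x : 'rV[R]_M) (B : R) : 0 <= B ->
  (forall j, `|x 0 j| <= B) -> `|x| <= B.
Proof.
move=> B0 H; change (mx_norm x <= B); rewrite mx_normrE.
by apply: bigmax_le => // -[i j] _ /=; rewrite (ord1 i).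
Qed.

Lemma coord_le_norm M (x : 'rV[R]_M) (j : 'I_M) : `|x 0 j| <= `|x|.
Proof.
change (`|x 0 j| <= mx_norm x); rewrite mx_normrE.
exact: (le_bigmax 0 (fun ij : 'I_1 * 'I_M => `|x ij.1 ij.2|) (0, j)).
Qed.

Lemma row_mx_distl M (r r' : R) (y : 'rV[R]_M) :
  `|(row_mx (const_mx r : 'rV_1) y : 'rV[R]_(1 + M)) -
    (row_mx (const_mx r' : 'rV_1) y : 'rV[R]_(1 + M))| <= `|r - r'|.
Proof.
apply: row_norm_le => // j; case: (@split_ordP 1 M j) => k ->.
  by rewrite !(row_mxEl, mxE).
by rewrite !(row_mxEr, mxE) subrr normr0.
Qed.

Lemma row_mx_distr M (r : R) (y z : 'rV[R]_M) :
  `|(row_mx (const_mx r : 'rV_1) y : 'rV[R]_(1 + M)) -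
    (row_mx (const_mx r : 'rV_1) z : 'rV[R]_(1 + M))| <= `|y - z|.
Proof.
apply: row_norm_le => // j; case: (@split_ordP 1 M j) => k ->.
  by rewrite !(row_mxEl, mxE) subrr normr0.
by rewrite !(row_mxEr, mxE); have := coord_le_norm (y - z) k; rewrite !mxE.
Qed.

Lemma row_mx_shiftr M (r h : R) (y : 'rV[R]_M) (j : 'I_M) :
  row_mx (const_mx r : 'rV_1) (y + h *: delta_mx 0 j) =
  (row_mx (const_mx r : 'rV_1) y : 'rV[R]_(1 + M)) + h *: delta_mx 0 (rshift 1 j).
Proof.
apply/rowP => k; case: (@split_ordP 1 M k) => i ->; rewrite !(row_mxEl, row_mxEr, mxE).
  by rewrite eq_shift mulr0 addr0.
by rewrite eq_shift.
Qed.

Lemma row_mx_shiftl M (r h : R) (y : 'rV[R]_M) :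
  row_mx (const_mx (r + h) : 'rV_1) y =
  (row_mx (const_mx r : 'rV_1) y : 'rV[R]_(1 + M)) + h *: delta_mx 0 (lshift M 0).
Proof.
apply/rowP => k; case: (@split_ordP 1 M k) => i ->; rewrite !(row_mxEl, row_mxEr, mxE).
  by rewrite eq_shift ord1 eqxx /= mulr1.
by rewrite eq_shift /= mulr0 addr0.
Qed.

Lemma slice_cper M (f : 'rV[R]_(1 + M) -> R) r : cper f -> cper (slice f r).
Proof.
move=> [cf pf]; split.
  apply: continuous_epsilon => y e e0.
  have [d d0 Hd] := cper_unif (conj cf pf) e0.
  exists d => // z yz; apply: Hd; apply: le_lt_trans yz; exact: row_mx_distr.
by move=> j y; rewrite /slice row_mx_shiftr pf.
Qed.

Let mu := @lebesgue_measure R.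

Lemma two_pi_gt0 : (0 : R) < 2 * pi.
Proof. by rewrite mulr_gt0 ?pi_gt0. Qed.

Lemma continuous_integrable (F : R -> R) : continuous F ->
  mu.-integrable `[0, 2 * pi] (EFin \o F).
Proof.
move=> cF; apply: continuous_compact_integrable; first exact: segment_compact.
exact: continuous_subspaceT.
Qed.

Let mD : measurable (`[0, 2 * pi]%classic : set R). Proof. exact: measurable_itv. Qed.

Lemma Rint_cst (c : R) : \int[mu]_(r in `[0, 2 * pi]) c = c * (2 * pi).
Proof.
have := @Rintegral_cst _ _ _ mu _ mD c; rewrite /cst /= => ->.
by rewrite lebesgue_measure_itv /= lte_fin two_pi_gt0 oppr0 addr0.
Qed.

(** One induction for all three properties: in dimension [M.+1] the outer integrand is integrable
    because it is continuous in [r], and that continuity uses all three properties in dimension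
    [M]. *)
Lemma torus_integral_spec N :
  [/\ (forall (c : R) (f g : 'rV[R]_N -> R), cper f -> cper g ->
        torus_integral (fun y => c * f y + g y) =
        c * torus_integral f + torus_integral g),
      (forall f g : 'rV[R]_N -> R, cper f -> cper g -> (forall y, f y <= g y) ->
        torus_integral f <= torus_integral g) &
      (forall c : R, torus_integral (fun _ : 'rV[R]_N => c) = c * (2 * pi) ^+ N)].
Proof.
elim: N => [|M [lin mon cst]].
  by split => //= c; rewrite expr0 mulr1.
have cint (f : 'rV[R]_(1 + M) -> R) : cper f ->
    continuous (fun r => torus_integral (slice f r)).
  move=> cf r; apply/cvgrPdist_lt => e e0.
  have p0 : (0 : R) < (2 * pi) ^+ M by rewrite exprn_gt0 ?two_pi_gt0.
  have e0' : 0 < e / 2 / (2 * pi) ^+ M by rewrite !divr_gt0.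
  have [d d0 Hd] := cper_unif cf e0'.
  apply/nbhs_ballP; exists d => //= r' rr'.
  have key a b : `|a - b| < d -> torus_integral (slice f a) <= e / 2 + torus_integral (slice f b).
    move=> ab.
    have -> : e / 2 + torus_integral (slice f b) =
       torus_integral (fun y => 1 * slice f b y + e / 2 / (2 * pi) ^+ M).
      rewrite lin ?cst; [|exact: slice_cper|exact: cper_cst].
      by rewrite mul1r divfK ?gt_eqF// addrC.
    apply: mon; [exact: slice_cper| |].
      apply: cperD; last exact: cper_cst.
      by apply: cperZ; exact: slice_cper.
    move=> y; rewrite mul1r -lerBlDl.
    apply: le_trans (ler_norm _) _; apply/ltW/Hd.
    by apply: le_lt_trans ab; exact: row_mx_distl.
  have h1 := key _ _ rr'.
  have := key r' r; rewrite distrC => /(_ rr') h2.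
  by rewrite ltr_norml; apply/andP; split; lra.
split.
- move=> c f g cf cg /=.
  under eq_Rintegral => r _.
    rewrite (_ : torus_integral _ = c * torus_integral (slice f r) + torus_integral (slice g r)); last first.
      by rewrite -lin //; exact: slice_cper.
    over.
  rewrite RintegralD//.
  + by rewrite RintegralZl//; apply: continuous_integrable; exact: cint.
  + by apply: continuous_integrable => r; apply: cvgMr; exact: cint.
  + by apply: continuous_integrable; exact: cint.
- move=> f g cf cg fg /=; apply: le_Rintegral => //.
  + by apply: continuous_integrable; exact: cint.
  + by apply: continuous_integrable; exact: cint.
  + by move=> r _; apply: mon => *; [exact: slice_cper|exact: slice_cper|exact: fg].
- move=> c /=.
  under eq_Rintegral => r _ do rewrite cst.
  by rewrite Rint_cst exprS; ring.
Qed.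

End TorusIntegral.

(** * Derivatives along lines and first-order remainders *)

Section Lines.
Context {R : realType}.

(** A directional derivative only sees the restriction to one line, so it transfers between
    functions on different spaces: slices, translates and functions of t alone are all treated this
    way. *)
Lemma same_line (V W : normedModType R) (f : V -> R) (g : W -> R) v w y z :
  (forall h : R, g (h *: w + z) = f (h *: v + y)) ->
  (derivable f y v -> derivable g z w) /\ 'D_w g z = 'D_v f y.
Proof.
move=> H.
have E : (fun h : R => h^-1 *: ((g \o shift z) (h *: w) - g z)) =
         (fun h : R => h^-1 *: ((f \o shift y) (h *: v) - f y)).
  apply/funext => h /=; rewrite H.
  by have := H 0; rewrite !scale0r !add0r => ->.
by rewrite /derivable /derive E.
Qed.

Lemma is_derive_epsilon (V : normedModType R) (f : V -> R) y v (g : R) :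
  (forall e : R, 0 < e -> exists2 d : R, 0 < d &
     forall h : R, `|h| < d -> `|f (h *: v + y) - f y - h * g| <= `|h| * e) ->
  is_derive y v f g.
Proof.
move=> H.
have cv : (fun h : R => h^-1 *: ((f \o shift y) (h *: v) - f y)) @ 0^' --> g.
  apply/cvgrPdist_le => e e0.
  have [d d0 Hd] := H e e0.
  near=> h.
  have h0 : h != 0 by near: h; exact: nbhs_dnbhs_neq.
  have hd : `|h| < d.
    near: h; apply: dnbhs0_lt => //.
  have /= := Hd h hd; rewrite -ler_pdivrMl ?normr_gt0// -normfV -normrM.
  rewrite distrC; congr (`|_| <= _).
  by rewrite mulrBr mulKf.
apply: DeriveDef; first by apply/cvg_ex; exists g.
exact: cvg_lim cv.
Unshelve. all: by end_near.
Qed.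

Lemma mvt_estimate (phi dphi : R -> R) (c e h : R) :
  (forall s : R, is_derive s (1 : R) phi (dphi s)) ->
  (forall s, `|s| <= `|h| -> `|dphi s - c| <= e) ->
  `|phi h - phi 0 - h * c| <= `|h| * e.
Proof.
move=> dp He.
have cphi : continuous phi.
  by move=> s; apply/differentiable_continuous/derivable1_diffP.
have [h0|h0] := leP 0 h.
  have [s + E] := MVT_segment h0 (fun s _ => dp s) (continuous_subspaceT cphi).
  rewrite in_itv /= => /andP[s0 sh].
  rewrite E subr0 mulrC -mulrBr normrM; apply: ler_wpM2l => //; apply: He.
  by rewrite !ger0_norm.
have [s + E] := MVT_segment (ltW h0) (fun s _ => dp s) (continuous_subspaceT cphi).
rewrite in_itv /= => /andP[hs s0].
have -> : phi h - phi 0 - h * c = h * (dphi s - c).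
  have -> : phi h = phi 0 - dphi s * (0 - h) by rewrite -E; ring.
  by ring.
rewrite normrM; apply: ler_wpM2l => //; apply: He.
by rewrite !ler0_norm ?lerN2// ltW.
Qed.

Lemma line_is_derive (V : normedModType R) (f : V -> R) v (y : V) (s : R) :
  derivable f (s *: v + y) v ->
  is_derive s (1 : R) (fun h : R => f (h *: v + y)) ('D_v f (s *: v + y)).
Proof.
move=> df.
have [H1 H2] : (derivable f (s *: v + y) v -> derivable (fun h : R => f (h *: v + y)) s (1 : R)) /\
    'D_(1 : R) (fun h : R => f (h *: v + y)) s = 'D_v f (s *: v + y).
  apply: same_line => h.
  by rewrite addrA -scalerDl /= [h *: _]mulr1.
by apply: DeriveDef; [exact: H1|exact: H2].
Qed.

(** By the mean value theorem the remainder is governed by the oscillation of the derivative on the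
    segment. When that oscillation is uniform, so is the bound, which can then be integrated over
    slices or summed over frequencies. *)
Lemma line_estimate (V : normedModType R) (f : V -> R) v (y : V) (c e h : R) :
  (forall z, derivable f z v) ->
  (forall s, `|s| <= `|h| -> `|'D_v f (s *: v + y) - c| <= e) ->
  `|f (h *: v + y) - f y - h * c| <= `|h| * e.
Proof.
move=> df He.
have := @mvt_estimate (fun h : R => f (h *: v + y)) (fun s => 'D_v f (s *: v + y)) c e h.
rewrite scale0r add0r; apply => // s; exact: line_is_derive.
Qed.

End Lines.

(** * Integrals of partial derivatives vanish *)

Section IntegralDerivative.
Context {R : realType}.

Lemma torus_integral_approx N (f g : 'rV[R]_N -> R) (e : R) :
  cper f -> cper g -> (forall y, `|f y - g y| <= e) ->
  `|torus_integral f - torus_integral g| <= e * (2 * pi) ^+ N.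
Proof.
move=> cf cg H.
have [lin mon cst] := @torus_integral_spec R N.
have key (p q : 'rV[R]_N -> R) : cper p -> cper q -> (forall y, `|p y - q y| <= e) ->
    torus_integral p <= torus_integral q + e * (2 * pi) ^+ N.
  move=> cp cq pq.
  rewrite -cst -[torus_integral q]mul1r -lin //; last exact: cper_cst.
  apply: mon => //.
    by apply: cperD; [exact: cperZ|exact: cper_cst].
  by move=> y; rewrite mul1r -lerBlDl; apply: le_trans (ler_norm _) _.
have h1 := key _ _ cf cg H.
have h2 := key g f cg cf (fun y => eq_ind_r (fun t => t <= e) (H y) (distrC _ _)).
by rewrite ler_norml; apply/andP; split; lra.
Qed.

Lemma norm_delta_le1 N (j : 'I_N) : `|delta_mx 0 j : 'rV[R]_N| <= 1.
Proof.
by apply: row_norm_le => // k; rewrite mxE; case: (_ && _); rewrite ?normr1 ?normr0.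
Qed.


(** For a coordinate other than the first, slicing reduces to a lower dimension. For the first,
    differentiation passes under the inner integral and the fundamental theorem of calculus applies;
    periodicity makes the endpoint values cancel. *)
Lemma torus_integral_pderiv N (j : 'I_N) (f : 'rV[R]_N -> R) :
  cper f -> (forall y, derivable f y (delta_mx 0 j)) -> cper (pderiv j f) ->
  torus_integral (pderiv j f) = 0.
Proof.
elim: N j f => [[]//|M IH] j f cf df cdf.
change (\int[@lebesgue_measure R]_(r in `[0, 2 * pi])
   torus_integral (@slice R M (pderiv j f) r) = 0).
case: (@split_ordP 1 M j) => k jE; rewrite jE {j jE} in df cdf *; last first.
  under eq_Rintegral => r _.
    have line y h : slice f r (h *: delta_mx 0 k + y) =
        f (h *: delta_mx 0 (rshift 1 k) + (row_mx (const_mx r : 'rV_1) y : 'rV[R]_(1 + M))).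
      by rewrite [in LHS]addrC /slice row_mx_shiftr addrC.
    have E : slice (pderiv (rshift 1 k) f) r = pderiv k (slice f r).
      apply/funext => y; rewrite /slice /pderiv.
      by rewrite (same_line (line y)).2.
    rewrite E IH; first over.
    - exact: slice_cper.
    - by move=> y; apply: (same_line (line y)).1; exact: df.
    - by rewrite -E; exact: slice_cper.
  by rewrite Rint_cst mul0r.
rewrite (ord1 k) {k} in df cdf *.
have [lin mon cst] := @torus_integral_spec R M.
pose G r := torus_integral (@slice R M (pderiv (lshift M (0 : 'I_1)) f) r).
pose F r := torus_integral (@slice R M f r).
have line r y (h : R) : (row_mx (const_mx (r + h) : 'rV_1) y : 'rV[R]_(1 + M)) =
    h *: delta_mx 0 (lshift M (0 : 'I_1)) + row_mx (const_mx r : 'rV_1) y.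
  by rewrite row_mx_shiftl addrC.
have p0 : (0 : R) < (2 * pi) ^+ M by rewrite exprn_gt0 ?two_pi_gt0.
(* Uniform continuity of the partial derivative makes the first-order remainder in [r] uniform over
   the slice, so it survives the inner integral. *)
have dF r : is_derive r (1 : R) F (G r).
  apply: is_derive_epsilon => e e0.
  have e1 : 0 < e / (2 * pi) ^+ M by rewrite divr_gt0.
  have [d d0 Hd] := cper_unif cdf e1.
  exists d => // h hd; rewrite [h *: _]mulr1 (addrC h) /F /G.
  set f0 := slice f r; set f1 := slice f (r + h); set g0 := slice _ r.
  have c0 : cper f0 by exact: slice_cper.
  have c1 : cper f1 by exact: slice_cper.
  have cg : cper g0 by exact: slice_cper.
  have -> : torus_integral f1 - torus_integral f0 - h * torus_integral g0 =
      torus_integral f1 - torus_integral (fun y => h * g0 y + f0 y).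
    by rewrite lin //; ring.
  have -> : `|h| * e = `|h| * (e / (2 * pi) ^+ M) * (2 * pi) ^+ M.
    by rewrite -mulrA divfK// lt0r_neq0.
  apply: torus_integral_approx => //.
    by apply: cperD => //; exact: cperZ.
  move=> y; rewrite (_ : f1 y - _ = f1 y - f0 y - h * g0 y); last by ring.
  rewrite /f1 /slice line; apply: line_estimate => // s sh.
  apply/ltW/Hd; rewrite addrK normrZ.
  apply: le_lt_trans hd; apply: le_trans sh.
  by rewrite ler_piMr // norm_delta_le1.
have cF : continuous F.
  by move=> r; have ? := dF r; apply/differentiable_continuous/derivable1_diffP.
have cG : continuous G.
  move=> r; apply/cvgrPdist_le => e e0.
  have e1 : 0 < e / (2 * pi) ^+ M by rewrite divr_gt0.
  have [d d0 Hd] := cper_unif cdf e1.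
  apply/nbhs_ballP; exists d => //= r' rr'.
  rewrite -[leRHS](divfK (lt0r_neq0 p0)).
  apply: torus_integral_approx; [exact: slice_cper|exact: slice_cper|] => y.
  by apply/ltW/Hd; apply: le_lt_trans rr'; exact: row_mx_distl.
have := @continuous_FTC2 R G F 0 (2 * pi) two_pi_gt0 (continuous_subspaceT cG).
rewrite -/(G) /Rintegral => -> //.
- rewrite -EFinB /=; have -> : F (2 * pi) = F 0; last by rewrite subrr.
  rewrite /F; congr torus_integral; apply/funext => y.
  by rewrite /slice -[2 * pi]add0r row_mx_shiftl cf.2.
- split.
  + by move=> r _; have ? := dF r.
  + exact/cvg_at_right_filter/cF.
  + exact/cvg_at_left_filter/cF.
- by move=> r _; rewrite derive1E; have ? := dF r; exact: derive_val.
Qed.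

End IntegralDerivative.

(** * Smooth functions *)

Section SmoothReal.
Context {R : realType} {N : nat}.
Implicit Types (f g : 'rV[R]_N -> R) (j : 'I_N).

(** Coinduction: it suffices to exhibit a class closed under partial derivatives whose members are
    continuous and derivable. No formula for iterated derivatives of products or series is then
    required. *)
Lemma smooth_coind (P : ('rV[R]_N -> R) -> Prop) :
  (forall f, P f -> [/\ continuous f, forall j y, derivable f y (delta_mx 0 j) &
                      forall j, P (pderiv j f)]) ->
  forall f, P f -> smooth f.
Proof.
move=> H f Pf s.
have {Pf} /H[cf df _] : P (iter_pderiv s f).
  by elim: s => //= j s IH; have [_ _] := H _ IH; exact.
by [].
Qed.

Lemma smooth_continuous f : smooth f -> continuous f.
Proof. by move=> /(_ [::])[]. Qed.

Lemma smooth_derivable f j y : smooth f -> derivable f y (delta_mx 0 j).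
Proof. by move=> /(_ [::])[_]; exact. Qed.

Lemma smooth_pderiv j f : smooth f -> smooth (pderiv j f).
Proof.
move=> sf s; rewrite (_ : iter_pderiv s (pderiv j f) = iter_pderiv (rcons s j) f) //.
by rewrite /iter_pderiv foldr_rcons.
Qed.

Lemma pderiv_cst j (c : R) : pderiv j (fun _ : 'rV[R]_N => c) = fun _ => 0.
Proof. by apply/funext => y; exact: derive_val. Qed.

Lemma pderivD j f g : smooth f -> smooth g ->
  pderiv j (fun y => f y + g y) = fun y => pderiv j f y + pderiv j g y.
Proof.
move=> sf sg; apply/funext => y.
by rewrite /pderiv -deriveD //; exact: smooth_derivable.
Qed.

Lemma pderivM j f g : smooth f -> smooth g ->
  pderiv j (fun y => f y * g y) = fun y => pderiv j f y * g y + f y * pderiv j g y.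
Proof.
move=> sf sg; apply/funext => y; rewrite /pderiv.
have := @deriveM R _ f g y (delta_mx 0 j) (@smooth_derivable f j y sf) (@smooth_derivable g j y sg).
by rewrite /GRing.scale /= [g y * _]mulrC [in RHS]addrC => <-.
Qed.

(** Leibniz turns a product into a sum of two products, so closure under both operations is what
    makes a class to which [smooth_coind] applies. *)
Inductive smooth_alg : ('rV[R]_N -> R) -> Prop :=
| smooth_alg_base f : smooth f -> smooth_alg f
| smooth_alg_add f g : smooth_alg f -> smooth_alg g -> smooth_alg (fun y => f y + g y)
| smooth_alg_mul f g : smooth_alg f -> smooth_alg g -> smooth_alg (fun y => f y * g y).

Lemma smooth_algP f : smooth_alg f -> smooth f.
Proof.
apply: smooth_coind => {}f; elim=> {f}.
- move=> f sf; split; [exact: smooth_continuous|by move=> *; exact: smooth_derivable|].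
  by move=> j; apply: smooth_alg_base; exact: smooth_pderiv.
- move=> f g _ [cf df pf] _ [cg dg pg]; split.
  + by move=> y; exact: (continuousD (cf y) (cg y)).
  + by move=> j y; exact: derivableD.
  + move=> j; rewrite (_ : pderiv j _ = fun y => pderiv j f y + pderiv j g y).
      exact: smooth_alg_add.
    by apply/funext => y; rewrite /pderiv -deriveD.
- move=> f g af [cf df pf] ag [cg dg pg]; split.
  + by move=> y; exact: (continuousM (cf y) (cg y)).
  + by move=> j y; exact: derivableM.
  + move=> j; rewrite (_ : pderiv j _ = fun y => pderiv j f y * g y + f y * pderiv j g y).
      by apply: smooth_alg_add; exact: smooth_alg_mul.
    apply/funext => y; rewrite /pderiv.
    have := @deriveM R _ f g y (delta_mx 0 j) (df _ _) (dg _ _).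
    by rewrite /GRing.scale /= [g y * _]mulrC [in RHS]addrC => <-.
Qed.

Lemma smooth_cst (c : R) : smooth (fun _ : 'rV[R]_N => c).
Proof.
apply: (@smooth_coind (fun f => exists c, f = fun _ => c)); last by exists c.
move=> _ [d ->]; split; [exact: cst_continuous|by move=> *; exact: ex_derive|].
by move=> j; exists 0; exact: pderiv_cst.
Qed.

Lemma Cinfty_cper f : Cinfty f -> cper f.
Proof. by move=> [sf pf]; split => //; exact: smooth_continuous. Qed.

Lemma Cinfty_cst (c : R) : Cinfty (fun _ : 'rV[R]_N => c).
Proof. by split; [exact: smooth_cst|]. Qed.

Lemma CinftyD f g : Cinfty f -> Cinfty g -> Cinfty (fun y => f y + g y).
Proof.
move=> [sf pf] [sg pg]; split; last by move=> j y; rewrite pf pg.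
by apply: smooth_algP; apply: smooth_alg_add; exact: smooth_alg_base.
Qed.

Lemma CinftyM f g : Cinfty f -> Cinfty g -> Cinfty (fun y => f y * g y).
Proof.
move=> [sf pf] [sg pg]; split; last by move=> j y; rewrite pf pg.
by apply: smooth_algP; apply: smooth_alg_mul; exact: smooth_alg_base.
Qed.

Lemma CinftyN f : Cinfty f -> Cinfty (fun y => - f y).
Proof.
move=> cf; rewrite (_ : (fun _ => _) = fun y => -1 * f y).
  by apply: CinftyM => //; exact: Cinfty_cst.
by apply/funext => y; rewrite mulN1r.
Qed.

Lemma pderivN j f : smooth f -> pderiv j (fun y => - f y) = fun y => - pderiv j f y.
Proof.
move=> sf; apply/funext => y; rewrite /pderiv -deriveN //; exact: smooth_derivable.
Qed.

Lemma pderiv_shift j f (v : 'rV[R]_N) y :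
  pderiv j (fun z => f (z + v)) y = pderiv j f (y + v).
Proof.
by rewrite /pderiv; apply: (same_line _).2 => h; rewrite addrA.
Qed.

Lemma Cinfty_pderiv j f : Cinfty f -> Cinfty (pderiv j f).
Proof.
move=> [sf pf]; split; first exact: smooth_pderiv.
by move=> k y; rewrite -pderiv_shift; congr pderiv; apply/funext => z; rewrite pf.
Qed.

Lemma Cinfty_integral_pderiv j f : Cinfty f -> torus_integral (pderiv j f) = 0.
Proof.
move=> cf; apply: torus_integral_pderiv; first exact: Cinfty_cper.
  by move=> y; apply: smooth_derivable; case: cf.
by apply/Cinfty_cper/Cinfty_pderiv.
Qed.

End SmoothReal.

(** * Real trigonometric modes *)

Section Trig.
Context {R : realType} {N : nat}.
Implicit Types (xi : 'rV[int]_N) (y : 'rV[R]_N) (j : 'I_N).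

Definition dot xi y : R := \sum_j (xi 0 j)%:~R * y 0 j.

Definition norm1 xi : R := \sum_j `|(xi 0 j)%:~R|.

Lemma norm1_ge0 xi : 0 <= norm1 xi.
Proof. exact: sumr_ge0. Qed.

Lemma coord_le_norm1 xi j : `|(xi 0 j)%:~R : R| <= norm1 xi.
Proof. by rewrite /norm1 (bigD1 j) //= lerDl sumr_ge0. Qed.

Lemma dotD xi y z : dot xi (y + z) = dot xi y + dot xi z.
Proof. by rewrite -big_split /=; apply: eq_bigr => j _; rewrite mxE mulrDr. Qed.

Lemma dotZ xi (h : R) y : dot xi (h *: y) = h * dot xi y.
Proof. by rewrite mulr_sumr; apply: eq_bigr => j _; rewrite mxE mulrCA. Qed.

Lemma dot_delta xi j : dot xi (delta_mx 0 j) = (xi 0 j)%:~R.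
Proof.
rewrite /dot (bigD1 j) //= big1 => [|k kj]; rewrite mxE ?eqxx ?mulr1 ?addr0//.
by rewrite (negbTE kj) mulr0.
Qed.

Lemma dot_addl xi xi' y : dot (xi + xi') y = dot xi y + dot xi' y.
Proof. by rewrite -big_split /=; apply: eq_bigr => j _; rewrite mxE intrD mulrDl. Qed.

Lemma dot_oppl xi y : dot (- xi) y = - dot xi y.
Proof. by rewrite /dot -sumrN; apply: eq_bigr => j _; rewrite mxE mulrNz mulNr. Qed.

Lemma dot_zerol y : dot 0 y = 0.
Proof. by rewrite /dot big1 // => j _; rewrite mxE mul0r. Qed.

Lemma dot_lip xi y z : `|dot xi y - dot xi z| <= norm1 xi * `|y - z|.
Proof.
have -> : dot xi y - dot xi z = dot xi (y - z) by rewrite dotD -[in RHS](scaleN1r z) dotZ mulN1r.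
rewrite /dot mulr_suml; apply: le_trans (ler_norm_sum _ _ _) _.
by apply: ler_sum => j _; rewrite normrM ler_wpM2l // coord_le_norm.
Qed.

Lemma dot_continuous xi : continuous (dot xi).
Proof.
apply: continuous_epsilon => y e e0.
have p : 0 < norm1 xi + 1 by rewrite ltr_wpDl // norm1_ge0.
exists (e / (norm1 xi + 1)); first exact: divr_gt0.
move=> z yz; apply: le_lt_trans (dot_lip _ _ _) _.
move: yz; rewrite ltr_pdivlMr // => yz; apply: le_lt_trans yz.
by rewrite mulrC ler_wpM2l // lerDl.
Qed.

(** The real span of one frequency: [pderiv j] keeps this form and sends [(al, be)] to
    [(be xi_j, - al xi_j)], so smoothness follows by coinduction. *)
Definition trig xi (al be : R) y : R := al * cos (dot xi y) + be * sin (dot xi y).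

Lemma trig_is_derive (a c al be s : R) : is_derive s (1 : R)
  (fun h : R => al * cos (h * c + a) + be * sin (h * c + a))
  (be * c * cos (s * c + a) - al * c * sin (s * c + a)).
Proof.
have aff (h : R) : is_derive h (1 : R) (fun h : R => h * c + a) c.
  have -> : (fun h : R => h * c + a) = (c \*: (id : R -> R)) + cst a.
    by apply/funext => t /=; rewrite mulrC.
  apply: is_derive_eq; by rewrite [_ *: _]mulr1 addr0.
have dc := @is_derive1_comp R cos (fun h => h * c + a) s _ _ (is_derive_cos _) (aff s).
have ds := @is_derive1_comp R sin (fun h => h * c + a) s _ _ (is_derive_sin _) (aff s).
have -> : (fun h : R => al * cos (h * c + a) + be * sin (h * c + a)) =
   (al \*: (cos \o (fun h => h * c + a))) + (be \*: (sin \o (fun h => h * c + a))).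
  by apply/funext.
apply: is_derive_eq; rewrite /GRing.scale /=; ring.
Qed.

Lemma trig_line xi al be j (h : R) y :
  trig xi al be (h *: delta_mx 0 j + y) =
  al * cos (h * (xi 0 j)%:~R + dot xi y) + be * sin (h * (xi 0 j)%:~R + dot xi y).
Proof. by rewrite /trig dotD dotZ dot_delta. Qed.

Lemma trig_derive xi al be j y :
  derivable (trig xi al be) y (delta_mx 0 j) /\
  pderiv j (trig xi al be) y =
    trig xi (be * (xi 0 j)%:~R) (- (al * (xi 0 j)%:~R)) y.
Proof.
have d := trig_is_derive (dot xi y) (xi 0 j)%:~R al be 0.
set g := fun h : R => _ in d.
have line h : trig xi al be (h *: delta_mx 0 j + y) = g (h *: (1 : R) + 0).
  by rewrite trig_line addr0 [_ *: _]mulr1.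
have [H1 H2] := same_line line.
split; first exact: H1.
by rewrite /pderiv H2 derive_val mul0r add0r /trig mulNr.
Qed.

Lemma trig_continuous xi al be : continuous (trig xi al be).
Proof.
move=> y.
have cc := continuous_comp (@dot_continuous xi y) (@continuous_cos R _).
have cs := continuous_comp (@dot_continuous xi y) (@continuous_sin R _).
exact: (continuousD (continuousM (@cst_continuous _ _ al y) cc)
  (continuousM (@cst_continuous _ _ be y) cs)).
Qed.

Lemma cos_sin_2piZ (x : R) (k : int) :
  cos (x + k%:~R * (2 * pi)) = cos x /\ sin (x + k%:~R * (2 * pi)) = sin x.
Proof.
have posn (n : nat) (z : R) : cos (z + n%:R * (2 * pi)) = cos z /\ sin (z + n%:R * (2 * pi)) = sin z.
  elim: n z => [|n IH] z; first by rewrite mul0r addr0.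
  rewrite -[n.+1%:R]natr1 mulrDl mul1r addrA [X in _ + X](_ : _ = pi *+ 2); last by rewrite mulr_natl.
  by rewrite cosD2pi sinD2pi; exact: IH.
case: k => n; first exact: posn.
rewrite NegzE mulrNz -pmulrn mulNr.
have [<- <-] := posn n.+1 (x - n.+1%:R * (2 * pi)).
by rewrite subrK.
Qed.

Lemma trig_periodic xi al be : periodic2pi (trig xi al be).
Proof.
move=> j y; rewrite /trig dotD dotZ dot_delta [2 * pi * _]mulrC.
by have [-> ->] := cos_sin_2piZ (dot xi y) (xi 0 j).
Qed.

Lemma Cinfty_trig xi al be : Cinfty (trig xi al be).
Proof.
split; last exact: trig_periodic.
apply: (@smooth_coind _ _ (fun f => exists al be, f = trig xi al be)); last by exists al, be.
move=> _ [a [b ->]]; split; first exact: trig_continuous.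
  by move=> j y; have [] := trig_derive xi a b j y.
move=> j; eexists; eexists; apply/funext => y.
by have [_ ->] := trig_derive xi a b j y.
Qed.

Lemma trig_bound xi al be y : `|trig xi al be y| <= `|al| + `|be|.
Proof.
apply: le_trans (ler_normD _ _) _; rewrite !normrM.
by apply: lerD; rewrite ler_piMr // ler_norml ?cos_geN1 ?cos_le1 ?sin_geN1 ?sin_le1.
Qed.

Lemma trig_estimate1 xi al be y z :
  `|trig xi al be y - trig xi al be z| <= (`|al| + `|be|) * norm1 xi * `|y - z|.
Proof.
have := @mvt_estimate R (fun h => al * cos (h * 1 + dot xi z) + be * sin (h * 1 + dot xi z))
  (fun s => be * 1 * cos (s * 1 + dot xi z) - al * 1 * sin (s * 1 + dot xi z)) 0
  (`|al| + `|be|) (dot xi y - dot xi z) (trig_is_derive (dot xi z) 1 al be).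
rewrite /= !mulr1 add0r subrK mulr0 subr0 => H.
apply: le_trans (H _) _ => [s _|].
  rewrite !mulr1 subr0; apply: le_trans (ler_normB _ _) _; rewrite !normrM addrC.
  by apply: lerD; rewrite ler_piMr // ler_norml ?cos_geN1 ?cos_le1 ?sin_geN1 ?sin_le1.
by rewrite mulrC -mulrA ler_wpM2l ?addr_ge0 // dot_lip.
Qed.

(** The remainder is quadratic in [h] at the price of two powers of the frequency, which rapidly
    decreasing coefficients can afford. This is the estimate behind termwise differentiation. *)
Lemma trig_estimate2 xi al be j y (h : R) :
  `|trig xi al be (h *: delta_mx 0 j + y) - trig xi al be y -
    h * pderiv j (trig xi al be) y| <=
  `|h| * (`|h| * ((`|al| + `|be|) * norm1 xi ^+ 2)).
Proof.
apply: line_estimate => [z|s sh]; first by have [] := trig_derive xi al be j z.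
rewrite -/(pderiv j _ _) !(trig_derive xi al be j _).2.
apply: le_trans (trig_estimate1 _ _ _ _ _) _; rewrite addrK normrN !normrM -mulrDl.
have n0 := norm1_ge0 xi.
rewrite normrZ expr2 [leRHS]mulrC -!mulrA (addrC `|be|).
apply: ler_wpM2l; first exact: addr_ge0.
apply: ler_pM => //; first by rewrite !mulr_ge0.
  exact: coord_le_norm1.
apply: ler_wpM2l => //.
by apply: le_trans sh; rewrite ler_piMr // norm_delta_le1.
Qed.

End Trig.

(** * Trigonometric series *)

Section LatticeSum.
Context {R : realType} {N : nat}.
Implicit Types (xi : 'rV[int]_N).

(* Sums over Z^N run over pickle codes; a natural number that codes no         *)
(* frequency contributes [0].                                                  *)
Definition lterm {V : nmodType} (F : 'rV[int]_N -> V) (i : nat) : V :=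
  if pickle_inv i is Some xi then F xi else 0.

(** A summable weight in product form, so that its sums over boxes of frequencies factor into
    one-dimensional sums. *)
Definition weight xi : R := \prod_j (1 + `|(xi 0 j)%:~R|) ^- 2.

Lemma weight_ge0 xi : 0 <= weight xi.
Proof. by apply: prodr_ge0 => j _; rewrite invr_ge0 exprn_ge0 // addr_ge0. Qed.

Lemma weight_norm1 xi : 1 <= weight xi * (1 + norm1 xi) ^+ (2 * N).
Proof.
rewrite /weight exprM -[X in _ ^+ X]card_ord -prodr_const -big_split /=.
elim/big_rec: _ => // j x _ x1; apply: mulr_ege1 => //; rewrite mulrC ler_pdivlMr ?mul1r.
  by apply: lerXn2r; rewrite ?nnegrE ?addr_ge0 ?norm1_ge0 // lerD2l coord_le_norm1.
by rewrite exprn_gt0 // ltr_pwDl.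
Qed.

Lemma sum_inv_sqr (m : nat) : \sum_(k < m) (1 + (k : nat)%:R) ^- 2 <= 2 :> R.
Proof.
case: m => [|m]; first by rewrite big_ord0.
(* The sharper bound with the term [m.+1%:R^-1] subtracted is the one that passes through the
   induction. *)
apply: (@le_trans _ _ (2 - m.+1%:R^-1)); last by rewrite gerBl invr_ge0.
elim: m => [|m IH]; first by rewrite big_ord_recr big_ord0 /= addr0 expr1n !invr1; lra.
rewrite big_ord_recr /= -lerBrDr; apply: le_trans IH _.
rewrite -subr_ge0 -!natr1.
have m0 : (0 : R) <= m%:R by [].
set x := (m%:R : R) in m0 *.
rewrite (_ : _ - _ = ((x + 1) * (x + 1 + 1) ^+ 2)^-1); first by rewrite invr_ge0 mulr_ge0 ?exprn_ge0 //; lra.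
by field; apply/andP; split; apply: lt0r_neq0; lra.
Qed.

(** A finite list of frequencies lies in a box, whose points are encoded by a sign and an absolute
    value in each coordinate. Over all codes the sum factors, and each coordinate contributes at
    most 2 for each sign. The value 0 is coded under both signs, which only enlarges the sum. *)
Lemma weight_sum_seq (L : seq 'rV[int]_N) : uniq L -> \sum_(xi <- L) weight xi <= 4 ^+ N.
Proof.
move=> uL.
pose ab (xi : 'rV[int]_N) (j : 'I_N) : nat := absz (xi 0%R j).
pose B := \max_(xi <- L) \max_(j < N) ab xi j.
have LB xi j : xi \in L -> (ab xi j < B.+1)%N.
  move=> xL; rewrite ltnS /B (big_rem _ xL) /=; apply: leq_trans (leq_maxl _ _).
  by rewrite (bigD1 j) //= leq_maxl.
pose T := {ffun 'I_N -> bool * 'I_B.+1}.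
pose h xi : T := [ffun j => (xi 0 j < 0, inord (ab xi j))].
pose g (f : T) : 'rV[int]_N := \row_j ((-1) ^+ (f j).1 * ((f j).2 : nat)%:Z).
have gh xi : xi \in L -> g (h xi) = xi.
  move=> xL; apply/rowP => j; rewrite mxE ffunE /= inordK ?LB //.
  by rewrite [RHS]intEsign.
have -> : \sum_(xi <- L) weight xi = \sum_(f <- map h L) weight (g f).
  by rewrite big_map; apply: eq_big_seq => xi xL; rewrite gh.
have uhL : uniq (map h L).
  rewrite map_inj_in_uniq // => x y xL yL E.
  by rewrite -(gh x xL) -(gh y yL) E.
rewrite big_uniq //=.
apply: (@le_trans _ _ (\sum_f weight (g f))).
  by rewrite [leRHS](bigID (mem (map h L))) /= lerDl sumr_ge0 // => f _; exact: weight_ge0.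
have -> : \sum_f weight (g f) = \prod_(j < N) \sum_(p : bool * 'I_B.+1)
     (1 + ((p.2 : nat)%:R : R)) ^- 2.
  rewrite bigA_distr_bigA /=; apply: eq_bigr => f _; apply: eq_bigr => j _.
  rewrite mxE; congr ((1 + _) ^- 2).
  by rewrite rmorphM rmorph_sign normrM normr_sign mul1r normr_nat.
rewrite -[X in _ ^+ X](card_ord N) -prodr_const; apply: ler_prod => j _.
rewrite sumr_ge0 => [|p _]; last by rewrite invr_ge0 exprn_ge0 // addr_ge0.
rewrite -(pair_bigA _ (fun (b : bool) (k : 'I_B.+1) => (1 + ((k : nat)%:R : R)) ^- 2)) /=.
rewrite sumr_const card_bool.
by have := sum_inv_sqr B.+1; rewrite mulr2n; lra.
Qed.

Lemma lterm_sum {V : nmodType} (F : 'rV[int]_N -> V) m :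
  exists2 L : seq 'rV[int]_N, uniq L & \sum_(0 <= i < m) lterm F i = \sum_(xi <- L) F xi.
Proof.
exists (pmap (@pickle_inv 'rV[int]_N) (iota 0 m)).
  have : uniq (iota 0 m) by exact: iota_uniq.
  elim: (iota 0 m) => //= i s IH /andP[iS uS].
  case E: (pickle_inv i) => [xi|] /=; last exact: IH.
  rewrite IH // andbT; apply: contra iS.
  have inv (j : nat) z : pickle_inv j = Some z -> pickle (z : 'rV[int]_N) = j.
    by have /= := @pickle_invK 'rV[int]_N j => H Ez; rewrite Ez /= in H.
  by rewrite mem_pmap => /mapP[k ks Ek]; rewrite -(inv _ _ E) (inv k) // -Ek.
rewrite /index_iota subn0; elim: (iota 0 m) => [|i s IH] /=; first by rewrite !big_nil.
rewrite big_cons IH /lterm; case: (pickle_inv i) => [xi|] /=; last by rewrite add0r.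
by rewrite big_cons.
Qed.

Lemma weight_series_le m : series (lterm weight) m <= 4 ^+ N.
Proof. by have [L uL E] := lterm_sum weight m; rewrite /series /= E weight_sum_seq. Qed.

Lemma lterm_weight_ge0 i : 0 <= lterm weight i.
Proof. by rewrite /lterm; case: pickle_inv => // xi; exact: weight_ge0. Qed.

Lemma weight_cvg : cvgn (series (lterm weight)).
Proof.
apply: nondecreasing_is_cvgn.
  by apply/nondecreasing_series => i _ _; exact: lterm_weight_ge0.
by exists (4 ^+ N) => _ [m _ <-]; exact: weight_series_le.
Qed.

(** One modulus of convergence for all series dominated by a multiple of [weight], uniform in the
    point at which they are evaluated. *)
Definition tail m : R := limn (series (lterm weight)) - series (lterm weight) m.

Lemma tail_cvg0 : tail @ \oo --> (0 : R).
Proof.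
rewrite -(subrr (limn (series (lterm weight)))).
exact: (cvgB (cvg_cst _) weight_cvg).
Qed.

Lemma cvg_norm_le (u : nat -> R) (l B : R) (m : nat) :
  u @ \oo --> l -> (forall i, (m <= i)%N -> `|u i| <= B) -> `|l| <= B.
Proof.
move=> ul uB.
have nl : (fun i => `|u i|) @ \oo --> `|l| by exact: cvg_norm.
rewrite -(cvg_lim _ nl) //; apply: limr_le; first by apply/cvg_ex; exists `|l|.
by exists m => // i; exact: uB.
Qed.

Lemma dominated_series (t : nat -> R) (A : R) :
  (forall i, `|t i| <= A * lterm weight i) ->
  series t @ \oo --> limn (series t) /\
  forall m, `|limn (series t) - series t m| <= A * tail m.
Proof.
move=> H.
have cA : series (fun i => A * lterm weight i) @ \oo --> A * limn (series (lterm weight)).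
  rewrite (_ : series _ = fun m => A * series (lterm weight) m).
    exact: (cvgM (cvg_cst _) weight_cvg).
  by apply/funext => m; rewrite /series /= mulr_sumr.
have ct : cvgn (series t).
  apply: normed_cvg; apply: (series_le_cvg _ _ H) => //.
    by move=> n; apply: le_trans (H n).
  by apply/cvg_ex; eexists; exact: cA.
split=> // m.
have cm : (fun M => series t M - series t m) @ \oo --> limn (series t) - series t m.
  by apply: cvgB => //; exact: cvg_cst.
apply: (cvg_norm_le (m := m) cm) => M mM.
rewrite sub_series_geq //; apply: le_trans (ler_norm_sum _ _ _) _.
apply: (@le_trans _ _ (\sum_(m <= k < M) A * lterm weight k)); first by apply: ler_sum.
have Aw0 i : 0 <= A * lterm weight i by apply: le_trans (H i).
have le M' : series (fun i => A * lterm weight i) M' <= A * limn (series (lterm weight)).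
  rewrite -(cvg_lim _ cA) //; apply: nondecreasing_cvgn_le.
    by apply/nondecreasing_series => i _ _.
  by apply/cvg_ex; eexists; exact: cA.
rewrite -sub_series_geq // /tail mulrBr; apply: lerB => //.
by rewrite /series /= mulr_sumr.
Qed.

End LatticeSum.

(** * Trigonometric series with rapidly decreasing coefficients *)

Section TrigSeries.
Context {R : realType} {N : nat}.
Implicit Types (xi : 'rV[int]_N) (al be c : 'rV[int]_N -> R) (y z : 'rV[R]_N).

Definition rapid c : Prop :=
  forall s : nat, exists C : R, forall xi, `|c xi| * (1 + norm1 xi) ^+ s <= C.

Lemma onenorm_ge1 xi : 1 <= 1 + norm1 xi :> R.
Proof. by rewrite lerDl norm1_ge0. Qed.

Lemma onenorm_gt0 xi : 0 < 1 + norm1 xi :> R.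
Proof. exact: lt_le_trans (onenorm_ge1 _). Qed.

Lemma rapidN c : rapid c -> rapid (fun xi => - c xi).
Proof. by move=> rc s; have [C HC] := rc s; exists C => xi; rewrite normrN. Qed.

Lemma rapid_coord c (j : 'I_N) : rapid c -> rapid (fun xi => c xi * (xi 0 j)%:~R).
Proof.
move=> rc s; have [C HC] := rc s.+1; exists C => xi.
apply: le_trans (HC xi); rewrite normrM exprS mulrA.
apply: ler_wpM2r; first by rewrite exprn_ge0 // ltW // onenorm_gt0.
apply: ler_wpM2l => //; apply: le_trans (coord_le_norm1 _ _) _.
by rewrite lerDr.
Qed.

(** Of the available powers of the frequency, [s] are kept for derivatives and [2 * N] are traded
    for [weight] through [weight_norm1]. *)
Lemma rapid_weight c (s : nat) : rapid c ->
  exists2 A, 0 <= A & forall xi, `|c xi| * norm1 xi ^+ s <= A * weight xi.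
Proof.
move=> rc; have [C HC] := rc (s + 2 * N)%N.
exists `|C| => // xi.
have n0 := norm1_ge0 (R := R) xi.
have h : `|c xi| * norm1 xi ^+ s <= `|c xi| * norm1 xi ^+ s * (weight xi * (1 + norm1 xi) ^+ (2 * N)).
  by rewrite ler_peMr ?weight_norm1 // mulr_ge0 // exprn_ge0.
apply: le_trans h _; rewrite (mulrC (weight xi)) mulrA; apply: ler_wpM2r.
  exact: weight_ge0.
apply: le_trans (ler_norm C); apply: le_trans (HC xi).
rewrite exprD mulrA; apply: ler_wpM2r.
  by rewrite exprn_ge0 // ltW // onenorm_gt0.
apply: ler_wpM2l => //; apply: lerXn2r; rewrite ?nnegrE ?addr_ge0 //.
by rewrite lerDr.
Qed.

Lemma lterm_norm (F : 'rV[int]_N -> R) (B : R) i :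
  (forall xi, `|F xi| <= B * weight xi) -> `|lterm F i| <= B * lterm (@weight R N) i.
Proof.
by move=> H; rewrite /lterm; case: pickle_inv => [xi|]; rewrite ?normr0 ?mulr0.
Qed.

Lemma series_lterm_norm (F : 'rV[int]_N -> R) (B : R) m : 0 <= B ->
  (forall xi, `|F xi| <= B * weight xi) -> `|series (lterm F) m| <= B * 4 ^+ N.
Proof.
move=> B0 H; apply: le_trans (ler_norm_sum _ _ _) _.
apply: (@le_trans _ _ (\sum_(0 <= i < m) B * lterm (@weight R N) i)).
  by apply: ler_sum => i _; exact: lterm_norm.
by rewrite -mulr_sumr; apply: ler_wpM2l => //; exact: weight_series_le.
Qed.

Lemma series_ltermB (F G : 'rV[int]_N -> R) m :
  series (lterm F) m - series (lterm G) m = series (lterm (fun xi => F xi - G xi)) m.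
Proof.
rewrite /series /= -sumrB; apply: eq_bigr => i _.
by rewrite /lterm; case: pickle_inv => //; rewrite subrr.
Qed.

Lemma series_ltermZ (h : R) (F : 'rV[int]_N -> R) m :
  h * series (lterm F) m = series (lterm (fun xi => h * F xi)) m.
Proof.
rewrite /series /= mulr_sumr; apply: eq_bigr => i _.
by rewrite /lterm; case: pickle_inv => //; rewrite mulr0.
Qed.

Definition tterm al be y : nat -> R := lterm (fun xi => trig xi (al xi) (be xi) y).
Definition tpart m al be y : R := series (tterm al be y) m.
Definition tseries al be y : R := limn (series (tterm al be y)).

Lemma rapid2_weight al be (s : nat) : rapid al -> rapid be ->
  exists2 A, 0 <= A & forall xi, (`|al xi| + `|be xi|) * norm1 xi ^+ s <= A * weight xi.
Proof.
move=> /(rapid_weight s)[A A0 HA] /(rapid_weight s)[B B0 HB].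
exists (A + B) => [|xi]; first exact: addr_ge0.
by rewrite !mulrDl lerD.
Qed.

Lemma tseries_cvg al be y : rapid al -> rapid be ->
  (fun m => tpart m al be y) @ \oo --> tseries al be y.
Proof.
move=> ra rb; have [A A0 HA] := rapid2_weight 0 ra rb.
have [] // := @dominated_series R N (tterm al be y) A.
move=> i; apply: lterm_norm => xi; apply: le_trans (trig_bound _ _ _ _) _.
by have := HA xi; rewrite expr0 mulr1.
Qed.

Lemma tseries_tail al be (A : R) y m :
  (forall xi, `|al xi| + `|be xi| <= A * weight xi) ->
  `|tseries al be y - tpart m al be y| <= A * tail (N := N) m.
Proof.
move=> HA; suff H i : `|tterm al be y i| <= A * lterm (@weight R N) i.
  by have [_] := dominated_series H; apply.
by apply: lterm_norm => xi; exact: le_trans (trig_bound _ _ _ _) _.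
Qed.

Lemma tpart_bound al be (A : R) y m : 0 <= A ->
  (forall xi, `|al xi| + `|be xi| <= A * weight xi) ->
  `|tpart m al be y| <= A * 4 ^+ N.
Proof.
move=> A0 HA; apply: series_lterm_norm => // xi.
exact: le_trans (trig_bound _ _ _ _) _.
Qed.

Lemma tseries_bound al be (A : R) y : rapid al -> rapid be -> 0 <= A ->
  (forall xi, `|al xi| + `|be xi| <= A * weight xi) ->
  `|tseries al be y| <= A * 4 ^+ N.
Proof.
move=> ra rb A0 HA.
apply: (cvg_norm_le (m := 0) (tseries_cvg (y := y) ra rb)) => m _.
exact: tpart_bound.
Qed.

Lemma tseries_continuous al be : rapid al -> rapid be -> continuous (tseries al be).
Proof.
move=> ra rb; have [A A0 HA] := rapid2_weight 1 ra rb.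
have lip y z : `|tseries al be y - tseries al be z| <= A * `|y - z| * 4 ^+ N.
  have cB : (fun m => tpart m al be y - tpart m al be z) @ \oo -->
      tseries al be y - tseries al be z.
    by apply: cvgB; exact: tseries_cvg.
  apply: (cvg_norm_le (m := 0) cB) => m _.
  rewrite series_ltermB; apply: series_lterm_norm; first by rewrite mulr_ge0.
  move=> xi; apply: le_trans (trig_estimate1 _ _ _ _ _) _.
  by rewrite [leRHS]mulrAC; apply: ler_wpM2r => //; have := HA xi; rewrite expr1.
apply: continuous_epsilon => y e e0.
have p : 0 < A * 4 ^+ N + 1 by rewrite ltr_wpDl // mulr_ge0 // exprn_ge0.
exists (e / (A * 4 ^+ N + 1)); first exact: divr_gt0.
move=> z yz; apply: le_lt_trans (lip _ _) _.
move: yz; rewrite ltr_pdivlMr // => yz; apply: le_lt_trans yz.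
by rewrite mulrAC mulrC ler_wpM2l // lerDl.
Qed.

Definition dal (j : 'I_N) be : 'rV[int]_N -> R := fun xi => be xi * (xi 0 j)%:~R.
Definition dbe (j : 'I_N) al : 'rV[int]_N -> R := fun xi => - (al xi * (xi 0 j)%:~R).

Lemma rapid_dal j be : rapid be -> rapid (dal j be).
Proof. exact: rapid_coord. Qed.

Lemma rapid_dbe j al : rapid al -> rapid (dbe j al).
Proof. by move=> ra; apply: rapidN; exact: rapid_coord. Qed.

(** The quadratic remainders of the single modes sum to a bound uniform in the length of the partial
    sum, and this bound passes to the limit. *)
Lemma tseries_is_derive al be j y : rapid al -> rapid be ->
  is_derive y (delta_mx 0 j) (tseries al be) (tseries (dal j be) (dbe j al) y).
Proof.
move=> ra rb; have [A A0 HA] := rapid2_weight 2 ra rb.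
apply: is_derive_epsilon => e e0.
have p : 0 < A * 4 ^+ N + 1 by rewrite ltr_wpDl // mulr_ge0 // exprn_ge0.
exists (e / (A * 4 ^+ N + 1)); first exact: divr_gt0.
move=> h hd.
have cB : (fun m => tpart m al be (h *: delta_mx 0 j + y) - tpart m al be y -
      h * tpart m (dal j be) (dbe j al) y) @ \oo -->
    tseries al be (h *: delta_mx 0 j + y) - tseries al be y -
    h * tseries (dal j be) (dbe j al) y.
  apply: cvgB; first by apply: cvgB; exact: tseries_cvg.
  apply: (cvgM (cvg_cst _)); apply: tseries_cvg; [exact: rapid_dal|exact: rapid_dbe].
apply: (@le_trans _ _ (`|h| * (`|h| * A) * 4 ^+ N)).
  apply: (cvg_norm_le (m := 0) cB) => m _.
  rewrite series_ltermB series_ltermZ series_ltermB.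
  apply: series_lterm_norm; first by rewrite !mulr_ge0.
  move=> xi; have := trig_estimate2 xi (al xi) (be xi) j y h.
  rewrite (trig_derive xi (al xi) (be xi) j y).2 => H; apply: le_trans H _.
  by rewrite -!mulrA; apply: ler_wpM2l => //; apply: ler_wpM2l => //; exact: HA.
rewrite -!mulrA; apply: ler_wpM2l => //.
move: hd; rewrite ltr_pdivlMr // => hd; apply: le_trans (ltW hd).
by apply: ler_wpM2l => //; rewrite lerDl.
Qed.

Lemma pderiv_tseries al be j : rapid al -> rapid be ->
  pderiv j (tseries al be) = tseries (dal j be) (dbe j al).
Proof.
move=> ra rb; apply/funext => y.
by have ? := tseries_is_derive j y ra rb; exact: derive_val.
Qed.

Lemma Cinfty_tseries al be : rapid al -> rapid be -> Cinfty (tseries al be).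
Proof.
move=> ra rb; split.
  apply: (@smooth_coind _ _ (fun f => exists al be, [/\ rapid al, rapid be & f = tseries al be])).
    move=> _ [a [b [{}ra {}rb ->]]]; split; first exact: tseries_continuous.
      by move=> j y; have ? := tseries_is_derive j y ra rb; exact: ex_derive.
    move=> j; exists (dal j b), (dbe j a); split; [exact: rapid_dal|exact: rapid_dbe|].
    exact: pderiv_tseries.
  by exists al, be.
move=> j y; rewrite /tseries; congr (limn (series _)); apply/funext => i.
by rewrite /tterm /lterm; case: pickle_inv => // xi; exact: trig_periodic.
Qed.

Lemma tpartS m al be :
  tpart m.+1 al be = fun y => tpart m al be y + tterm al be y m.
Proof. by apply/funext => y; rewrite /tpart /series /= big_nat_recr. Qed.

Lemma Cinfty_tterm al be i : Cinfty (fun y => tterm al be y i).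
Proof.
rewrite /tterm /lterm; case: pickle_inv => [xi|]; first exact: Cinfty_trig.
exact: Cinfty_cst.
Qed.

Lemma pderiv_tterm al be i j :
  pderiv j (fun y => tterm al be y i) = fun y => tterm (dal j be) (dbe j al) y i.
Proof.
rewrite /tterm /lterm; case: pickle_inv => [xi|]; last exact: pderiv_cst.
by apply/funext => y; have [_ ->] := trig_derive xi (al xi) (be xi) j y.
Qed.

Lemma tpart0 al be : tpart 0 al be = fun _ => 0.
Proof. by apply/funext => y; rewrite /tpart /series /= big_nil. Qed.

Lemma Cinfty_tpart m al be : Cinfty (tpart m al be).
Proof.
elim: m => [|m IH]; first by rewrite tpart0; exact: Cinfty_cst.
by rewrite tpartS; apply: CinftyD => //; exact: Cinfty_tterm.
Qed.

Lemma pderiv_tpart m al be j :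
  pderiv j (tpart m al be) = tpart m (dal j be) (dbe j al).
Proof.
elim: m => [|m IH]; first by rewrite !tpart0 pderiv_cst.
rewrite !tpartS pderivD ?IH ?pderiv_tterm //; first by case: (Cinfty_tpart m al be).
by case: (Cinfty_tterm al be m).
Qed.

End TrigSeries.

(** * Complex-valued smooth functions *)

Section ComplexNorm.
Context {R : realType}.
Implicit Types x y : R[i].
Local Notation Re := complex.Re.
Local Notation Im := complex.Im.
Local Notation normc := Normc.normc.

Lemma Re_mul x y : Re (x * y) = Re x * Re y - Im x * Im y.
Proof. by case: x y => [a b] [c d]. Qed.

Lemma Im_mul x y : Im (x * y) = Re x * Im y + Im x * Re y.
Proof. by case: x y => [a b] [c d]. Qed.

Lemma Re_add x y : Re (x + y) = Re x + Re y.
Proof. by case: x y => [a b] [c d]. Qed.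

Lemma Im_add x y : Im (x + y) = Im x + Im y.
Proof. by case: x y => [a b] [c d]. Qed.

Lemma Re_opp x : Re (- x) = - Re x. Proof. by case: x. Qed.
Lemma Im_opp x : Im (- x) = - Im x. Proof. by case: x. Qed.
Lemma Re_conjc x : Re (x^*)%C = Re x. Proof. by case: x. Qed.
Lemma Im_conjc x : Im (x^*)%C = - Im x. Proof. by case: x. Qed.

Lemma conj_add x y : ((x + y)^*)%C = (x^*)%C + (y^*)%C.
Proof. by case: x y => [a b] [c d] /=; congr (_ +i* _); rewrite opprD. Qed.

Lemma conj_opp x : ((- x)^*)%C = - (x^*)%C.
Proof. by case: x. Qed.

Lemma conj_mul x y : ((x * y)^*)%C = (x^*)%C * (y^*)%C.
Proof.
by case: x y => [a b] [c d] /=; congr (_ +i* _); rewrite ?mulrNN // opprD mulrN mulNr.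
Qed.

Lemma complexP x y : Re x = Re y -> Im x = Im y -> x = y.
Proof. by case: x y => [a b] [c d] /= -> ->. Qed.

Lemma normc_ge0 x : 0 <= normc x.
Proof. by case: x => a b; exact: sqrtr_ge0. Qed.

Lemma normc_sqr x : normc x ^+ 2 = Re x ^+ 2 + Im x ^+ 2.
Proof. by case: x => a b /=; rewrite sqr_sqrtr // addr_ge0 // sqr_ge0. Qed.

Lemma normcD x y : normc (x + y) <= normc x + normc y.
Proof. exact: le_normcD. Qed.

Lemma normcM x y : normc (x * y) = normc x * normc y.
Proof. exact: Normc.normcM. Qed.

Lemma normc_opp x : normc (- x) = normc x.
Proof. by case: x => a b; rewrite /= !sqrrN. Qed.

Lemma normc_conj x : normc (x^*)%C = normc x.
Proof. by case: x => a b; rewrite /= !sqrrN. Qed.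

Lemma normc_real (r : R) : normc r%:C = `|r|.
Proof. by rewrite /= expr0n /= addr0 sqrtr_sqr. Qed.

Definition imagc (r : R) : R[i] := 0 +i* r.

Lemma normc_imag (r : R) : normc (imagc r) = `|r|.
Proof. by rewrite /= expr0n /= add0r sqrtr_sqr. Qed.

Lemma Re_le_normc x : `|Re x| <= normc x.
Proof.
rewrite -(@ler_pXn2r _ 2) ?nnegrE ?normc_ge0 //.
by rewrite normc_sqr real_normK ?num_real // lerDl sqr_ge0.
Qed.

Lemma Im_le_normc x : `|Im x| <= normc x.
Proof.
rewrite -(@ler_pXn2r _ 2) ?nnegrE ?normc_ge0 //.
by rewrite normc_sqr real_normK ?num_real // lerDr sqr_ge0.
Qed.

Lemma normc_le_ReIm x : normc x <= `|Re x| + `|Im x|.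
Proof.
rewrite -(@ler_pXn2r _ 2) ?nnegrE ?normc_ge0 ?addr_ge0 //.
rewrite normc_sqr sqrrD !real_normK ?num_real //.
by rewrite addrAC lerDl mulrn_wge0 // mulr_ge0.
Qed.

Lemma normc_eq0 x : (forall e : R, 0 < e -> normc x <= e) -> x = 0.
Proof.
move=> H; apply: Normc.eq0_normc; apply/eqP; rewrite eq_le normc_ge0 andbT.
by apply/ler_addgt0Pl => e e0; rewrite addr0; exact: H.
Qed.

End ComplexNorm.

Section SmoothComplex.
Context {R : realType} {N : nat}.
Implicit Types (f g : 'rV[R]_N -> R[i]) (j : 'I_N).
Local Notation Re := complex.Re.
Local Notation Im := complex.Im.
Local Notation normc := Normc.normc.

Lemma re_funD f g : re_fun (fun y => f y + g y) = fun y => re_fun f y + re_fun g y.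
Proof. by apply/funext => y; rewrite /re_fun Re_add. Qed.

Lemma im_funD f g : im_fun (fun y => f y + g y) = fun y => im_fun f y + im_fun g y.
Proof. by apply/funext => y; rewrite /im_fun Im_add. Qed.

Lemma re_funM f g : re_fun (fun y => f y * g y) =
  fun y => re_fun f y * re_fun g y + - (im_fun f y * im_fun g y).
Proof. by apply/funext => y; rewrite /re_fun Re_mul. Qed.

Lemma im_funM f g : im_fun (fun y => f y * g y) =
  fun y => re_fun f y * im_fun g y + im_fun f y * re_fun g y.
Proof. by apply/funext => y; rewrite /im_fun Im_mul. Qed.

Lemma CinftyC_cst (c : R[i]) : CinftyC (fun _ : 'rV[R]_N => c).
Proof. by split; exact: Cinfty_cst. Qed.

Lemma CinftyC_D f g : CinftyC f -> CinftyC g -> CinftyC (fun y => f y + g y).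
Proof.
by move=> [rf if_] [rg ig]; split; rewrite ?re_funD ?im_funD; exact: CinftyD.
Qed.

Lemma CinftyC_M f g : CinftyC f -> CinftyC g -> CinftyC (fun y => f y * g y).
Proof.
move=> [rf if_] [rg ig]; split; rewrite ?re_funM ?im_funM; apply: CinftyD.
- exact: CinftyM.
- by apply: CinftyN; exact: CinftyM.
- exact: CinftyM.
- exact: CinftyM.
Qed.

Lemma CinftyC_Z (c : R[i]) f : CinftyC f -> CinftyC (fun y => c * f y).
Proof. by move=> sf; apply: CinftyC_M => //; exact: CinftyC_cst. Qed.

Lemma CinftyC_N f : CinftyC f -> CinftyC (fun y => - f y).
Proof.
move=> sf; rewrite (_ : (fun _ => _) = fun y => -1 * f y); first exact: CinftyC_Z.
by apply/funext => y; rewrite mulN1r.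
Qed.

Lemma CinftyC_B f g : CinftyC f -> CinftyC g -> CinftyC (fun y => f y - g y).
Proof. by move=> sf sg; apply: CinftyC_D => //; exact: CinftyC_N. Qed.

Lemma CinftyC_conj f : CinftyC f -> CinftyC (fun y => ((f y)^*)%C).
Proof.
move=> [rf if_]; split.
  by rewrite (_ : re_fun _ = re_fun f) //; apply/funext => y; rewrite /re_fun Re_conjc.
rewrite (_ : im_fun _ = fun y => - im_fun f y); first exact: CinftyN.
by apply/funext => y; rewrite /im_fun Im_conjc.
Qed.

Lemma CinftyC_real (b : 'rV[R]_N -> R) : Cinfty b -> CinftyC (fun y => (b y)%:C).
Proof. by move=> sb; split => //; exact: Cinfty_cst. Qed.

Lemma CinftyC_pderiv j f : CinftyC f -> CinftyC (pderivC j f).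
Proof. by move=> [rf if_]; split; exact: Cinfty_pderiv. Qed.

Lemma CinftyC_sum (I : Type) (r : seq I) (F : I -> 'rV[R]_N -> R[i]) :
  (forall i, CinftyC (F i)) -> CinftyC (fun y => \sum_(i <- r) F i y).
Proof.
move=> H; elim: r => [|i r IH].
  rewrite (_ : (fun _ => _) = fun _ => 0); first exact: CinftyC_cst.
  by apply/funext => y; rewrite big_nil.
rewrite (_ : (fun _ => _) = fun y => F i y + \sum_(i <- r) F i y); first exact: CinftyC_D.
by apply/funext => y; rewrite big_cons.
Qed.

Lemma pderivC_cst j (c : R[i]) : pderivC j (fun _ : 'rV[R]_N => c) = fun _ => 0.
Proof.
apply/funext => y; rewrite /pderivC.
have -> : re_fun (fun _ : 'rV[R]_N => c) = fun _ => Re c by [].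
have -> : im_fun (fun _ : 'rV[R]_N => c) = fun _ => Im c by [].
by rewrite !pderiv_cst.
Qed.

Lemma pderivC_D j f g : CinftyC f -> CinftyC g ->
  pderivC j (fun y => f y + g y) = fun y => pderivC j f y + pderivC j g y.
Proof.
move=> [[rf _] [if_ _]] [[rg _] [ig _]]; apply/funext => y.
by rewrite /pderivC re_funD im_funD !pderivD.
Qed.

Lemma pderivC_M j f g : CinftyC f -> CinftyC g ->
  pderivC j (fun y => f y * g y) = fun y => pderivC j f y * g y + f y * pderivC j g y.
Proof.
move=> [rf if_] [rg ig]; apply/funext => y.
have sm (p q : 'rV[R]_N -> R) : Cinfty p -> Cinfty q -> smooth (fun y => p y * q y).
  by move=> sp sq; have [] := CinftyM sp sq.
rewrite /pderivC re_funM im_funM !pderivD; last 4 first.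
- exact: sm.
- exact: sm.
- exact: sm.
- by have [] := CinftyN (CinftyM if_ ig).
rewrite pderivN; last exact: sm.
case: rf if_ rg ig => [rf _] [if_ _] [rg _] [ig _].
rewrite !pderivM //; apply: complexP => /=; rewrite ?Re_add ?Im_add ?Re_mul ?Im_mul /=.
  by rewrite /re_fun /im_fun; ring.
by rewrite /re_fun /im_fun; ring.
Qed.

Lemma pderivC_Z j (c : R[i]) f : CinftyC f ->
  pderivC j (fun y => c * f y) = fun y => c * pderivC j f y.
Proof.
move=> sf; rewrite pderivC_M //; last exact: CinftyC_cst.
by apply/funext => y; rewrite pderivC_cst mul0r add0r.
Qed.

Lemma pderivC_N j f : CinftyC f -> pderivC j (fun y => - f y) = fun y => - pderivC j f y.
Proof.
move=> sf; rewrite (_ : (fun _ => _) = fun y => -1 * f y).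
  by rewrite pderivC_Z //; apply/funext => y; rewrite mulN1r.
by apply/funext => y; rewrite mulN1r.
Qed.

Lemma pderivC_conj j f : CinftyC f ->
  pderivC j (fun y => ((f y)^*)%C) = fun y => ((pderivC j f y)^*)%C.
Proof.
move=> [[rf _] [if_ _]]; apply/funext => y; rewrite /pderivC.
rewrite (_ : re_fun _ = re_fun f); last by apply/funext => z; rewrite /re_fun Re_conjc.
rewrite (_ : im_fun _ = fun y => - im_fun f y); last by apply/funext => z; rewrite /im_fun Im_conjc.
by rewrite pderivN.
Qed.

Lemma pderivC_real j (b : 'rV[R]_N -> R) :
  pderivC j (fun y => (b y)%:C) = fun y => (pderiv j b y)%:C.
Proof.
apply/funext => y; rewrite /pderivC.
have -> : im_fun (fun y => (b y)%:C) = fun _ => 0 by [].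
by rewrite pderiv_cst.
Qed.

Lemma integralC_lin (c : R[i]) f g : CinftyC f -> CinftyC g ->
  torus_integralC (fun y => c * f y + g y) = c * torus_integralC f + torus_integralC g.
Proof.
move=> sf sg; have [lin _ _] := @torus_integral_spec R N.
case: sf sg => /Cinfty_cper rf /Cinfty_cper if_ [/Cinfty_cper rg /Cinfty_cper ig].
rewrite /torus_integralC re_funD im_funD re_funM im_funM.
have -> : re_fun (fun _ : 'rV[R]_N => c) = fun _ => Re c by [].
have -> : im_fun (fun _ : 'rV[R]_N => c) = fun _ => Im c by [].
have lin2 (a b : R) (p q r : 'rV[R]_N -> R) : cper p -> cper q -> cper r ->
    torus_integral (fun y => a * p y + b * q y + r y) =
    a * torus_integral p + b * torus_integral q + torus_integral r.
  move=> cp cq cr; rewrite -addrA -lin // -lin //; last by apply: cperD => //; exact: cperZ.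
  by congr torus_integral; apply/funext => y; rewrite addrA.
apply: complexP; rewrite ?Re_add ?Im_add ?Re_mul ?Im_mul /=.
  rewrite -mulNr -lin2 //; congr torus_integral.
  by apply/funext => y; rewrite mulNr.
by rewrite lin2.
Qed.

Lemma integralC_cst (c : R[i]) :
  torus_integralC (fun _ : 'rV[R]_N => c) = c * ((2 * pi) ^+ N)%:C.
Proof.
have [_ _ cst] := @torus_integral_spec R N.
rewrite /torus_integralC.
have -> : re_fun (fun _ : 'rV[R]_N => c) = fun _ => Re c by [].
have -> : im_fun (fun _ : 'rV[R]_N => c) = fun _ => Im c by [].
by apply: complexP; rewrite ?Re_mul ?Im_mul /= cst; ring.
Qed.

Lemma integralC_D f g : CinftyC f -> CinftyC g ->
  torus_integralC (fun y => f y + g y) = torus_integralC f + torus_integralC g.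
Proof.
move=> sf sg; rewrite -[torus_integralC f]mul1r -integralC_lin //.
by congr torus_integralC; apply/funext => y; rewrite mul1r.
Qed.

Lemma integralC_Z (c : R[i]) f : CinftyC f ->
  torus_integralC (fun y => c * f y) = c * torus_integralC f.
Proof.
move=> sf; have := @integralC_lin c f _ sf (CinftyC_cst 0).
rewrite integralC_cst mul0r addr0 => <-.
by congr torus_integralC; apply/funext => y; rewrite addr0.
Qed.

Lemma integralC_N f : CinftyC f ->
  torus_integralC (fun y => - f y) = - torus_integralC f.
Proof.
move=> sf; rewrite -[RHS]mulN1r -integralC_Z //.
by congr torus_integralC; apply/funext => y; rewrite mulN1r.
Qed.

Lemma integralC_sum (I : Type) (r : seq I) (F : I -> 'rV[R]_N -> R[i]) :
  (forall i, CinftyC (F i)) ->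
  torus_integralC (fun y => \sum_(i <- r) F i y) = \sum_(i <- r) torus_integralC (F i).
Proof.
move=> H; elim: r => [|i r IH].
  rewrite big_nil (_ : (fun _ => _) = fun _ => 0); first by rewrite integralC_cst mul0r.
  by apply/funext => y; rewrite big_nil.
rewrite big_cons -IH -integralC_D //; last exact: CinftyC_sum.
by congr torus_integralC; apply/funext => y; rewrite big_cons.
Qed.

Lemma integralC_conj f : CinftyC f ->
  torus_integralC (fun y => ((f y)^*)%C) = ((torus_integralC f)^*)%C.
Proof.
move=> [_ /Cinfty_cper ci]; rewrite /torus_integralC.
rewrite (_ : re_fun _ = re_fun f); last by apply/funext => z; rewrite /re_fun Re_conjc.
rewrite (_ : im_fun _ = fun y => -1 * im_fun f y + 0); last first.
  by apply/funext => z; rewrite /im_fun Im_conjc mulN1r addr0.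
have [lin _ cst] := @torus_integral_spec R N.
by rewrite lin //; [rewrite cst mul0r addr0 mulN1r|exact: cper_cst].
Qed.

Lemma integralC_pderiv j f : CinftyC f -> torus_integralC (pderivC j f) = 0.
Proof.
move=> [rf if_]; rewrite /torus_integralC.
have -> : re_fun (pderivC j f) = pderiv j (re_fun f) by [].
have -> : im_fun (pderivC j f) = pderiv j (im_fun f) by [].
by rewrite !Cinfty_integral_pderiv.
Qed.

Lemma integralC_parts j f g : CinftyC f -> CinftyC g ->
  torus_integralC (fun y => pderivC j f y * g y) =
  - torus_integralC (fun y => f y * pderivC j g y).
Proof.
move=> sf sg; apply/eqP; rewrite -subr_eq0 opprK -integralC_D.
- by rewrite -pderivC_M // integralC_pderiv //; exact: CinftyC_M.
- by apply: CinftyC_M => //; exact: CinftyC_pderiv.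
- by apply: CinftyC_M => //; exact: CinftyC_pderiv.
Qed.

Lemma torus_integral_bound (f : 'rV[R]_N -> R) (B : R) : cper f ->
  (forall y, `|f y| <= B) -> `|torus_integral f| <= B * (2 * pi) ^+ N.
Proof.
move=> cf H; have [_ _ cst] := @torus_integral_spec R N.
have := @torus_integral_approx R N f (fun _ => 0) B cf (cper_cst 0).
by rewrite cst mul0r subr0; apply => y; rewrite subr0.
Qed.

Lemma integralC_bound f (B : R) : CinftyC f -> (forall y, normc (f y) <= B) ->
  normc (torus_integralC f) <= 2 * B * (2 * pi) ^+ N.
Proof.
move=> [/Cinfty_cper rf /Cinfty_cper if_] H; apply: le_trans (normc_le_ReIm _) _ => /=.
rewrite -mulrA mulr_natl mulr2n; apply: lerD; apply: torus_integral_bound => // y.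
  exact: le_trans (Re_le_normc _) (H y).
exact: le_trans (Im_le_normc _) (H y).
Qed.

Lemma CinftyC_bounded f : CinftyC f -> exists2 B, 0 <= B & forall y, normc (f y) <= B.
Proof.
move=> [/Cinfty_cper/cper_bounded[A [A0 HA]] /Cinfty_cper/cper_bounded[B [B0 HB]]].
exists (A + B) => [|y]; first exact: addr_ge0.
by apply: le_trans (normc_le_ReIm _) _; exact: lerD (HA y) (HB y).
Qed.

Lemma CinftyC_iter_pderiv s f : CinftyC f -> CinftyC (iter_pderivC s f).
Proof. by move=> sf; elim: s => //= j s IH; exact: CinftyC_pderiv. Qed.

Lemma iter_pderivC_rcons s j f : iter_pderivC (rcons s j) f = iter_pderivC s (pderivC j f).
Proof. by rewrite /iter_pderivC foldr_rcons. Qed.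

Lemma iter_pderivC_D s f g : CinftyC f -> CinftyC g ->
  iter_pderivC s (fun y => f y + g y) = fun y => iter_pderivC s f y + iter_pderivC s g y.
Proof.
move=> sf sg; elim: s => //= j s ->.
by rewrite pderivC_D //; exact: CinftyC_iter_pderiv.
Qed.

Lemma iter_pderivC_Z s (c : R[i]) f : CinftyC f ->
  iter_pderivC s (fun y => c * f y) = fun y => c * iter_pderivC s f y.
Proof.
move=> sf; elim: s => //= j s ->.
by rewrite pderivC_Z //; exact: CinftyC_iter_pderiv.
Qed.

End SmoothComplex.

(** * Complex exponentials: orthogonality and Bessel's inequality *)

Section Exponentials.
Context {R : realType} {N : nat}.
Implicit Types (xi : 'rV[int]_N) (y : 'rV[R]_N) (j : 'I_N) (f : 'rV[R]_N -> R[i]).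
Local Notation Re := complex.Re.
Local Notation Im := complex.Im.
Local Notation normc := Normc.normc.

Definition expi xi y : R[i] := cos (dot xi y) +i* sin (dot xi y).

Lemma re_expi xi : re_fun (expi xi) = trig xi 1 0.
Proof. by apply/funext => y; rewrite /trig mul1r mul0r addr0. Qed.

Lemma im_expi xi : im_fun (expi xi) = trig xi 0 1.
Proof. by apply/funext => y; rewrite /trig mul1r mul0r add0r. Qed.

Lemma CinftyC_expi xi : CinftyC (expi xi).
Proof. by split; rewrite ?re_expi ?im_expi; exact: Cinfty_trig. Qed.

Lemma expiD xi xi' y : expi (xi + xi') y = expi xi y * expi xi' y.
Proof.
rewrite /expi dot_addl cosD sinD; apply: complexP; rewrite ?Re_mul ?Im_mul //=.
by rewrite addrC.
Qed.

Lemma expi0 y : expi 0 y = 1.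
Proof. by rewrite /expi dot_zerol cos0 sin0. Qed.

Lemma expi_conj xi y : ((expi xi y)^*)%C = expi (- xi) y.
Proof. by rewrite /expi dot_oppl cosN sinN. Qed.

Lemma expiK xi y : expi xi y * expi (- xi) y = 1.
Proof. by rewrite -expiD subrr expi0. Qed.

Lemma normc_expi xi y : normc (expi xi y) = 1.
Proof.
apply/eqP; rewrite -(@eqrXn2 _ 2) ?normc_ge0 //.
by rewrite normc_sqr /= cos2Dsin2 expr1n.
Qed.

Lemma pderivC_expi j xi :
  pderivC j (expi xi) = fun y => imagc (xi 0 j)%:~R * expi xi y.
Proof.
apply/funext => y; rewrite /pderivC re_expi im_expi.
rewrite !(trig_derive xi _ _ j y).2 /trig.
by apply: complexP; rewrite ?Re_mul ?Im_mul /=; ring.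
Qed.

(** If some coordinate [xi 0 j] is nonzero, [expi xi] is a multiple of its own derivative in
    direction [j], whose integral vanishes. *)
Lemma integralC_expi xi :
  torus_integralC (expi xi) = if xi == 0 then ((2 * pi) ^+ N)%:C else 0.
Proof.
case: eqP => [->|/eqP xi0].
  rewrite (_ : expi 0 = fun _ => 1); first by rewrite integralC_cst mul1r.
  by apply/funext => y; exact: expi0.
have [j xij] : exists j, xi 0 j != 0.
  apply/existsP; apply: contraR xi0; rewrite negb_exists => /forallP H.
  by apply/eqP/rowP => j; rewrite mxE; apply/eqP; have := H j; rewrite negbK.
have := integralC_pderiv j (CinftyC_expi xi).
rewrite pderivC_expi integralC_Z; last exact: CinftyC_expi.
move/eqP; rewrite mulf_eq0 => /orP[|/eqP //].
by rewrite /imagc eq_complex /= eqxx /= intr_eq0 (negbTE xij).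
Qed.

Lemma integral_normc_sqr f : CinftyC f ->
  torus_integralC (fun y => f y * ((f y)^*)%C) =
  (torus_integral (fun y => normc (f y) ^+ 2))%:C.
Proof.
move=> sf; rewrite /torus_integralC.
have -> : re_fun (fun y => f y * ((f y)^*)%C) = fun y => normc (f y) ^+ 2.
  apply/funext => y; rewrite /re_fun Re_mul Re_conjc Im_conjc normc_sqr !expr2.
  by rewrite mulrN opprK.
have -> : im_fun (fun y => f y * ((f y)^*)%C) = fun _ => 0.
  apply/funext => y; rewrite /im_fun Im_mul Re_conjc Im_conjc; ring.
by have [_ _ ->] := @torus_integral_spec R N; rewrite mul0r.
Qed.

Lemma cper_normc_sqr f : CinftyC f -> cper (fun y => normc (f y) ^+ 2).
Proof.
move=> [/Cinfty_cper cr /Cinfty_cper ci].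
rewrite (_ : (fun _ => _) = fun y => re_fun f y * re_fun f y + im_fun f y * im_fun f y).
  by apply: cperD; exact: cperM.
by apply/funext => y; rewrite normc_sqr !expr2.
Qed.

Lemma integral_normc_sqr_ge0 f : CinftyC f -> 0 <= torus_integral (fun y => normc (f y) ^+ 2).
Proof.
move=> sf; have [_ mon cst] := @torus_integral_spec R N.
have := mon (fun _ => 0) _ (cper_cst 0) (cper_normc_sqr sf).
by rewrite cst mul0r; apply => y; rewrite sqr_ge0.
Qed.

Lemma two_piX_gt0 : (0 : R) < (2 * pi) ^+ N.
Proof. by rewrite exprn_gt0 // two_pi_gt0. Qed.

(* Expand [0 <= \int |f - q e_(-xi)|^2] with [q] the mean of [f e_xi]. *)
Lemma bessel f xi : CinftyC f ->
  normc (torus_integralC (fun y => f y * expi xi y)) ^+ 2 <=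
  (2 * pi) ^+ N * torus_integral (fun y => normc (f y) ^+ 2).
Proof.
move=> sf; set P := (2 * pi) ^+ N; set L := torus_integralC _.
have P0 : 0 < P := two_piX_gt0.
have sL : CinftyC (fun y => f y * expi xi y) by apply: CinftyC_M => //; exact: CinftyC_expi.
pose q := (P^-1)%:C * L.
pose w y := f y + - q * expi (- xi) y.
have sw : CinftyC w.
  by apply: CinftyC_D => //; apply: CinftyC_Z; exact: CinftyC_expi.
have := integral_normc_sqr_ge0 sw.
have := integral_normc_sqr sw.
have -> : (fun y => w y * ((w y)^*)%C) =
    fun y => - (q^*)%C * (f y * expi xi y) + (- q * ((f y * expi xi y)^*)%C +
       (1 * (f y * ((f y)^*)%C) + q * (q^*)%C)).
  apply/funext => y; rewrite /w; move: (q) => r.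
  rewrite !(conj_add, conj_mul, conj_opp) !expi_conj opprK.
  have := expiK xi y; set e := expi xi y; set e' := expi (- xi) y => ee.
  have -> : r * (r^*)%C = r * (r^*)%C * (e * e') by rewrite ee mulr1.
  by ring.
have sff : CinftyC (fun y => f y * ((f y)^*)%C).
  by apply: CinftyC_M => //; exact: CinftyC_conj.
have s3 : CinftyC (fun y => 1 * (f y * ((f y)^*)%C) + q * (q^*)%C).
  by apply: CinftyC_D; [exact: CinftyC_Z|exact: CinftyC_cst].
rewrite integralC_lin //; last first.
  by apply: CinftyC_D => //; apply: CinftyC_Z; exact: CinftyC_conj.
rewrite integralC_lin //; last exact: CinftyC_conj.
rewrite integralC_lin //; last exact: CinftyC_cst.
rewrite integralC_conj // integralC_cst integral_normc_sqr // -/L -/P mul1r.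
set S := torus_integral (fun y => normc (f y) ^+ 2).
have -> : - (q^*)%C * L + (- q * (L^*)%C + (S%:C + q * (q^*)%C * P%:C)) =
   (S - P^-1 * normc L ^+ 2)%:C.
  rewrite /q normc_sqr; case: (L) => a b.
  apply: complexP; rewrite ?Re_mul ?Im_mul ?Re_add ?Im_add ?Re_mul ?Im_mul ?Re_opp ?Im_opp /=; field; exact: lt0r_neq0.
move=> [<-]; rewrite subr_ge0 ler_pdivrMl //.
Qed.

End Exponentials.

(** * Uniqueness of Fourier coefficients *)

Section Uniqueness.
Context {R : realType} {N : nat}.
Context (y0 : 'rV[R]_N).
Implicit Types (xi : 'rV[int]_N) (y : 'rV[R]_N) (j k : 'I_N) (s : seq 'I_N).

Lemma dot_deltal j y : dot (delta_mx 0 j : 'rV[int]_N) y = y 0 j.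
Proof.
rewrite /dot (bigD1 j) //= big1 => [|k kj]; rewrite mxE ?eqxx ?mul1r ?addr0//.
by rewrite (negbTE kj) andbF mul0r.
Qed.

(** The function (1 + cos (y_j - y0_j)) / 2, with values in [0, 1] and value 1 at [y0]. The expanded
    form shows that only the frequencies 0 and plus or minus the basis vector j occur, so products
    of bumps are trigonometric polynomials. *)
Definition cos_bump j y : R :=
  2^-1 + trig (delta_mx 0 j) (cos (y0 0 j) / 2) (sin (y0 0 j) / 2) y.

Definition sin_bump j y : R := trig (delta_mx 0 j) (- sin (y0 0 j)) (cos (y0 0 j)) y.

Lemma cos_bumpE j y : cos_bump j y = (1 + cos (y 0 j - y0 0 j)) / 2.
Proof. by rewrite /cos_bump /trig dot_deltal cosB; field. Qed.

Lemma sin_bumpE j y : sin_bump j y = sin (y 0 j - y0 0 j).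
Proof. by rewrite /sin_bump /trig dot_deltal sinB; ring. Qed.

Lemma sin_bump_sqr j y : sin_bump j y ^+ 2 = 4 * cos_bump j y * (1 - cos_bump j y).
Proof.
rewrite sin_bumpE cos_bumpE; have := cos2Dsin2 (y 0 j - y0 0 j).
set c := cos _; set d := sin _ => E.
have -> : d ^+ 2 = 1 - c ^+ 2 by rewrite -E; ring.
by field.
Qed.

Lemma cos_bump_ge0 j y : 0 <= cos_bump j y.
Proof. by rewrite cos_bumpE divr_ge0 // -lerBlDl sub0r cos_geN1. Qed.

Lemma Cinfty_cos_bump j : Cinfty (cos_bump j).
Proof. by apply: CinftyD; [exact: Cinfty_cst|exact: Cinfty_trig]. Qed.

Lemma Cinfty_sin_bump j : Cinfty (sin_bump j).
Proof. exact: Cinfty_trig. Qed.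

Lemma pderiv_cos_bump k j : pderiv k (cos_bump j) =
  fun y => if k == j then - sin_bump j y / 2 else 0.
Proof.
have [st _] := Cinfty_trig (delta_mx 0 j : 'rV[int]_N) (cos (y0 0 j) / 2) (sin (y0 0 j) / 2).
rewrite /cos_bump pderivD //; last exact: smooth_cst.
rewrite pderiv_cst; apply/funext => y; rewrite add0r.
rewrite (trig_derive _ _ _ k y).2 mxE eqxx /=; case: eqP => [_|_] /=.
  by rewrite /sin_bump /trig !mulr1; field.
by rewrite /trig !mulr0 oppr0 !mul0r addr0.
Qed.

Lemma pderiv_sin_bump j : pderiv j (sin_bump j) = fun y => 2 * cos_bump j y - 1.
Proof.
apply/funext => y; rewrite (trig_derive _ _ _ j y).2 mxE !eqxx /= /cos_bump /trig !mulr1.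
by field.
Qed.

(** A list encodes a monomial in the bumps: the exponent of [cos_bump j] is [count_mem j s]. *)
Fixpoint bump_prod s y : R := if s is j :: s' then cos_bump j y * bump_prod s' y else 1.

Lemma bump_prod_cons j s : bump_prod (j :: s) = fun y => cos_bump j y * bump_prod s y.
Proof. by []. Qed.

Lemma Cinfty_bump_prod s : Cinfty (bump_prod s).
Proof.
elim: s => [|j s IH]; first exact: Cinfty_cst.
by rewrite bump_prod_cons; apply: CinftyM => //; exact: Cinfty_cos_bump.
Qed.

Lemma bump_prod_ge0 s y : 0 <= bump_prod s y.
Proof. by elim: s => //= j s IH; rewrite mulr_ge0 // cos_bump_ge0. Qed.

(** Differentiating a power of [cos_bump j] loses one factor and produces [sin_bump j]. The second
    [sin_bump j] restores that factor, by [sin_bump_sqr]. *)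
Lemma pderiv_bump_prod j s y : sin_bump j y * pderiv j (bump_prod s) y =
  - 2 * (count_mem j s)%:R * (1 - cos_bump j y) * bump_prod s y.
Proof.
elim: s => [|k s IH]; first by rewrite (pderiv_cst j 1) !mulr0 !mul0r.
rewrite bump_prod_cons pderivM; [|by case: (Cinfty_cos_bump k)|by case: (Cinfty_bump_prod s)].
rewrite mulrDr [X in _ + X]mulrCA IH pderiv_cos_bump /= eq_sym natrD.
case: eqP => [<-|_] /=; last by ring.
have := sin_bump_sqr k y; rewrite expr2 => E.
have -> : sin_bump k y * (- sin_bump k y / 2 * bump_prod s y) =
    - (sin_bump k y * sin_bump k y) / 2 * bump_prod s y by field.
by rewrite E; field.
Qed.

(* From [0 = \int d_j (sin(y_j - y0_j) bump_prod s)]. *)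
Lemma bump_prod_recurrence j s :
  (2 * (count_mem j s)%:R + 2) * torus_integral (bump_prod (j :: s)) =
  (2 * (count_mem j s)%:R + 1) * torus_integral (bump_prod s).
Proof.
have [lin _ _] := @torus_integral_spec R N.
have ck t : cper (bump_prod t) by apply: Cinfty_cper; exact: Cinfty_bump_prod.
have := Cinfty_integral_pderiv j (CinftyM (Cinfty_sin_bump j) (Cinfty_bump_prod s)).
rewrite pderivM; [|by case: (Cinfty_sin_bump j)|by case: (Cinfty_bump_prod s)].
set m : R := (count_mem j s)%:R.
have -> : (fun y => pderiv j (sin_bump j) y * bump_prod s y + sin_bump j y * pderiv j (bump_prod s) y)
   = fun y => (2 * m + 2) * bump_prod (j :: s) y + (- (2 * m + 1) * bump_prod s y + 0).
  by apply/funext => y; rewrite pderiv_bump_prod pderiv_sin_bump /= -/m; ring.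
rewrite lin //; last by apply: cperD; [exact: cperZ|exact: cper_cst].
rewrite lin //; last exact: cper_cst.
have [_ _ cst] := @torus_integral_spec R N.
by rewrite cst mul0r addr0 mulNr => /eqP; rewrite subr_eq0 => /eqP.
Qed.

Lemma bump_prod_int_gt0 s : 0 < torus_integral (bump_prod s).
Proof.
elim: s => [|j s IH].
  have [_ _ cst] := @torus_integral_spec R N.
  by rewrite cst mul1r two_piX_gt0.
have m0 : (0 : R) <= (count_mem j s)%:R by [].
have := bump_prod_recurrence j s; set m : R := (count_mem j s)%:R in m0 *.
have h : 0 < (2 * m + 1) * torus_integral (bump_prod s) by rewrite mulr_gt0 //; lra.
by move=> E; rewrite -E in h; rewrite pmulr_rgt0 in h => //; lra.
Qed.

(** With [m] the multiplicity of [j], the recurrence makes the integral of [bump_prod (j :: s)] the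
    fraction (2 m + 1) / (2 m + 2) of that of [bump_prod s]; what is missing is the fraction 1 / (2
    m + 2). *)
Lemma bump_prod_concentration j s :
  torus_integral (fun y => (1 - cos_bump j y) * bump_prod s y) <=
  torus_integral (bump_prod s) / (count_mem j s).+1%:R.
Proof.
have [lin _ cst] := @torus_integral_spec R N.
have ck t : cper (bump_prod t) by apply: Cinfty_cper; exact: Cinfty_bump_prod.
have -> : (fun y => (1 - cos_bump j y) * bump_prod s y) =
   fun y => -1 * bump_prod (j :: s) y + bump_prod s y.
  by apply/funext => y /=; ring.
rewrite lin //; have := bump_prod_recurrence j s; have := bump_prod_int_gt0 s.
rewrite -natr1; have m0 : (0 : R) <= (count_mem j s)%:R by [].
set m : R := (count_mem j s)%:R in m0 *; set a := torus_integral _; set b := torus_integral _ => a0 E.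
rewrite ler_pdivlMr; last by lra.
by nra.
Qed.

(* A continuous periodic function varies by at most [e] near [y0 + 2 pi Z^N],  *)
(* and away from it some [1 - cos_bump j] is bounded below.                    *)
Lemma korovkin (g : 'rV[R]_N -> R) (e : R) : cper g -> 0 < e ->
  exists2 C, 0 <= C & forall y, `|g y - g y0| <= e + C * \sum_j (1 - cos_bump j y).
Proof.
move=> cg e0; have [B [B0 HB]] := cper_bounded cg.
have [d d0 Hd] := cper_unif cg e0.
(* The cap at 1 keeps [t] below [pi], in the range where the cosine decreases. *)
pose t := Num.min (d / 2) 1.
have t0 : 0 < t by rewrite lt_min ltr01 andbT divr_gt0.
have tpi : t <= pi by rewrite ge_min; apply/orP; right; apply: le_trans (pi_ge2 _); lra.
pose eta := (1 - cos t) / 2.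
have eta0 : 0 < eta.
  rewrite divr_gt0 // subr_gt0 -cos0; rewrite ltr_cos ?in_itv /= ?lexx ?pi_ge0 // ?(ltW t0) //.
exists (2 * B / eta) => [|y]; first by rewrite divr_ge0 ?mulr_ge0 // ltW.
(* The shift by [pi] centres the reduction: the translate [z] lies within [pi] of [y0] in every
   coordinate. *)
have [k Hk] := lattice_reduce (y - y0 + const_mx pi).
pose z := y + (2 * pi) *: map_mx intr k.
have gz : g z = g y by rewrite /z periodic2pi_lattice //; case: cg.
have bz j : cos_bump j z = cos_bump j y by rewrite /z periodic2pi_lattice //; case: (Cinfty_cos_bump j).
have zpi j : `|z 0 j - y0 0 j| <= pi.
  have := Hk j; rewrite /= in_itv /= !mxE => /andP[h1 h2].
  by rewrite ler_norml; apply/andP; split; lra.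
have b1 j : 0 <= 1 - cos_bump j z.
  by rewrite subr_ge0 cos_bumpE ler_pdivrMr // mul1r; have := cos_le1 (z 0 j - y0 0 j); lra.
rewrite -gz; under eq_bigr => j _ do rewrite -bz.
have S0 : 0 <= \sum_j (1 - cos_bump j z) by exact: sumr_ge0.
have C0 : 0 <= 2 * B / eta by rewrite divr_ge0 ?mulr_ge0 // ltW.
have [/forallP H|] := boolP [forall j, `|z 0 j - y0 0 j| <= t].
  apply: (@le_trans _ _ e); last by rewrite lerDl mulr_ge0.
  apply/ltW/Hd; apply: (@le_lt_trans _ _ (d / 2)); last by lra.
  apply: row_norm_le => [|j]; first by lra.
  by rewrite (_ : (z - y0) 0 j = z 0 j - y0 0 j); [|by rewrite !mxE]; apply: le_trans (H j) _; rewrite ge_min lexx.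
rewrite negb_forall => /existsP[j]; rewrite -ltNge => tj.
apply: (@le_trans _ _ (2 * B)).
  by apply: le_trans (ler_normB _ _) _; have := HB z; have := HB y0; lra.
apply: (@le_trans _ _ (2 * B / eta * (1 - cos_bump j z))).
  rewrite mulrAC ler_pdivlMr //; apply: ler_wpM2l; first by rewrite mulr_ge0.
  rewrite cos_bumpE /eta.
  have : cos (z 0 j - y0 0 j) <= cos t.
    rewrite -(cos_norm (z 0 j - y0 0 j)).
    by apply: ltW; rewrite ltr_cos ?in_itv /= ?zpi ?andbT ?normr_ge0 ?tpi ?andbT ?(ltW t0).
  by lra.
rewrite -[leLHS]add0r; apply: lerD; first exact: ltW.
apply: ler_wpM2l => //; rewrite (bigD1 j) //= lerDl sumr_ge0 //.
Qed.

(** Bump products with high powers in every coordinate, divided by their integrals, form an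
    approximate identity at [y0]: in the bound of [korovkin] for [g - g y0], the terms
    [1 - cos_bump j] have small mass by concentration. *)
Lemma bump_prod_separates (g : 'rV[R]_N -> R) : cper g ->
  (forall s, torus_integral (fun y => g y * bump_prod s y) = 0) -> g y0 = 0.
Proof.
move=> cg H; have [lin mon cst] := @torus_integral_spec R N.
have ck t : cper (bump_prod t) by apply: Cinfty_cper; exact: Cinfty_bump_prod.
suff : `|g y0| <= 0 by rewrite normr_le0 => /eqP.
apply/ler_addgt0Pl => e e0; rewrite addr0.
have e2 : 0 < e / 2 by rewrite divr_gt0.
have [C C0 HC] := korovkin cg e2.
(* Chosen so that [C * N / (m + 1)] is at most [e / 2]: each of the [N] coordinates contributes at
   most 1 / (m + 1), relative to the total mass. *)
pose m := Num.truncn (C * N%:R / (e / 2)).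
pose s := flatten (nseq m (enum 'I_N)).
have cnt j : count_mem j s = m.
  rewrite /s count_flatten map_nseq (count_uniq_mem _ (enum_uniq _)) mem_enum /=.
  by rewrite sumn_nseq mul1n.
set I0 := torus_integral (bump_prod s).
have I0p : 0 < I0 := bump_prod_int_gt0 s.
have cb j : cper (fun y => (1 - cos_bump j y) * bump_prod s y).
  apply: cperM => //; rewrite (_ : (fun _ => _) = fun y => 1 + -1 * cos_bump j y).
    by apply: cperD; [exact: cper_cst|apply: cperZ; apply: Cinfty_cper; exact: Cinfty_cos_bump].
  by apply/funext => y; rewrite mulN1r.
have sumb (r : seq 'I_N) : cper (fun y => \sum_(j <- r) (1 - cos_bump j y) * bump_prod s y) /\
    torus_integral (fun y => \sum_(j <- r) (1 - cos_bump j y) * bump_prod s y) <=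
      (size r)%:R * (I0 / m.+1%:R).
  elim: r => [|j r [IH1 IH2]].
    have -> : (fun y => \sum_(j <- [::]) (1 - cos_bump j y) * bump_prod s y) = fun _ => 0.
      by apply/funext => y; rewrite big_nil.
    by split; [exact: cper_cst|rewrite cst !mul0r].
  have -> : (fun y => \sum_(j <- j :: r) (1 - cos_bump j y) * bump_prod s y) =
     fun y => 1 * ((1 - cos_bump j y) * bump_prod s y) + \sum_(j <- r) (1 - cos_bump j y) * bump_prod s y.
    by apply/funext => y; rewrite big_cons mul1r.
  split; first by apply: cperD => //; exact: cperZ.
  rewrite lin // mul1r /= -natr1 mulrDl mul1r addrC; apply: lerD => //.
  by have := bump_prod_concentration j s; rewrite cnt.
have [cS HS] := sumb (enum 'I_N).
rewrite size_enum_ord in HS.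
pose G y := (e / 2) * bump_prod s y + (C * (\sum_(j <- enum 'I_N) (1 - cos_bump j y) * bump_prod s y) + 0).
have cG : cper G by apply: cperD; [exact: cperZ|apply: cperD; [exact: cperZ|exact: cper_cst]].
have IG : torus_integral G <= e * I0.
  rewrite lin //; last by apply: cperD; [exact: cperZ|exact: cper_cst].
  rewrite lin //; last exact: cper_cst.
  rewrite cst mul0r addr0 -/I0.
  have : C * torus_integral (fun y => \sum_(j <- enum 'I_N) (1 - cos_bump j y) * bump_prod s y) <=
      C * (N%:R * (I0 / m.+1%:R)) by exact: ler_wpM2l.
  have : C * (N%:R * (I0 / m.+1%:R)) <= e / 2 * I0.
    rewrite !mulrA mulrAC; apply: ler_wpM2r; first exact: ltW.
    rewrite ler_pdivrMr // [leRHS]mulrC -ler_pdivrMr //; apply: ltW.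
    exact: truncnS_gt.
  by move=> h1 h2; have := le_trans h2 h1; clear; set X := C * _; lra.
have bound y : `|(g y0 - g y) * bump_prod s y| <= G y.
  rewrite normrM (ger0_norm (bump_prod_ge0 _ _)) /G addr0 -mulr_suml mulrA -mulrDl.
  apply: ler_wpM2r; first exact: bump_prod_ge0.
  by rewrite distrC big_enum; exact: HC.
have cD : cper (fun y => (g y0 - g y) * bump_prod s y).
  apply: cperM => //; rewrite (_ : (fun _ => _) = fun y => g y0 + -1 * g y).
    by apply: cperD; [exact: cper_cst|exact: cperZ].
  by apply/funext => y; rewrite mulN1r.
have ID : torus_integral (fun y => (g y0 - g y) * bump_prod s y) = g y0 * I0.
  rewrite (_ : (fun _ => _) = fun y => g y0 * bump_prod s y + (-1 * (g y * bump_prod s y) + 0)).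
    rewrite lin //; last by apply: cperD; [apply: cperZ; exact: cperM|exact: cper_cst].
    rewrite lin //; [|exact: cperM|exact: cper_cst].
    by rewrite H cst mulr0 mul0r !addr0.
  by apply/funext => y; ring.
have up : torus_integral (fun y => (g y0 - g y) * bump_prod s y) <= torus_integral G.
  by apply: mon => // y; apply: le_trans (ler_norm _) (bound y).
have lo : torus_integral (fun y => -1 * G y + 0) <= torus_integral (fun y => (g y0 - g y) * bump_prod s y).
  apply: mon => //; first by apply: cperD; [exact: cperZ|exact: cper_cst].
  by move=> y; have := bound y; rewrite ler_norml => /andP[h _]; rewrite addr0 mulN1r.
rewrite lin // in lo; last exact: cper_cst.
rewrite cst mul0r addr0 mulN1r ID in lo; rewrite ID in up.
have : `|g y0| * I0 <= e * I0.
  rewrite -[X in _ * X](gtr0_norm I0p) -normrM ler_norml; apply/andP; split; lra.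
by rewrite ler_pM2r.
Qed.

End Uniqueness.

(** * Fourier series and distributions *)

Section FourierSeries.
Context {R : realType} {N : nat}.
Implicit Types (xi eta : 'rV[int]_N) (y : 'rV[R]_N) (j : 'I_N)
  (f phi : 'rV[R]_N -> R[i]) (c : 'rV[int]_N -> R[i]) (v : functional R N).
Local Notation Re := complex.Re.
Local Notation Im := complex.Im.
Local Notation normc := Normc.normc.
Local Notation P := ((2 * pi) ^+ N : R).

Lemma cos_bump_expi (y0 : 'rV[R]_N) j y : (cos_bump y0 j y)%:C =
  (2^-1)%:C + ((cos (y0 0 j) / 4 +i* - (sin (y0 0 j) / 4)) * expi (delta_mx 0 j) y +
    (cos (y0 0 j) / 4 +i* (sin (y0 0 j) / 4)) * expi (- delta_mx 0 j) y).
Proof.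
rewrite /cos_bump /trig /expi dot_oppl cosN sinN dot_deltal.
by apply: complexP; rewrite ?Re_add ?Im_add ?Re_mul ?Im_mul ?Re_add ?Im_add ?Re_mul ?Im_mul /=; field.
Qed.

(** The conclusion is kept for all [xi] because each further bump shifts the frequency by plus or
    minus a basis vector. *)
Lemma fourier_bump_prod (y0 : 'rV[R]_N) (s : seq 'I_N) f : CinftyC f ->
  (forall xi, torus_integralC (fun y => f y * expi xi y) = 0) ->
  forall xi, torus_integralC (fun y => f y * (bump_prod y0 s y)%:C * expi xi y) = 0.
Proof.
move=> sf H; elim: s => [|j s IH] xi.
  by rewrite -(H xi); congr torus_integralC; apply/funext => y; rewrite mulr1.
set A := (cos (y0 0 j) / 4 +i* - (sin (y0 0 j) / 4)).
set B := (cos (y0 0 j) / 4 +i* (sin (y0 0 j) / 4)).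
have sg eta : CinftyC (fun y => f y * (bump_prod y0 s y)%:C * expi eta y).
  apply: CinftyC_M; last exact: CinftyC_expi.
  by apply: CinftyC_M => //; apply: CinftyC_real; exact: Cinfty_bump_prod.
rewrite (_ : (fun _ => _) = fun y =>
    (2^-1)%:C * (f y * (bump_prod y0 s y)%:C * expi xi y) +
    (A * (f y * (bump_prod y0 s y)%:C * expi (delta_mx 0 j + xi) y) +
     (B * (f y * (bump_prod y0 s y)%:C * expi (- delta_mx 0 j + xi) y)))); last first.
  apply/funext => y; rewrite /= rmorphM /= cos_bump_expi -/A -/B !expiD /=.
  by move: (expi _ y) (expi xi y) => e1 e2; ring.
rewrite integralC_lin //; last by apply: CinftyC_D; exact: CinftyC_Z.
rewrite integralC_lin //; last exact: CinftyC_Z.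
by rewrite integralC_Z // !IH !mulr0 !addr0.
Qed.

(** The bump products are real, so the real and the imaginary part of [f] are separately orthogonal
    to them, and each vanishes at the arbitrary centre [y0]. *)
Lemma fourier_unique f : CinftyC f ->
  (forall xi, torus_integralC (fun y => f y * expi xi y) = 0) -> f = fun _ => 0.
Proof.
move=> sf H; apply/funext => y0.
have K s : torus_integralC (fun y => f y * (bump_prod y0 s y)%:C) = 0.
  rewrite -(fourier_bump_prod y0 s sf H 0); congr torus_integralC.
  by apply/funext => y; rewrite expi0 mulr1.
case: sf => /Cinfty_cper cr /Cinfty_cper ci.
apply: complexP.
  apply: (bump_prod_separates (g := re_fun f)) => // s.
  have := congr1 (@complex.Re R) (K s); rewrite /torus_integralC /= => <-; congr torus_integral.
  by apply/funext => y; rewrite /re_fun Re_mul /= mulr0 subr0.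
apply: (bump_prod_separates (g := im_fun f)) => // s.
have := congr1 (@complex.Im R) (K s); rewrite /torus_integralC /= => <-; congr torus_integral.
by apply/funext => y; rewrite /im_fun Im_mul /= mulr0 add0r.
Qed.

Definition rapidC c : Prop :=
  forall s : nat, exists C : R, forall xi, normc (c xi) * (1 + norm1 xi) ^+ s <= C.

Lemma rapidC_Re c : rapidC c -> rapid (fun xi => Re (c xi)).
Proof.
move=> rc s; have [C HC] := rc s; exists C => xi; apply: le_trans (HC xi).
by apply: ler_wpM2r; [rewrite exprn_ge0 // ltW // onenorm_gt0|exact: Re_le_normc].
Qed.

Lemma rapidC_Im c : rapidC c -> rapid (fun xi => Im (c xi)).
Proof.
move=> rc s; have [C HC] := rc s; exists C => xi; apply: le_trans (HC xi).
by apply: ler_wpM2r; [rewrite exprn_ge0 // ltW // onenorm_gt0|exact: Im_le_normc].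
Qed.

Lemma rapidC_NIm c : rapidC c -> rapid (fun xi => - Im (c xi)).
Proof. by move=> rc; apply: rapidN; exact: rapidC_Im. Qed.

Lemma rapidC_Z (b : R[i]) c : rapidC c -> rapidC (fun xi => b * c xi).
Proof.
move=> rc s; have [C HC] := rc s; exists (normc b * C) => xi.
by rewrite normcM -mulrA; apply: ler_wpM2l => //; exact: normc_ge0.
Qed.

Lemma norm1N xi : norm1 (- xi) = norm1 xi :> R.
Proof. by rewrite /norm1; apply: eq_bigr => j _; rewrite mxE mulrNz normrN. Qed.

Lemma rapidC_opp c : rapidC c -> rapidC (fun xi => c (- xi)).
Proof.
by move=> rc s; have [C HC] := rc s; exists C => xi; have := HC (- xi); rewrite norm1N.
Qed.

(** The sum of the [c xi * expi xi y], split into two real series so that the results on [tseries]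
    apply. *)
Definition fseries c y : R[i] :=
  tseries (fun xi => Re (c xi)) (fun xi => - Im (c xi)) y +i*
  tseries (fun xi => Im (c xi)) (fun xi => Re (c xi)) y.

Definition fpart m c y : R[i] :=
  tpart m (fun xi => Re (c xi)) (fun xi => - Im (c xi)) y +i*
  tpart m (fun xi => Im (c xi)) (fun xi => Re (c xi)) y.

Lemma CinftyC_fseries c : rapidC c -> CinftyC (fseries c).
Proof.
move=> rc; split; apply: Cinfty_tseries;
  [exact: rapidC_Re|exact: rapidC_NIm|exact: rapidC_Im|exact: rapidC_Re].
Qed.

Lemma CinftyC_fpart m c : CinftyC (fpart m c).
Proof. by split; exact: Cinfty_tpart. Qed.

Lemma fpartE m c y : fpart m c y = \sum_(0 <= i < m) lterm (fun xi => c xi * expi xi y) i.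
Proof.
elim: m => [|m IH]; first by rewrite big_nil /fpart !tpart0.
rewrite big_nat_recr //= -IH /fpart !tpartS.
apply: complexP; rewrite ?Re_add ?Im_add /=; congr (_ + _); rewrite /tterm /lterm;
  case: pickle_inv => // xi; rewrite ?Re_mul ?Im_mul /trig /=; ring.
Qed.

Definition dcoef j c : 'rV[int]_N -> R[i] := fun xi => imagc (xi 0 j)%:~R * c xi.

Lemma rapidC_dcoef j c : rapidC c -> rapidC (dcoef j c).
Proof.
move=> rc s; have [C HC] := rc s.+1; exists C => xi.
apply: le_trans (HC xi); rewrite /dcoef normcM exprS mulrA.
apply: ler_wpM2r; first by rewrite exprn_ge0 // ltW // onenorm_gt0.
rewrite mulrC; apply: ler_wpM2l; first exact: normc_ge0.
rewrite normc_imag; apply: le_trans (coord_le_norm1 _ _) _.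
by rewrite lerDr.
Qed.

Lemma pderivC_fseries j c : rapidC c -> pderivC j (fseries c) = fseries (dcoef j c).
Proof.
move=> rc; apply/funext => y; rewrite /pderivC.
have -> : re_fun (fseries c) = tseries (fun xi => Re (c xi)) (fun xi => - Im (c xi)) by [].
have -> : im_fun (fseries c) = tseries (fun xi => Im (c xi)) (fun xi => Re (c xi)) by [].
rewrite !pderiv_tseries; [|exact: rapidC_Im|exact: rapidC_Re|exact: rapidC_Re|exact: rapidC_NIm].
by apply: complexP => /=; congr (tseries _ _ y); apply/funext => xi;
  rewrite /dal /dbe /dcoef ?Re_mul ?Im_mul /=; ring.
Qed.

Lemma pderivC_fpart j m c : pderivC j (fpart m c) = fpart m (dcoef j c).
Proof.
apply/funext => y; rewrite /pderivC.
have -> : re_fun (fpart m c) = tpart m (fun xi => Re (c xi)) (fun xi => - Im (c xi)) by [].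
have -> : im_fun (fpart m c) = tpart m (fun xi => Im (c xi)) (fun xi => Re (c xi)) by [].
rewrite !pderiv_tpart.
by apply: complexP => /=; congr (tpart m _ _ y); apply/funext => xi;
  rewrite /dal /dbe /dcoef ?Re_mul ?Im_mul /=; ring.
Qed.

Lemma rapidC_weight c : rapidC c ->
  exists2 A, 0 <= A & forall xi, `|Re (c xi)| + `|Im (c xi)| <= A * weight xi.
Proof.
move=> rc; have [A A0 HA] := rapid2_weight 0 (rapidC_Re rc) (rapidC_Im rc).
by exists A => // xi; have := HA xi; rewrite expr0 mulr1.
Qed.

Lemma fseries_tail c : rapidC c ->
  exists2 A, 0 <= A & forall m y, normc (fseries c y - fpart m c y) <= A * tail (N := N) m.
Proof.
move=> rc; have [A A0 HA] := rapidC_weight rc.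
exists (A + A) => [|m y]; first exact: addr_ge0.
apply: le_trans (normc_le_ReIm _) _; rewrite mulrDl.
rewrite Re_add Im_add Re_opp Im_opp /=; apply: lerD; apply: tseries_tail => xi.
  by rewrite normrN.
by rewrite addrC.
Qed.

Lemma fseries_bound c (A : R) y : rapidC c -> 0 <= A ->
  (forall xi, normc (c xi) <= A * weight xi) -> normc (fseries c y) <= 4 * A * 4 ^+ N.
Proof.
move=> rc A0 HA.
have HA2 xi : `|Re (c xi)| + `|Im (c xi)| <= 2 * A * weight xi.
  have := Re_le_normc (c xi); have := Im_le_normc (c xi); have := HA xi.
  by rewrite -mulrA; set w := A * _; lra.
apply: le_trans (normc_le_ReIm _) _ => /=.
have -> : 4 * A * 4 ^+ N = 2 * A * 4 ^+ N + 2 * A * 4 ^+ N by ring.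
have A2 : 0 <= 2 * A by rewrite mulr_ge0.
apply: lerD; apply: tseries_bound => //.
- exact: rapidC_Re.
- exact: rapidC_NIm.
- by move=> xi; rewrite normrN.
- exact: rapidC_Im.
- exact: rapidC_Re.
- by move=> xi; rewrite addrC.
Qed.

Lemma tail_small (A e : R) : 0 < e -> exists M, forall m, (M <= m)%N -> A * tail (N := N) m <= e.
Proof.
move=> e0; have := @tail_cvg0 R N => /cvgrPdist_le.
have e1 : 0 < e / (`|A| + 1) by rewrite divr_gt0 // ltr_wpDl.
move=> /(_ _ e1)[M _ HM]; exists M => m /HM /=.
rewrite sub0r normrN ler_pdivlMr ?ltr_wpDl // => h.
apply: le_trans (ler_norm _) _; rewrite normrM mulrC; apply: le_trans h.
by apply: ler_wpM2l => //; rewrite lerDl.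
Qed.

Lemma integralC_fpart m c phi : CinftyC phi ->
  torus_integralC (fun y => fpart m c y * phi y) =
  \sum_(0 <= i < m) lterm (fun xi => c xi * torus_integralC (fun y => expi xi y * phi y)) i.
Proof.
move=> sp.
have -> : (fun y => fpart m c y * phi y) = fun y => \sum_(i <- index_iota 0 m)
    lterm (fun xi => c xi * (expi xi y * phi y)) i.
  apply/funext => y; rewrite fpartE mulr_suml; apply: eq_bigr => i _.
  by rewrite /lterm; case: pickle_inv => [xi|]; rewrite ?mul0r // mulrA.
have se xi : CinftyC (fun y => expi xi y * phi y).
  by apply: CinftyC_M => //; exact: CinftyC_expi.
rewrite integralC_sum => [|i].
  apply: eq_bigr => i _; rewrite /lterm; case: pickle_inv => [xi|].
    by rewrite integralC_Z.
  by rewrite integralC_cst mul0r.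
rewrite /lterm; case: pickle_inv => [xi|]; last exact: CinftyC_cst.
exact: CinftyC_Z.
Qed.

Lemma fseries_integral_tail c phi : rapidC c -> CinftyC phi ->
  forall e : R, 0 < e -> exists M, forall m, (M <= m)%N ->
  normc (torus_integralC (fun y => fseries c y * phi y) -
         torus_integralC (fun y => fpart m c y * phi y)) <= e.
Proof.
move=> rc sp e e0; have [A A0 HA] := fseries_tail rc.
have [B B0 HB] := CinftyC_bounded sp.
have [M HM] := tail_small (2 * (A * B) * P) e0.
exists M => m /HM; apply: le_trans.
have sF := CinftyC_fseries rc; have sm := CinftyC_fpart m c.
rewrite -integralC_N; last exact: CinftyC_M.
rewrite -integralC_D; [|exact: CinftyC_M|by apply: CinftyC_N; exact: CinftyC_M].
have -> : 2 * (A * B) * P * tail (N := N) m = 2 * (A * tail (N := N) m * B) * P by ring.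
apply: integralC_bound => [|y].
  by apply: CinftyC_B; exact: CinftyC_M.
rewrite -mulrBl normcM; apply: ler_pM => //; exact: normc_ge0.
Qed.

Lemma fseries_coef c eta : rapidC c ->
  torus_integralC (fun y => fseries c y * expi (- eta) y) = c eta * P%:C.
Proof.
move=> rc; apply/eqP; rewrite -subr_eq0; apply/eqP/normc_eq0 => e e0.
have [M HM] := fseries_integral_tail rc (CinftyC_expi (- eta)) e0.
(* As soon as the partial sum includes the code of [eta], orthogonality leaves exactly that term. *)
pose m := maxn M (pickle eta).+1.
have := HM m (leq_maxl _ _); rewrite integralC_fpart; last exact: CinftyC_expi.
rewrite (bigD1_seq (pickle eta)) ?iota_uniq //=; last first.
  by rewrite mem_index_iota /= leq_maxr.
rewrite big1 => [|i ip].
  rewrite addr0 /lterm pickleK_inv.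
  rewrite (_ : (fun y => expi eta y * expi (- eta) y) = fun _ => 1).
    by rewrite integralC_cst mul1r.
  by apply/funext => y; exact: expiK.
rewrite /lterm; case E: pickle_inv => [xi|] //.
rewrite (_ : (fun y => expi xi y * expi (- eta) y) = expi (xi - eta)); last first.
  by apply/funext => y; rewrite expiD.
rewrite integralC_expi subr_eq0; case: eqP => [Exi|_]; last by rewrite mulr0.
have /= := @pickle_invK 'rV[int]_N i; rewrite E /= Exi => Ei.
by rewrite Ei eqxx in ip.
Qed.

(** Each further power of the frequency costs one integration by parts, which moves the factor
    [xi_j] onto [f] as a derivative; hence the induction over all [f]. *)
Lemma rapidC_fourier f : CinftyC f ->
  rapidC (fun xi => torus_integralC (fun y => f y * expi xi y)).
Proof.
move=> sf s; elim: s f sf => [|s IH] f sf.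
  have [B B0 HB] := CinftyC_bounded sf.
  exists (2 * B * P) => xi; rewrite expr0 mulr1; apply: integralC_bound => [|y].
    by apply: CinftyC_M => //; exact: CinftyC_expi.
  by rewrite normcM normc_expi mulr1.
have [C0 HC0] := IH f sf.
have [C HC] := choice (fun j : 'I_N => IH _ (CinftyC_pderiv j sf)).
exists (C0 + \sum_j C j) => xi.
rewrite exprS mulrCA mulrDl mul1r; apply: lerD; first exact: HC0.
rewrite /norm1 mulr_suml; apply: ler_sum => j _; apply: le_trans (HC j xi).
rewrite mulrA; apply: ler_wpM2r; first by rewrite exprn_ge0 // ltW // onenorm_gt0.
rewrite integralC_parts //; last exact: CinftyC_expi.
rewrite pderivC_expi normc_opp (_ : (fun y => f y * (imagc _ * _)) = fun y =>
   imagc (xi 0 j)%:~R * (f y * expi xi y)); last by apply/funext => y; rewrite mulrCA.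
rewrite integralC_Z ?normcM ?normc_imag //.
by apply: CinftyC_M => //; exact: CinftyC_expi.
Qed.

Definition fcoef f : 'rV[int]_N -> R[i] :=
  fun xi => (P^-1)%:C * torus_integralC (fun y => f y * expi (- xi) y).

Lemma rapidC_fcoef f : CinftyC f -> rapidC (fcoef f).
Proof.
by move=> sf; apply: rapidC_Z; exact: (rapidC_opp (rapidC_fourier sf)).
Qed.

Lemma fourier_inversion f : CinftyC f -> fseries (fcoef f) = f.
Proof.
move=> sf; have rf := rapidC_fcoef sf; have sF := CinftyC_fseries rf.
have sD : CinftyC (fun y => fseries (fcoef f) y - f y) by exact: CinftyC_B.
have /(fourier_unique sD) E xi :
    torus_integralC (fun y => (fseries (fcoef f) y - f y) * expi xi y) = 0.
  have se := CinftyC_expi (R := R) xi.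
  rewrite (_ : (fun _ => _) = fun y => fseries (fcoef f) y * expi xi y + - (f y * expi xi y)).
    rewrite integralC_D; [|exact: CinftyC_M|by apply: CinftyC_N; exact: CinftyC_M].
    rewrite integralC_N; last exact: CinftyC_M.
    have := fseries_coef (- xi) rf; rewrite opprK => ->.
    rewrite /fcoef opprK mulrAC -rmorphM /= mulVf ?mul1r ?subrr //.
    by rewrite lt0r_neq0 // two_piX_gt0.
  by apply/funext => y; rewrite mulrBl.
apply/funext => y; apply/eqP; rewrite -subr_eq0; apply/eqP.
exact: (congr1 (fun g => g y) E).
Qed.

Definition clinear v : Prop := forall (a : R[i]) phi psi, CinftyC phi -> CinftyC psi ->
  v (fun y => a * phi y + psi y) = a * v phi + v psi.

Definition null_seq (phis : nat -> 'rV[R]_N -> R[i]) : Prop :=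
  (forall m, CinftyC (phis m)) /\
  forall (s : seq 'I_N) (e : R), 0 < e -> exists M, forall m, (M <= m)%N ->
    forall y, normc (iter_pderivC s (phis m) y) <= e.

(** Unlike a bound by [Ck_norm], this form of continuity passes to [vfield a j u] without tracking
    constants, since null sequences are stable under derivatives and smooth multiples. It is enough
    to evaluate a functional on a Fourier series. *)
Definition seq_continuous v : Prop := forall phis, null_seq phis ->
  forall e : R, 0 < e -> exists M, forall m, (M <= m)%N -> normc (v (phis m)) <= e.

Lemma fseries_null_tail c : rapidC c -> null_seq (fun m y => fseries c y - fpart m c y).
Proof.
move=> rc; split=> [m|s].
  by apply: CinftyC_B; [exact: CinftyC_fseries|exact: CinftyC_fpart].
(* The innermost derivative is peeled off: it acts on the series by changing the coefficients, hence
   the induction over all [c]. *)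
elim/last_ind: s c rc => [|s j IH] c rc e e0.
  have [A A0 HA] := fseries_tail rc; have [M HM] := tail_small A e0.
  by exists M => m /HM h y; apply: le_trans h; exact: HA.
have [M HM] := IH _ (rapidC_dcoef j rc) e e0; exists M => m /HM h y.
rewrite iter_pderivC_rcons pderivC_D; [|exact: CinftyC_fseries|by apply: CinftyC_N; exact: CinftyC_fpart].
by rewrite pderivC_N ?pderivC_fseries ?pderivC_fpart //; exact: CinftyC_fpart.
Qed.

Lemma clinear0 v : clinear v -> v (fun _ => 0) = 0.
Proof.
move=> lv; have := lv 1 _ _ (CinftyC_cst 0) (CinftyC_cst 0).
rewrite (_ : (fun _ => _) = fun _ => 0); last by apply/funext => y; rewrite mulr0 addr0.
by rewrite mul1r => /eqP; rewrite -subr_eq subrr eq_sym => /eqP.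
Qed.

Lemma clinearD v phi psi : clinear v -> CinftyC phi -> CinftyC psi ->
  v (fun y => phi y + psi y) = v phi + v psi.
Proof.
move=> lv sp ss; rewrite -[v phi]mul1r -lv //; congr v.
by apply/funext => y; rewrite mul1r.
Qed.

Lemma clinearZ v (a : R[i]) phi : clinear v -> CinftyC phi ->
  v (fun y => a * phi y) = a * v phi.
Proof.
move=> lv sp; have := lv a _ _ sp (CinftyC_cst 0); rewrite clinear0 // addr0 => <-.
by congr v; apply/funext => y; rewrite addr0.
Qed.

Lemma clinear_fpart v c m : clinear v ->
  v (fpart m c) = \sum_(0 <= i < m) lterm (fun xi => c xi * v (expi xi)) i.
Proof.
move=> lv; elim: m => [|m IH].
  rewrite big_nil (_ : fpart 0 c = fun _ => 0) ?clinear0 //.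
  by apply/funext => y; rewrite fpartE big_nil.
rewrite big_nat_recr //= -IH.
rewrite (_ : fpart m.+1 c = fun y => fpart m c y + lterm (fun xi => c xi * expi xi y) m).
  rewrite clinearD //; first congr (_ + _); try exact: CinftyC_fpart.
    rewrite /lterm; case: pickle_inv => [xi|]; last exact: clinear0.
    by rewrite clinearZ //; exact: CinftyC_expi.
  rewrite /lterm; case: pickle_inv => [xi|]; last exact: CinftyC_cst.
  by apply: CinftyC_Z; exact: CinftyC_expi.
by apply/funext => y; rewrite !fpartE big_nat_recr.
Qed.

(** The pairing with test functions is bilinear, without conjugation, hence the reflected frequency:
    this is the function whose integral against [expi xi] is [c xi]. *)
Definition density c : 'rV[R]_N -> R[i] := fseries (fun xi => (P^-1)%:C * c (- xi)).

Lemma CinftyC_density c : rapidC c -> CinftyC (density c).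
Proof. by move=> rc; apply: CinftyC_fseries; apply: rapidC_Z; exact: rapidC_opp. Qed.

Lemma density_coef c xi : rapidC c ->
  torus_integralC (fun y => density c y * expi xi y) = c xi.
Proof.
move=> rc; have := @fseries_coef (fun xi => (P^-1)%:C * c (- xi)) (- xi).
rewrite !opprK => ->; last by apply: rapidC_Z; exact: rapidC_opp.
rewrite mulrAC -rmorphM /= mulVf ?mul1r //.
by rewrite lt0r_neq0 // two_piX_gt0.
Qed.

(* [c] need not agree with [v] at all frequencies: with [c] cut off to a single *)
(* frequency in one variable this represents [v] on the corresponding mode.    *)
Lemma densityP v c phi : clinear v -> seq_continuous v -> rapidC c -> CinftyC phi ->
  (forall xi, fcoef phi xi != 0 -> v (expi xi) = c xi) ->
  v phi = torus_integralC (fun y => density c y * phi y).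
Proof.
move=> lv cv rc sp H; have rf := rapidC_fcoef sp.
have sd := CinftyC_density rc.
apply/eqP; rewrite -subr_eq0; apply/eqP/normc_eq0 => e e0.
have e2 : 0 < e / 2 by rewrite divr_gt0.
have [M1 HM1] := cv _ (fseries_null_tail rf) _ e2.
have [M2 HM2] := fseries_integral_tail rf sd e2.
pose m := maxn M1 M2.
have := HM1 m (leq_maxl _ _); have := HM2 m (leq_maxr _ _).
rewrite fourier_inversion // integralC_fpart // => h2 h1.
have := normcD (v (fun y => phi y - fpart m (fcoef phi) y))
  (- (torus_integralC (fun y => phi y * density c y) -
     \sum_(0 <= i < m) lterm (fun xi => fcoef phi xi *
        torus_integralC (fun y => expi xi y * density c y)) i)).
rewrite normc_opp => h.
have E : v (fun y => phi y - fpart m (fcoef phi) y) =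
   v phi - \sum_(0 <= i < m) lterm (fun xi => fcoef phi xi *
        torus_integralC (fun y => expi xi y * density c y)) i.
  have -> : (fun y => phi y - fpart m (fcoef phi) y) = fun y => -1 * fpart m (fcoef phi) y + phi y.
    by apply/funext => y; rewrite mulN1r addrC.
  rewrite lv //; last exact: CinftyC_fpart.
  rewrite mulN1r addrC clinear_fpart //; congr (_ - _); apply: eq_bigr => i _.
  rewrite /lterm; case: pickle_inv => [xi|] //.
  have [->|nz] := eqVneq (fcoef phi xi) 0; first by rewrite !mul0r.
  rewrite H // -[in LHS](density_coef xi rc); congr (_ * torus_integralC _).
  by apply/funext => y; rewrite mulrC.
rewrite E opprB addrA subrK in h.
have -> : (fun y => density c y * phi y) = fun y => phi y * density c y.
  by apply/funext => y; rewrite mulrC.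
by apply: le_trans h _; rewrite -E; lra.
Qed.

End FourierSeries.

(** * Null sequences and the finite order of distributions *)

Section NullSequences.
Context {R : realType} {N : nat}.
Implicit Types (j : 'I_N) (g phi : 'rV[R]_N -> R[i]) (phis psis : nat -> 'rV[R]_N -> R[i])
  (u : functional R N).
Local Notation normc := Normc.normc.

Lemma null_seqD phis psis : null_seq phis -> null_seq psis ->
  null_seq (fun m y => phis m y + psis m y).
Proof.
move=> [s1 n1] [s2 n2]; split=> [m|s e e0]; first exact: CinftyC_D.
have e2 : 0 < e / 2 by rewrite divr_gt0.
have [M1 H1] := n1 s _ e2; have [M2 H2] := n2 s _ e2.
exists (maxn M1 M2) => m; rewrite geq_max => /andP[h1 h2] y.
rewrite iter_pderivC_D //; apply: le_trans (normcD _ _) _.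
by have := H1 m h1 y; have := H2 m h2 y; lra.
Qed.

Lemma null_seq_pderiv j phis : null_seq phis -> null_seq (fun m => pderivC j (phis m)).
Proof.
move=> [s1 n1]; split=> [m|s e e0]; first exact: CinftyC_pderiv.
by have [M H] := n1 (rcons s j) _ e0; exists M => m mM y; rewrite -iter_pderivC_rcons; exact: H.
Qed.

Lemma null_seqM g phis : CinftyC g -> null_seq phis -> null_seq (fun m y => g y * phis m y).
Proof.
move=> sg np; split=> [m|s]; first by apply: CinftyC_M => //; case: np.
elim/last_ind: s g phis sg np => [|s j IH] g phis sg np e e0.
  have [B B0 HB] := CinftyC_bounded sg.
  have e1 : 0 < e / (B + 1) by rewrite divr_gt0 // ltr_wpDl.
  have [_ n1] := np; have [M HM] := n1 [::] _ e1; exists M => m mM y /=.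
  have := HM m mM y; rewrite /= ler_pdivlMr ?ltr_wpDl // => h.
  rewrite normcM; apply: le_trans h; rewrite mulrC; apply: ler_wpM2l; first exact: normc_ge0.
  by apply: le_trans (HB y) _; rewrite lerDl.
have e2 : 0 < e / 2 by rewrite divr_gt0.
have [M1 H1] := IH _ _ (CinftyC_pderiv j sg) np _ e2.
have [M2 H2] := IH _ _ sg (null_seq_pderiv j np) _ e2.
exists (maxn M1 M2) => m; rewrite geq_max => /andP[h1 h2] y.
have [sp _] := np.
rewrite iter_pderivC_rcons pderivC_M // iter_pderivC_D; last 2 first.
- by apply: CinftyC_M => //; exact: CinftyC_pderiv.
- by apply: CinftyC_M => //; exact: CinftyC_pderiv.
apply: le_trans (normcD _ _) _.
by have := H1 m h1 y; have := H2 m h2 y; lra.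
Qed.

Lemma null_seq_uniform (k : nat) phis (e : R) : null_seq phis -> 0 < e ->
  exists M, forall m, (M <= m)%N -> forall s : seq 'I_N, (size s <= k)%N ->
    forall y, normc (iter_pderivC s (phis m) y) <= e.
Proof.
move=> np e0; elim: k phis np => [|k IH] phis np.
  have [_ /(_ [::] e e0)[M HM]] := np; exists M => m mM s.
  by rewrite leqn0 size_eq0 => /eqP -> y; exact: HM.
have [_ /(_ [::] e e0)[M0 HM0]] := np.
have [M HM] := choice (fun j => IH _ (null_seq_pderiv j np)).
exists (M0 + \sum_j M j)%N => m mM; elim/last_ind => [_ y|s j _].
  by apply: HM0; apply: leq_trans mM; rewrite leq_addr.
rewrite size_rcons ltnS => sk y; rewrite iter_pderivC_rcons; apply: HM => //.
by apply: leq_trans mM; rewrite (bigD1 j) //= addnCA leq_addr.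
Qed.

(** Replaces the supremum in [Ck_norm] by any uniform bound [B], whose existence also makes that
    supremum meaningful. The absolute value is taken because the sign of the given constant is not
    known. *)
Lemma distribution_bound u : is_distribution u -> exists (k : nat) (C : R),
  0 <= C /\ forall phi (B : R), CinftyC phi ->
    (forall (s : seq 'I_N) y, (size s <= k)%N -> normc (iter_pderivC s phi y) <= B) ->
    normc (u phi) <= C * B.
Proof.
move=> [_ [k [C HC]]]; exists k, `|C|; split => // phi B sp HB.
apply: le_trans (HC phi sp) _; rewrite /Ck_norm; set S := (X in sup X).
have S0 : S (normc (iter_pderivC [::] phi 0)) by exists [::] => //; exists 0.
have SB : ubound S B by move=> _ [s sk [y _ <-]]; exact: HB.
have sup0 : 0 <= sup S.
  apply: le_trans (ub_le_sup _ S0); first exact: normc_ge0.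
  by exists B.
have supB : sup S <= B by apply: ge_sup SB; eexists; exact: S0.
apply: (@le_trans _ _ (`|C| * sup S)); last exact: ler_wpM2l.
by apply: ler_wpM2r => //; exact: ler_norm.
Qed.

Lemma distribution_clinear u : is_distribution u -> clinear u.
Proof. by case. Qed.

Lemma distribution_seq_continuous u : is_distribution u -> seq_continuous u.
Proof.
move=> /distribution_bound[k [C [C0 HC]]] phis np e e0.
have e1 : 0 < e / (C + 1) by rewrite divr_gt0 // ltr_wpDl.
have [M HM] := null_seq_uniform k np e1.
exists M => m mM; have [sp _] := np.
apply: (@le_trans _ _ (C * (e / (C + 1)))).
  by apply: HC => // s y sk; exact: HM.
by rewrite mulrA ler_pdivrMr ?ltr_wpDl // mulrC ler_wpM2l // ?lerDl // ltW.
Qed.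

(** On a Fourier series both derivatives multiply the coefficients by scalars, and scalars commute;
    inversion writes every smooth function as such a series. *)
Lemma pderivC_comm j k phi : CinftyC phi ->
  pderivC j (pderivC k phi) = pderivC k (pderivC j phi).
Proof.
move=> sp; rewrite -(fourier_inversion sp); have rf := rapidC_fcoef sp.
rewrite !pderivC_fseries //; try exact: rapidC_dcoef.
by congr fseries; apply/funext => xi; rewrite /dcoef mulrCA.
Qed.

(** A derivative either falls on [b], giving another multiplier, or brings down a coordinate of
    [xi]. The point is that [C] is uniform in [xi]. *)
Lemma iter_pderivC_expi_bound (k : nat) b : CinftyC b ->
  exists2 C : R, 0 <= C & forall (xi : 'rV[int]_N) (s : seq 'I_N) y, (size s <= k)%N ->
    normc (iter_pderivC s (fun z => b z * expi xi z) y) <= C * (1 + norm1 xi) ^+ k.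
Proof.
elim: k b => [|k IH] b sb; have [B B0 HB] := CinftyC_bounded sb.
  exists B => // xi s y; rewrite leqn0 size_eq0 => /eqP -> /=.
  by rewrite normcM normc_expi !mulr1.
have H j : exists c : R, 0 <= c /\ forall (xi : 'rV[int]_N) (s : seq 'I_N) y,
    (size s <= k)%N ->
    normc (iter_pderivC s (fun z => pderivC j b z * expi xi z) y) <= c * (1 + norm1 xi) ^+ k.
  by have [c c0 hc] := IH _ (CinftyC_pderiv j sb); exists c.
have [C HC] := choice H.
have [C1 C10 HC1] := IH _ sb.
have C0 : 0 <= \sum_j C j by apply: sumr_ge0 => j _; have [] := HC j.
exists (B + (C1 + \sum_j C j)) => [|xi]; first by rewrite !addr_ge0.
have q1 := onenorm_ge1 (R := R) xi.
have qk : 1 <= (1 + norm1 xi) ^+ k :> R by rewrite exprn_ege1.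
elim/last_ind => [y _|s j _ y].
  rewrite /= normcM normc_expi mulr1; apply: le_trans (HB y) _.
  rewrite -[leLHS]mulr1; apply: ler_pM => //; first by rewrite lerDl addr_ge0.
  by rewrite exprn_ege1.
rewrite size_rcons ltnS => sk; rewrite iter_pderivC_rcons.
have se := CinftyC_expi (R := R) xi.
rewrite pderivC_M // pderivC_expi.
rewrite (_ : (fun z => _ + b z * (imagc _ * _)) = fun z => pderivC j b z * expi xi z +
   imagc (xi 0 j)%:~R * (b z * expi xi z)); last by apply/funext => z; rewrite (mulrCA (b z)).
have sd : CinftyC (fun z => pderivC j b z * expi xi z).
  by apply: CinftyC_M => //; exact: CinftyC_pderiv.
have sbe : CinftyC (fun z => b z * expi xi z) by exact: CinftyC_M.
rewrite iter_pderivC_D //; last exact: CinftyC_Z.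
rewrite iter_pderivC_Z //; apply: le_trans (normcD _ _) _.
rewrite normcM normc_imag; have [_ /(_ xi s y sk) h1] := HC j; have h2 := HC1 xi s y sk.
have h3 : `|(xi 0 j)%:~R : R| <= norm1 xi := coord_le_norm1 _ _.
have Cj : C j <= \sum_j C j.
  by rewrite (bigD1 j) //= lerDl; apply: sumr_ge0 => i _; have [] := HC i.
have n0 := norm1_ge0 (R := R) xi.
apply: (@le_trans _ _ ((\sum_j C j) * (1 + norm1 xi) ^+ k + norm1 xi * (C1 * (1 + norm1 xi) ^+ k))).
  apply: lerD; last by apply: ler_pM => //; exact: normc_ge0.
  by apply: le_trans h1 _; apply: ler_wpM2r => //; apply: le_trans qk.
rewrite exprS; set q := (1 + norm1 xi) ^+ k in qk *; set S := \sum_j C j in C0 *.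
rewrite -subr_ge0.
have -> : (B + (C1 + S)) * ((1 + norm1 xi) * q) - (S * q + norm1 xi * (C1 * q)) =
  B * (1 + norm1 xi) * q + C1 * q + S * norm1 xi * q by ring.
have q0 : 0 <= q by lra.
by rewrite !addr_ge0 ?mulr_ge0 //; lra.
Qed.

End NullSequences.

(** * The vector fields *)

Section FieldOperators.
Context {R : realType} {n : nat}.
Implicit Types (phi psi f : 'rV[R]_(n + 1) -> R[i]) (g : 'rV[R]_n -> R) (u w : functional R (n + 1)).
Local Notation normc := Normc.normc.

Definition xj : 'I_(n + 1) := rshift n 0.
Definition tj (j : 'I_n) : 'I_(n + 1) := lshift 1 j.

Lemma lsubmx_shift_t (y : 'rV[R]_(n + 1)) (h : R) j :
  lsubmx (h *: delta_mx 0 (tj j) + y) = h *: delta_mx 0 j + lsubmx y.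
Proof. by apply/rowP => i; rewrite !mxE eq_shift. Qed.

Lemma lsubmx_shift_x (y : 'rV[R]_(n + 1)) (h : R) :
  lsubmx (h *: delta_mx 0 xj + y) = lsubmx y.
Proof. by apply/rowP => i; rewrite !mxE eq_shift andbF mulr0 add0r. Qed.

Lemma pderiv_lsub_t g j : pderiv (tj j) (fun y => g (lsubmx y)) = fun y => pderiv j g (lsubmx y).
Proof.
by apply/funext => y; apply: (same_line _).2 => h; rewrite lsubmx_shift_t.
Qed.

Lemma pderiv_lsub_x g : pderiv xj (fun y => g (lsubmx y)) = fun _ => 0.
Proof.
apply/funext => y; rewrite -[RHS](_ : pderiv xj (fun _ => g (lsubmx y)) y = 0).
  by apply: (same_line _).2 => h; rewrite lsubmx_shift_x.
by rewrite pderiv_cst.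
Qed.

Lemma Cinfty_lsub g : Cinfty g -> Cinfty (fun y : 'rV[R]_(n + 1) => g (lsubmx y)).
Proof.
move=> cg; split; last first.
  move=> j y; rewrite addrC; case: (@split_ordP n 1 j) => k ->.
    by rewrite (lsubmx_shift_t y _ k) addrC; case: cg.
  by rewrite (ord1 k) (lsubmx_shift_x y).
apply: (@smooth_coind _ _ (fun q => exists2 g, Cinfty g & q = fun y : 'rV[R]_(n + 1) => g (lsubmx y)));
  last by exists g.
move=> _ [{}g {}cg ->]; split.
- apply: continuous_epsilon => y e e0.
  have [d d0 Hd] := cper_unif (Cinfty_cper cg) e0.
  exists d => // z yz; apply: Hd; apply: le_lt_trans yz.
  by apply: row_norm_le => // j; have := coord_le_norm (y - z) (tj j); rewrite !mxE.
- move=> j y; case: (@split_ordP n 1 j) => k ->.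
    have [H _] := @same_line R _ _ g (fun y : 'rV[R]_(n + 1) => g (lsubmx y))
      (delta_mx 0 k) (delta_mx 0 (tj k)) (lsubmx y) y (fun h => congr1 g (lsubmx_shift_t y h k)).
    by apply: H; apply: smooth_derivable; case: cg.
  rewrite (ord1 k).
  have [H _] := @same_line R _ _ (fun _ : 'rV[R]_(n + 1) => g (lsubmx y)) (fun y => g (lsubmx y))
     (delta_mx 0 xj) (delta_mx 0 xj) y y (fun h => congr1 g (lsubmx_shift_x y h)).
  by apply: H; exact: ex_derive.
- move=> j; case: (@split_ordP n 1 j) => k ->.
    exists (pderiv k g); first exact: Cinfty_pderiv.
    exact: pderiv_lsub_t.
  exists (fun _ => 0); first exact: Cinfty_cst.
  by rewrite (ord1 k); exact: pderiv_lsub_x.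
Qed.

Context (a : 'I_n -> 'rV[R]_n -> R) (a_smooth : forall j, Cinfty (a j)).

Definition coefA (j : 'I_n) : 'rV[R]_(n + 1) -> R[i] := fun y => (a j (lsubmx y))%:C.

Lemma CinftyC_coefA j : CinftyC (coefA j).
Proof. by apply: CinftyC_real; exact: Cinfty_lsub. Qed.

Lemma pderivC_x_coefA j : pderivC xj (coefA j) = fun _ => 0.
Proof. by rewrite pderivC_real pderiv_lsub_x. Qed.

Definition Xf (j : 'I_n) phi : 'rV[R]_(n + 1) -> R[i] :=
  fun y => pderivC (tj j) phi y + coefA j y * pderivC xj phi y.

Lemma CinftyC_AX j phi : CinftyC phi -> CinftyC (fun y => coefA j y * pderivC xj phi y).
Proof.
by move=> sp; apply: CinftyC_M; [exact: CinftyC_coefA|exact: CinftyC_pderiv].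
Qed.

Lemma CinftyC_Xf j phi : CinftyC phi -> CinftyC (Xf j phi).
Proof.
by move=> sp; apply: CinftyC_D; [exact: CinftyC_pderiv|exact: CinftyC_AX].
Qed.

Lemma XfD j phi psi : CinftyC phi -> CinftyC psi ->
  Xf j (fun y => phi y + psi y) = fun y => Xf j phi y + Xf j psi y.
Proof.
move=> sp ss; apply/funext => y; rewrite /Xf !pderivC_D //; ring.
Qed.

Lemma XfZ j (c : R[i]) phi : CinftyC phi ->
  Xf j (fun y => c * phi y) = fun y => c * Xf j phi y.
Proof. by move=> sp; apply/funext => y; rewrite /Xf !pderivC_Z //; ring. Qed.

Lemma XfM j phi psi : CinftyC phi -> CinftyC psi ->
  Xf j (fun y => phi y * psi y) = fun y => Xf j phi y * psi y + phi y * Xf j psi y.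
Proof. by move=> sp ss; apply/funext => y; rewrite /Xf !pderivC_M //; ring. Qed.

Lemma Xf_conj j phi : CinftyC phi ->
  Xf j (fun y => ((phi y)^*)%C) = fun y => ((Xf j phi y)^*)%C.
Proof.
move=> sp; apply/funext => y; rewrite /Xf !pderivC_conj // conj_add conj_mul.
by congr (_ + _ * _); rewrite /coefA /= oppr0.
Qed.

(** [X_j] is divergence free: [a_j] does not depend on x, so its product with an x-derivative is
    again an x-derivative. *)
Lemma integralC_Xf j phi : CinftyC phi -> torus_integralC (Xf j phi) = 0.
Proof.
move=> sp; rewrite integralC_D; [|exact: CinftyC_pderiv|exact: CinftyC_AX].
rewrite integralC_pderiv // add0r.
rewrite -[RHS](integralC_pderiv xj (CinftyC_M (CinftyC_coefA j) sp)).
congr torus_integralC; rewrite pderivC_M //; last exact: CinftyC_coefA.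
by apply/funext => y; rewrite pderivC_x_coefA mul0r add0r.
Qed.

Lemma integralC_Xf_parts j phi psi : CinftyC phi -> CinftyC psi ->
  torus_integralC (fun y => Xf j phi y * psi y) =
  - torus_integralC (fun y => phi y * Xf j psi y).
Proof.
move=> sp ss; apply/eqP; rewrite -subr_eq0 opprK -integralC_D.
- by rewrite -XfM // integralC_Xf //; exact: CinftyC_M.
- by apply: CinftyC_M => //; exact: CinftyC_Xf.
- by apply: CinftyC_M => //; exact: CinftyC_Xf.
Qed.

(** The coefficient passes through the derivative in x, so the transpose of [X_j] is [- X_j]; in
    [sum_squares] the two signs cancel. *)
Lemma vfieldE j u phi : clinear u -> CinftyC phi -> vfield a j u phi = - u (Xf j phi).
Proof.
move=> lu sp; rewrite /vfield /distr_mul /distr_deriv.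
have -> : (fun y : 'rV[R]_(n + 1) => (a j (lsubmx y))%:C * phi y) = fun y => coefA j y * phi y by [].
rewrite pderivC_M //; last exact: CinftyC_coefA.
rewrite -[rshift n 0]/xj pderivC_x_coefA -opprD -clinearD //; last 2 first.
- exact: CinftyC_pderiv.
- apply: CinftyC_D; last exact: CinftyC_AX.
  by apply: CinftyC_M => //; exact: CinftyC_cst.
congr (- u _); apply/funext => y; rewrite /Xf /=; ring.
Qed.

Lemma clinear_vfield j u : clinear u -> clinear (vfield a j u).
Proof.
move=> lu c phi psi sp ss.
have scp : CinftyC (fun y => c * phi y) by exact: CinftyC_Z.
rewrite !vfieldE //; last exact: CinftyC_D.
rewrite XfD // XfZ // lu; [ring|exact: CinftyC_Xf|exact: CinftyC_Xf].
Qed.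

Lemma null_seq_Xf j phis : null_seq phis -> null_seq (fun m => Xf j (phis m)).
Proof.
move=> np; apply: null_seqD; first exact: null_seq_pderiv.
by apply: null_seqM; [exact: CinftyC_coefA|exact: null_seq_pderiv].
Qed.

Lemma seq_continuous_vfield j u : clinear u -> seq_continuous u -> seq_continuous (vfield a j u).
Proof.
move=> lu cu phis np e e0; have [M HM] := cu _ (null_seq_Xf j np) e e0.
exists M => m mM; have [sp _] := np; rewrite vfieldE // normc_opp; exact: HM.
Qed.

Lemma sum_squaresE u phi : clinear u -> CinftyC phi ->
  sum_squares a u phi = \sum_(j < n) u (Xf j (Xf j phi)).
Proof.
move=> lu sp; apply: eq_bigr => j _.
rewrite vfieldE //; last exact: clinear_vfield.
by rewrite vfieldE ?opprK //; exact: CinftyC_Xf.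
Qed.

Lemma Xf_expi j (xi : 'rV[int]_(n + 1)) : Xf j (expi xi) = fun y =>
  imagc (xi 0 (tj j))%:~R * expi xi y + imagc (xi 0 xj)%:~R * (coefA j y * expi xi y).
Proof. by apply/funext => y; rewrite /Xf !pderivC_expi; ring. Qed.

Lemma vfield_density j w F : CinftyC F ->
  (forall phi, CinftyC phi -> w phi = torus_integralC (fun y => F y * phi y)) ->
  forall phi, CinftyC phi -> vfield a j w phi = torus_integralC (fun y => Xf j F y * phi y).
Proof.
move=> sF H phi sp; rewrite integralC_Xf_parts // -H; last exact: CinftyC_Xf.
apply: vfieldE => // c p q sp' sq.
rewrite !H //; last by apply: CinftyC_D => //; exact: CinftyC_Z.
have sFp : CinftyC (fun y => F y * p y) by exact: CinftyC_M.
have sFq : CinftyC (fun y => F y * q y) by exact: CinftyC_M.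
rewrite -integralC_lin //; congr torus_integralC; apply/funext => y; ring.
Qed.

(** If [F_j] is the density of [X_j u], then the sum of the [X_j F_j] is the density of [P u]. *)
Lemma sum_squares_smooth u : is_distribution u ->
  (forall j, is_smooth_distribution (vfield a j u)) ->
  is_smooth_distribution (sum_squares a u).
Proof.
move=> du H; have [F HF] := choice H.
have sXF j : CinftyC (Xf j (F j)) by apply: CinftyC_Xf; case: (HF j).
exists (fun y => \sum_(j < n) Xf j (F j) y); split; first exact: CinftyC_sum.
move=> phi sp; rewrite /sum_squares.
under eq_bigr => j _.
  rewrite (@vfield_density j (vfield a j u) (F j)) //; [|by case: (HF j)|by case: (HF j)].
  over.
rewrite -integralC_sum => [|j]; last exact: CinftyC_M.
by congr torus_integralC; apply/funext => y; rewrite mulr_suml.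
Qed.

End FieldOperators.

(** * Elliptic estimates *)

Section Growth.
Context {R : realType} {n : nat}.
Implicit Types (xi : 'rV[int]_(n + 1)) (g h : 'rV[int]_(n + 1) -> R[i]).
Local Notation normc := Normc.normc.

(** Frequencies along t and along x are measured apart, because the bootstrap gains powers of the
    first and loses powers of the second. *)
Definition tnorm xi : R := 1 + \sum_(j < n) `|(xi 0 (tj j))%:~R|.
Definition xnorm xi : R := 1 + `|(xi 0 xj)%:~R|.

Lemma tnorm_ge1 xi : 1 <= tnorm xi.
Proof. by rewrite lerDl sumr_ge0. Qed.

Lemma xnorm_ge1 xi : 1 <= xnorm xi.
Proof. by rewrite lerDl. Qed.

Lemma tnorm_ge0 xi : 0 <= tnorm xi. Proof. exact: le_trans (tnorm_ge1 _). Qed.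
Lemma xnorm_ge0 xi : 0 <= xnorm xi. Proof. exact: le_trans (xnorm_ge1 _). Qed.

Lemma norm1_split xi : 1 + norm1 xi = tnorm xi + xnorm xi - 1 :> R.
Proof.
by rewrite /norm1 big_split_ord /= big_ord1 /tnorm /xnorm /tj /xj; ring.
Qed.

Lemma onenorm_le xi : 1 + norm1 xi <= tnorm xi * xnorm xi :> R.
Proof.
rewrite norm1_split; have := tnorm_ge1 xi; have := xnorm_ge1 xi.
set q := tnorm xi; set k := xnorm xi => k1 q1; nra.
Qed.

Lemma tnorm_le_onenorm xi : tnorm xi <= 1 + norm1 xi.
Proof. by rewrite norm1_split; have := xnorm_ge1 xi; lra. Qed.

(* The frequency along [x] is only controlled polynomially. *)
Definition growth (d p : nat) g : Prop := exists (M : nat) (C : R), 0 <= C /\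
  forall xi, normc (g xi) * tnorm xi ^+ p <= C * xnorm xi ^+ M * tnorm xi ^+ d.

Lemma growthD d p g h : growth d p g -> growth d p h -> growth d p (fun xi => g xi + h xi).
Proof.
move=> [M1 [C1 [C10 H1]]] [M2 [C2 [C20 H2]]].
exists (M1 + M2)%N, (C1 + C2); split=> [|xi]; first exact: addr_ge0.
have q0 e : 0 <= tnorm xi ^+ e by rewrite exprn_ge0 // tnorm_ge0.
have k1 := xnorm_ge1 xi.
apply: (@le_trans _ _ ((normc (g xi) + normc (h xi)) * tnorm xi ^+ p)).
  by apply: ler_wpM2r => //; exact: normcD.
rewrite mulrDl !mulrDl; apply: lerD.
  apply: le_trans (H1 xi) _; apply: ler_wpM2r => //; apply: ler_wpM2l => //.
  by apply: ler_weXn2l => //; rewrite leq_addr.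
apply: le_trans (H2 xi) _; apply: ler_wpM2r => //; apply: ler_wpM2l => //.
by apply: ler_weXn2l => //; rewrite leq_addl.
Qed.

Lemma growth0 d p : growth d p (fun _ => 0).
Proof. by exists 0%N, 0; split => // xi; rewrite Normc.normc0 !mul0r. Qed.

Lemma growth_sum d p (F : 'I_n -> 'rV[int]_(n + 1) -> R[i]) :
  (forall j, growth d p (F j)) -> growth d p (fun xi => \sum_j F j xi).
Proof.
move=> H; elim: (index_enum _) => [|j r IH].
  rewrite (_ : (fun _ => _) = fun _ => 0); first exact: growth0.
  by apply/funext => xi; rewrite big_nil.
rewrite (_ : (fun _ => _) = fun xi => F j xi + \sum_(i <- r) F i xi); first exact: growthD.
by apply/funext => xi; rewrite big_cons.
Qed.

(** The bound on [h] covers all the coefficients met below, of sizes |xi_j|, |k|, |xi_j k| and k^2: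
    one power of [tnorm] is lost, and the powers of [xnorm] go into the free exponent. *)
Lemma growthM d p g (h : 'rV[int]_(n + 1) -> R[i]) :
  (forall xi, normc (h xi) <= xnorm xi ^+ 2 * tnorm xi) -> growth d p g ->
  growth d.+1 p (fun xi => h xi * g xi).
Proof.
move=> hb [M [C [C0 H]]]; exists M.+2, C; split => // xi.
have -> : C * xnorm xi ^+ M.+2 * tnorm xi ^+ d.+1 =
   (xnorm xi ^+ 2 * tnorm xi) * (C * xnorm xi ^+ M * tnorm xi ^+ d).
  by rewrite !exprS; ring.
rewrite normcM -mulrA; apply: ler_pM => //; first exact: normc_ge0.
by rewrite mulr_ge0 ?normc_ge0 // exprn_ge0 // tnorm_ge0.
Qed.

Lemma growth1 d p g : growth d p g -> growth d.+1 p g.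
Proof.
move=> gg; rewrite (_ : g = fun xi => 1 * g xi); last by apply/funext => xi; rewrite mul1r.
apply: growthM gg => xi; rewrite Normc.normc1.
by apply: mulr_ege1; rewrite ?exprn_ege1 ?tnorm_ge1 ?xnorm_ge1.
Qed.

Lemma growthN d p g : growth d p g -> growth d p (fun xi => - g xi).
Proof. by move=> [M [C [C0 H]]]; exists M, C; split => // xi; rewrite normc_opp. Qed.

Lemma growth_rapid d p g : rapidC g -> growth d p g.
Proof.
move=> /(_ p)[C HC]; exists 0%N, `|C|; split => // xi; rewrite expr0 mulr1.
apply: (@le_trans _ _ (normc (g xi) * (1 + norm1 xi) ^+ p)).
  apply: ler_wpM2l; first exact: normc_ge0.
  apply: lerXn2r; rewrite ?nnegrE ?tnorm_ge0 ?tnorm_le_onenorm //.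
  by rewrite addr_ge0 ?norm1_ge0.
apply: le_trans (HC xi) _; apply: le_trans (ler_norm C) _.
by rewrite ler_peMr // exprn_ege1 // tnorm_ge1.
Qed.

Lemma growth_cancel d p g : growth d.+1 p.+1 g -> growth d p g.
Proof.
move=> [M [C [C0 H]]]; exists M, C; split => // xi; have := H xi.
have q0 : 0 < tnorm xi by exact: lt_le_trans (tnorm_ge1 _).
by rewrite !exprS mulrCA [leRHS]mulrCA ler_pM2l.
Qed.

Lemma growth_cancel_all d p g : growth d (d + p)%N g -> growth 0 p g.
Proof. by elim: d => // d IH; rewrite addSn => /growth_cancel. Qed.

Definition tsqr xi : R := \sum_(j < n) (xi 0 (tj j))%:~R ^+ 2.

Lemma tsqr_ge0 xi : 0 <= tsqr xi.
Proof. by apply: sumr_ge0 => j _; exact: sqr_ge0. Qed.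

(** Cauchy-Schwarz, obtained by summing 2 |s| |t| <= s^2 + t^2 over all pairs of coordinates. *)
Lemma tnorm_sqr xi : tnorm xi ^+ 2 <= 2 + 2 * n%:R * tsqr xi.
Proof.
have cs : (\sum_(j < n) `|(xi 0 (tj j))%:~R : R|) ^+ 2 <= n%:R * tsqr xi.
  pose x (i : 'I_n) : R := (xi 0 (tj i))%:~R ^+ 2 / 2.
  have -> : n%:R * tsqr xi = \sum_(i < n) \sum_(j < n) (x i + x j).
    under eq_bigr => i _ do rewrite big_split /= sumr_const card_ord.
    rewrite big_split /= sumrMnl sumr_const card_ord.
    have -> : \sum_i x i = tsqr xi / 2 by rewrite /tsqr mulr_suml.
    by rewrite -(mulr_natl (tsqr xi / 2) n); field.
  rewrite expr2 mulr_suml; apply: ler_sum => i _.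
  rewrite mulr_sumr; apply: ler_sum => j _; rewrite /x.
  set s := (xi 0 (tj i))%:~R; set t := (xi 0 (tj j))%:~R.
  rewrite -(real_normK (num_real s)) -(real_normK (num_real t)).
  have := sqr_ge0 (`|s| - `|t|); rewrite sqrrB; lra.
rewrite /tnorm; move: cs; set s := \sum_j `|_| => cs.
have : 0 <= s by apply: sumr_ge0.
have := sqr_ge0 (1 - s); rewrite sqrrB sqrrD -mulrA; lra.
Qed.

(** By [tnorm_sqr] the multiplier [tsqr] is worth two powers of [tnorm], while the hypothesis on it
    gives up one: the net gain is one power. *)
Lemma growth_elliptic d p g : growth d p g -> growth d.+1 p (fun xi => (tsqr xi)%:C * g xi) ->
  growth d p.+1 g.
Proof.
move=> /growth1[M1 [C1 [C10 H1]]] [M2 [C2 [C20 H2]]]; apply: growth_cancel.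
exists (M1 + M2)%N, (2 * C1 + 2 * n%:R * C2); split=> [|xi].
  by rewrite addr_ge0 ?mulr_ge0.
have q0 e : 0 <= tnorm xi ^+ e by rewrite exprn_ge0 // tnorm_ge0.
have k1 := xnorm_ge1 xi.
apply: (@le_trans _ _ (normc (g xi) * tnorm xi ^+ p * (2 + 2 * n%:R * tsqr xi))).
  rewrite -addn2 exprD mulrA; apply: ler_wpM2l; last exact: tnorm_sqr.
  by rewrite mulr_ge0 ?normc_ge0.
have h2 := H2 xi; rewrite normcM normc_real (ger0_norm (tsqr_ge0 _)) in h2.
have h1 := H1 xi.
have e1 : xnorm xi ^+ M1 <= xnorm xi ^+ (M1 + M2) by apply: ler_weXn2l => //; rewrite leq_addr.
have e2 : xnorm xi ^+ M2 <= xnorm xi ^+ (M1 + M2) by apply: ler_weXn2l => //; rewrite leq_addl.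
have f1 : normc (g xi) * tnorm xi ^+ p <= C1 * (xnorm xi ^+ (M1 + M2) * tnorm xi ^+ d.+1).
  by apply: le_trans h1 _; rewrite -mulrA; apply: ler_wpM2l => //; apply: ler_wpM2r.
have f2 : tsqr xi * normc (g xi) * tnorm xi ^+ p <= C2 * (xnorm xi ^+ (M1 + M2) * tnorm xi ^+ d.+1).
  by apply: le_trans h2 _; rewrite -mulrA; apply: ler_wpM2l => //; apply: ler_wpM2r.
have f3 : 2 * n%:R * (tsqr xi * normc (g xi) * tnorm xi ^+ p) <=
   2 * n%:R * (C2 * (xnorm xi ^+ (M1 + M2) * tnorm xi ^+ d.+1)) by apply: ler_wpM2l.
set Z := xnorm xi ^+ (M1 + M2) * tnorm xi ^+ d.+1 in f1 f2 f3 *.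
have -> : (2 * C1 + 2 * n%:R * C2) * xnorm xi ^+ (M1 + M2) * tnorm xi ^+ d.+1 =
   2 * (C1 * Z) + 2 * n%:R * (C2 * Z) by rewrite /Z; ring.
have -> : normc (g xi) * tnorm xi ^+ p * (2 + 2 * n%:R * tsqr xi) =
  2 * (normc (g xi) * tnorm xi ^+ p) + 2 * n%:R * (tsqr xi * normc (g xi) * tnorm xi ^+ p) by ring.
apply: lerD => //; first by apply: ler_wpM2l.
Qed.

End Growth.

(** * Bootstrapping the decay in the t-frequencies *)

Section Elliptic.
Context {R : realType} {n : nat}.
Implicit Types (xi : 'rV[int]_(n + 1)) (b phi : 'rV[R]_(n + 1) -> R[i]) (u : functional R (n + 1)).
Local Notation normc := Normc.normc.
Context (a : 'I_n -> 'rV[R]_n -> R) (a_smooth : forall j, Cinfty (a j)).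

Definition test u b xi : R[i] := u (fun y => b y * expi xi y).

Lemma CinftyC_be b xi : CinftyC b -> CinftyC (fun y => b y * expi xi y).
Proof. by move=> sb; apply: CinftyC_M => //; exact: CinftyC_expi. Qed.

Definition mulA j b : 'rV[R]_(n + 1) -> R[i] := fun y => coefA a j y * b y.

Lemma CinftyC_mulA j b : CinftyC b -> CinftyC (mulA j b).
Proof. by move=> sb; apply: CinftyC_M => //; exact: CinftyC_coefA. Qed.

Lemma Xf_be j b xi : CinftyC b -> Xf a j (fun y => b y * expi xi y) =
  fun y => imagc (xi 0 (tj j))%:~R * (b y * expi xi y) +
    (imagc (xi 0 xj)%:~R * (mulA j b y * expi xi y) + Xf a j b y * expi xi y).
Proof.
move=> sb; rewrite XfM //; last exact: CinftyC_expi.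
by apply/funext => y; rewrite Xf_expi /mulA /=; ring.
Qed.

Lemma test_Xf u j b xi : clinear u -> CinftyC b ->
  u (Xf a j (fun y => b y * expi xi y)) = imagc (xi 0 (tj j))%:~R * test u b xi +
    (imagc (xi 0 xj)%:~R * test u (mulA j b) xi + test u (Xf a j b) xi).
Proof.
move=> lu sb.
have s1 : CinftyC (fun y => mulA j b y * expi xi y) by apply: CinftyC_be; exact: CinftyC_mulA.
have s2 : CinftyC (fun y => Xf a j b y * expi xi y) by apply: CinftyC_be; exact: CinftyC_Xf.
rewrite Xf_be // lu //; first by rewrite lu.
  exact: CinftyC_be.
by apply: CinftyC_D => //; exact: CinftyC_Z.
Qed.

Lemma test_XfXf u j b xi : clinear u -> CinftyC b ->
  u (Xf a j (Xf a j (fun y => b y * expi xi y))) =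
    imagc (xi 0 (tj j))%:~R * u (Xf a j (fun y => b y * expi xi y)) +
    (imagc (xi 0 xj)%:~R * u (Xf a j (fun y => mulA j b y * expi xi y)) +
     u (Xf a j (fun y => Xf a j b y * expi xi y))).
Proof.
move=> lu sb.
have s0 := CinftyC_be xi sb.
have s1 : CinftyC (fun y => mulA j b y * expi xi y) by apply: CinftyC_be; exact: CinftyC_mulA.
have s2 : CinftyC (fun y => Xf a j b y * expi xi y) by apply: CinftyC_be; exact: CinftyC_Xf.
have s3 c : CinftyC (fun y => c * (mulA j b y * expi xi y)) by exact: CinftyC_Z.
rewrite [X in Xf a j X]Xf_be // XfD //; [|exact: CinftyC_Z|exact: CinftyC_D].
rewrite XfD // !XfZ // lu; [|exact: CinftyC_Xf|].
  by rewrite lu //; exact: CinftyC_Xf.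
by apply: CinftyC_D; [apply: CinftyC_Z|]; exact: CinftyC_Xf.
Qed.

Lemma imagc_tj_bound j xi : normc (imagc (xi 0 (tj j))%:~R : R[i]) <= xnorm xi ^+ 2 * tnorm xi.
Proof.
rewrite normc_imag -[leLHS]mul1r; apply: ler_pM => //.
  by rewrite exprn_ege1 // xnorm_ge1.
by rewrite /tnorm (bigD1 j) //= addrCA lerDl addr_ge0 // sumr_ge0.
Qed.

Lemma imagc_xj_bound xi : normc (imagc (xi 0 xj)%:~R : R[i]) <= xnorm xi ^+ 2 * tnorm xi.
Proof.
rewrite normc_imag -[leLHS]mulr1; apply: ler_pM => //; last exact: tnorm_ge1.
by rewrite /xnorm expr2; have := normr_ge0 ((xi 0 xj)%:~R : R); set k := `|_|; nra.
Qed.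

Lemma imagc_tx_bound j xi :
  normc (imagc (xi 0 (tj j))%:~R * imagc (xi 0 xj)%:~R : R[i]) <= xnorm xi ^+ 2 * tnorm xi.
Proof.
rewrite normcM !normc_imag mulrC; apply: ler_pM => //.
  by rewrite /xnorm expr2; have := normr_ge0 ((xi 0 xj)%:~R : R); set k := `|_|; nra.
by rewrite /tnorm (bigD1 j) //= addrCA lerDl addr_ge0 // sumr_ge0.
Qed.

Lemma imagc_xx_bound xi :
  normc (imagc (xi 0 xj)%:~R * imagc (xi 0 xj)%:~R : R[i]) <= xnorm xi ^+ 2 * tnorm xi.
Proof.
rewrite normcM !normc_imag -[leLHS]mulr1; apply: ler_pM => //; last exact: tnorm_ge1.
by rewrite /xnorm expr2; have := normr_ge0 ((xi 0 xj)%:~R : R); set k := `|_|; nra.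
Qed.

Lemma imagc_sqr (r : R) : imagc r * imagc r = - (r ^+ 2)%:C.
Proof. by apply: complexP; rewrite ?Re_mul ?Im_mul ?Re_opp ?Im_opp /=; ring. Qed.

(** The terms of [X_j (X_j (b e_xi))] are again multiples [b' e_xi], where [b'] arises from [b] by
    multiplying with [a_j] and applying [X_j]. The hypothesis is used at all these multipliers and
    is recovered, one power better, at every multiplier. *)
Lemma growth_test u d p : clinear u -> is_smooth_distribution (sum_squares a u) ->
  (forall b, CinftyC b -> growth d p (test u b)) ->
  forall b, CinftyC b -> growth d p.+1 (test u b).
Proof.
move=> lu [F [sF HF]] H b sb; apply: growth_elliptic; first exact: H.
have sXb j := CinftyC_Xf a_smooth j sb.
have sAb j := CinftyC_mulA j sb.
(* The equation for [P u] is solved for its |xi_t|^2 term: each square expands into nine terms, and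
   eight remain besides the one in xi_j^2. *)
rewrite (_ : (fun xi => _) = fun xi =>
  - torus_integralC (fun y => F y * b y * expi xi y) +
  \sum_(j < n) (imagc (xi 0 (tj j))%:~R * test u (Xf a j b) xi +
   (imagc (xi 0 (tj j))%:~R * imagc (xi 0 xj)%:~R * test u (mulA j b) xi +
   (imagc (xi 0 xj)%:~R * test u (Xf a j (mulA j b)) xi +
   (imagc (xi 0 (tj j))%:~R * imagc (xi 0 xj)%:~R * test u (mulA j b) xi +
   (imagc (xi 0 xj)%:~R * imagc (xi 0 xj)%:~R * test u (mulA j (mulA j b)) xi +
   (imagc (xi 0 (tj j))%:~R * test u (Xf a j b) xi +
   (imagc (xi 0 xj)%:~R * test u (mulA j (Xf a j b)) xi +
    test u (Xf a j (Xf a j b)) xi)))))))); last first.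
  apply/funext => xi.
  have := HF _ (CinftyC_be xi sb); rewrite sum_squaresE //; last exact: CinftyC_be.
  have -> : (fun y => F y * (b y * expi xi y)) = fun y => F y * b y * expi xi y.
    by apply/funext => y; rewrite mulrA.
  move=> <-; rewrite -sumrN -big_split /= /tsqr rmorph_sum mulr_suml /=.
  apply: eq_bigr => j _.
  rewrite test_XfXf // !test_Xf //.
  have := imagc_sqr ((xi 0 (tj j))%:~R : R) => E.
  have -> : ((xi 0 (tj j))%:~R ^+ 2 : R)%:C = - (imagc (xi 0 (tj j))%:~R * imagc (xi 0 (tj j))%:~R).
    by rewrite E opprK.
  by ring.
apply: growthD.
  by apply: growthN; apply: growth_rapid; apply: rapidC_fourier; exact: CinftyC_M.
apply: growth_sum => j.
have sXAb := CinftyC_Xf a_smooth j (sAb j).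
apply: growthD; first by apply: growthM (H _ (sXb j)); exact: imagc_tj_bound.
apply: growthD; first by apply: growthM (H _ (sAb j)); exact: imagc_tx_bound.
apply: growthD; first by apply: growthM (H _ sXAb); exact: imagc_xj_bound.
apply: growthD; first by apply: growthM (H _ (sAb j)); exact: imagc_tx_bound.
apply: growthD.
  by apply: growthM (H _ (CinftyC_mulA j (sAb j))); exact: imagc_xx_bound.
apply: growthD; first by apply: growthM (H _ (sXb j)); exact: imagc_tj_bound.
apply: growthD.
  by apply: growthM (H _ (CinftyC_mulA j (sXb j))); exact: imagc_xj_bound.
by apply: growth1; apply: H; exact: CinftyC_Xf.
Qed.

(** The order [d] belongs to [u] and is fixed before [b], which only affects constants. Derivatives
    of [b e_xi] up to order [d] cost (1 + |xi|)^d, split between the two directions by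
    [onenorm_le]. *)
Lemma growth_test0 u : is_distribution u -> exists d, forall b, CinftyC b -> growth d 0 (test u b).
Proof.
move=> du; have [d [C [C0 HC]]] := distribution_bound du.
exists d => b sb; have [B B0 HB] := iter_pderivC_expi_bound d sb.
exists d, (C * B); split=> [|xi]; first exact: mulr_ge0.
rewrite expr0 mulr1 /test.
apply: le_trans (HC _ _ (CinftyC_be xi sb) (HB xi)) _.
rewrite -!mulrA; apply: ler_wpM2l => //; apply: ler_wpM2l => //.
rewrite -exprMn mulrC; apply: lerXn2r; rewrite ?nnegrE.
- by rewrite addr_ge0 ?norm1_ge0.
- by rewrite mulr_ge0 ?tnorm_ge0 ?xnorm_ge0.
- exact: onenorm_le.
Qed.

Lemma growth_test_all u : is_distribution u -> is_smooth_distribution (sum_squares a u) ->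
  forall p b, CinftyC b -> growth 0 p (test u b).
Proof.
move=> du su p b sb; have [d Hd] := growth_test0 du.
have lu := distribution_clinear du.
(* After [d + p] rounds, [d] powers of decay cancel the initial growth and [p] remain. *)
apply: (@growth_cancel_all _ _ d); move: (d + p)%N => q.
elim: q b sb => [|q IH]; first exact: Hd.
exact: growth_test lu su IH.
Qed.

End Elliptic.

(** * Energy estimate *)

Section Modes.
Context {R : realType} {n : nat}.
Implicit Types (xi : 'rV[int]_(n + 1)) (phi psi F : 'rV[R]_(n + 1) -> R[i])
  (u : functional R (n + 1)) (k : int).
Local Notation normc := Normc.normc.
Local Notation P := ((2 * pi) ^+ (n + 1) : R).
Context (a : 'I_n -> 'rV[R]_n -> R) (a_smooth : forall j, Cinfty (a j)).

(** Having x-frequency [k], expressed as a differential equation, so that stability under [X_j] and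
    conjugation is a direct computation. *)
Definition pmode k phi : Prop := pderivC xj phi = fun y => imagc k%:~R * phi y.

Lemma imagcN (r : R) : imagc (- r) = - imagc r.
Proof. by apply: complexP; rewrite ?Re_opp ?Im_opp /= ?oppr0. Qed.

Lemma imagc_inj (r s : R) : imagc r = imagc s -> r = s.
Proof. by case. Qed.

Lemma pmode_expi xi : pmode (xi 0 xj) (expi xi).
Proof. exact: pderivC_expi. Qed.

(** [X_j] commutes with the derivative in x, because [a_j] depends on t only. *)
Lemma pmode_Xf j k phi : CinftyC phi -> pmode k phi -> pmode k (Xf a j phi).
Proof.
move=> sp pm; have sd := CinftyC_pderiv xj sp.
have sA := CinftyC_coefA a_smooth j.
rewrite /pmode pderivC_D; [|exact: CinftyC_pderiv|exact: CinftyC_M].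
rewrite pderivC_M // pderivC_x_coefA // pderivC_comm // pm !pderivC_Z // pm.
by apply/funext => y; rewrite /Xf pm; ring.
Qed.

Lemma pmode_conj k phi : CinftyC phi -> pmode (- k) phi -> pmode k (fun y => ((phi y)^*)%C).
Proof.
move=> sp pm; rewrite /pmode pderivC_conj // pm; apply/funext => y.
rewrite conj_mul; congr (_ * _); rewrite mulrNz.
by apply: complexP; rewrite ?Re_conjc ?Im_conjc /= ?opprK.
Qed.

(** Integration by parts in x multiplies the same nonzero coefficient by i k on one side and by i
    times the x-frequency of [xi] on the other. *)
Lemma pmode_fcoef k phi xi : CinftyC phi -> pmode k phi -> fcoef phi xi != 0 -> xi 0 xj = k.
Proof.
move=> sp pm; rewrite mulf_eq0 negb_or => /andP[_ nz].
have se := CinftyC_expi (R := R) (- xi).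
have sm : CinftyC (fun y => phi y * expi (- xi) y) by exact: CinftyC_M.
have := integralC_parts xj sp se; rewrite pm pderivC_expi.
rewrite (_ : (fun y => imagc _ * phi y * _) = fun y => imagc k%:~R * (phi y * expi (- xi) y));
  last by apply/funext => y; rewrite mulrA.
rewrite (_ : (fun y => phi y * (imagc _ * _)) = fun y => - imagc (xi 0 xj)%:~R * (phi y * expi (- xi) y));
  last by apply/funext => y; rewrite mxE mulrNz imagcN mulrCA.
rewrite !integralC_Z // mulNr opprK => /(mulIf nz)/imagc_inj/intr_inj ->.
by [].
Qed.

Definition cmode u k xi : R[i] := if xi 0 xj == k then u (expi xi) else 0.

(** The mode [G_k], kept as a function on the whole torus: because the pairing is bilinear it
    carries the factor exp (- i k x), and all integrals stay in the same dimension. *)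
Definition mode_part u k : 'rV[R]_(n + 1) -> R[i] := density (cmode u k).

Definition knorm k : R := 1 + `|k%:~R|.

Lemma knorm_ge1 k : 1 <= knorm k.
Proof. by rewrite lerDl. Qed.

Lemma knorm_gt0 k : 0 < knorm k.
Proof. exact: lt_le_trans (knorm_ge1 k). Qed.

(** On the support of [cmode u k], [xnorm xi] equals [knorm k], so the loss in the x-frequency is a
    constant for each mode. The extra [s] powers come from [onenorm_le]. *)
Lemma cmode_bound u (s : nat) : (forall p, growth 0 p (fun xi => u (expi xi))) ->
  exists (M : nat) (C : R), 0 <= C /\
  forall k xi, normc (cmode u k xi) * (1 + norm1 xi) ^+ s <= C * knorm k ^+ M.
Proof.
move=> /(_ s)[M [C [C0 H]]]; exists (M + s)%N, C; split => // k xi.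
rewrite /cmode; case: eqP => [<-|_]; last first.
  by rewrite Normc.normc0 mul0r mulr_ge0 // exprn_ge0 // ltW // knorm_gt0.
apply: (@le_trans _ _ (normc (u (expi xi)) * (tnorm xi * xnorm xi) ^+ s)).
  apply: ler_wpM2l; first exact: normc_ge0.
  apply: lerXn2r; rewrite ?nnegrE ?onenorm_le //; first by rewrite addr_ge0 ?norm1_ge0.
  by rewrite mulr_ge0 ?tnorm_ge0 ?xnorm_ge0.
rewrite exprMn mulrA exprD mulrA; apply: ler_wpM2r; first by rewrite exprn_ge0 // xnorm_ge0.
by have := H xi; rewrite expr0 mulr1.
Qed.

Lemma rapidC_cmode u k : (forall p, growth 0 p (fun xi => u (expi xi))) -> rapidC (cmode u k).
Proof.
by move=> H s; have [M [C [_ HC]]] := cmode_bound s H; exists (C * knorm k ^+ M) => xi.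
Qed.

Lemma mode_part_bound u : (forall p, growth 0 p (fun xi => u (expi xi))) ->
  exists (M : nat) (C : R), 0 <= C /\ forall k y, normc (mode_part u k y) <= C * knorm k ^+ M.
Proof.
move=> H; have [M [C [C0 HC]]] := cmode_bound (2 * (n + 1)) H.
have P0 : 0 <= P^-1 by rewrite invr_ge0 ltW // two_piX_gt0.
exists M, (4 * (P^-1 * C) * 4 ^+ (n + 1)); split.
  by rewrite !mulr_ge0 // exprn_ge0.
move=> k y; have rc := rapidC_cmode k H.
have kM : 0 <= knorm k ^+ M by rewrite exprn_ge0 // ltW // knorm_gt0.
have -> : 4 * (P^-1 * C) * 4 ^+ (n + 1) * knorm k ^+ M =
    4 * (P^-1 * (C * knorm k ^+ M)) * 4 ^+ (n + 1) by ring.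
apply: fseries_bound.
- by apply: rapidC_Z; exact: rapidC_opp.
- by rewrite !mulr_ge0.
- move=> xi; rewrite normcM normc_real ger0_norm // -mulrA; apply: ler_wpM2l => //.
  have := HC k (- xi); rewrite norm1N => h.
  have w := weight_norm1 (R := R) xi.
  have c0 := normc_ge0 (cmode u k (- xi)).
  apply: (@le_trans _ _ (normc (cmode u k (- xi)) * (weight xi * (1 + norm1 xi) ^+ (2 * (n + 1))))).
    by rewrite ler_peMr.
  by rewrite mulrCA mulrC; apply: ler_wpM2r => //; exact: weight_ge0.
Qed.

(** A test function of x-frequency [k] has Fourier coefficients only where [cmode u k] agrees with
    [u], so on such functions [u] may be replaced by a smooth density. *)
Lemma mode_partP u k phi : clinear u -> seq_continuous u ->
  (forall p, growth 0 p (fun xi => u (expi xi))) -> CinftyC phi -> pmode k phi ->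
  u phi = torus_integralC (fun y => mode_part u k y * phi y).
Proof.
move=> lu cu H sp pm; apply: densityP => //; first exact: rapidC_cmode.
by move=> xi /(pmode_fcoef sp pm) E; rewrite /cmode E eqxx.
Qed.

Lemma pmode_mode_part u k : (forall p, growth 0 p (fun xi => u (expi xi))) ->
  pmode (- k) (mode_part u k).
Proof.
move=> H; have rc := rapidC_cmode k H; have sG := CinftyC_density rc.
rewrite -/(mode_part u k) in sG.
have sdG := CinftyC_pderiv xj sG.
have sD : CinftyC (fun y => pderivC xj (mode_part u k) y + imagc k%:~R * mode_part u k y).
  by apply: CinftyC_D => //; exact: CinftyC_Z.
have /(fourier_unique sD) E xi : torus_integralC (fun y =>
    (pderivC xj (mode_part u k) y + imagc k%:~R * mode_part u k y) * expi xi y) = 0.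
  have se := CinftyC_expi (R := R) xi.
  rewrite (_ : (fun y => _) = fun y => pderivC xj (mode_part u k) y * expi xi y +
     imagc k%:~R * (mode_part u k y * expi xi y)); last first.
    by apply/funext => y; rewrite mulrDl mulrA.
  have sm : CinftyC (fun y => mode_part u k y * expi xi y) by exact: CinftyC_M.
  rewrite integralC_D; [|exact: CinftyC_M|exact: CinftyC_Z].
  rewrite integralC_parts // pderivC_expi.
  rewrite (_ : (fun y => mode_part u k y * (imagc _ * _)) = fun y =>
     imagc (xi 0 xj)%:~R * (mode_part u k y * expi xi y)); last first.
    by apply/funext => y; rewrite mulrCA.
  rewrite !integralC_Z // density_coef // /cmode; case: eqP => [->|_].
    by rewrite addNr.
  by rewrite !mulr0 oppr0 addr0.
apply/funext => y; apply/eqP; rewrite mulrNz imagcN mulNr -addr_eq0; apply/eqP.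
exact: (congr1 (fun g => g y) E).
Qed.

(* Repeated integration by parts in [x]. *)
Lemma mode_decay (L : nat) F : CinftyC F ->
  exists2 C : R, 0 <= C & forall k psi (B : R), CinftyC psi -> pmode k psi -> 0 <= B ->
    (forall y, normc (psi y) <= B) ->
    normc (torus_integralC (fun y => F y * psi y)) * knorm k ^+ L <= C * B.
Proof.
elim: L F => [|L IH] F sF.
  have [A A0 HA] := CinftyC_bounded sF.
  exists (2 * A * P) => [|k psi B ss pm B0 HB].
    by rewrite !mulr_ge0 // ltW // two_piX_gt0.
  rewrite expr0 mulr1; have -> : 2 * A * P * B = 2 * (A * B) * P by ring.
  apply: integralC_bound => [|y]; first exact: CinftyC_M.
  by rewrite normcM; apply: ler_pM => //; exact: normc_ge0.
have [C1 C10 H1] := IH _ sF; have [C2 C20 H2] := IH _ (CinftyC_pderiv xj sF).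
exists (C1 + C2) => [|k psi B ss pm B0 HB]; first exact: addr_ge0.
rewrite exprS mulrCA mulrDl mul1r mulrDl; apply: lerD; first exact: H1.
apply: le_trans (H2 k psi B ss pm B0 HB).
rewrite mulrA; apply: ler_wpM2r; first by rewrite exprn_ge0 // ltW // knorm_gt0.
rewrite integralC_parts // pm normc_opp.
rewrite (_ : (fun y => F y * (imagc _ * _)) = fun y => imagc k%:~R * (F y * psi y)); last first.
  by apply/funext => y; rewrite mulrCA.
by rewrite integralC_Z ?normcM ?normc_imag //; exact: CinftyC_M.
Qed.

Context (u : functional R (n + 1)) (du : is_distribution u)
  (su : is_smooth_distribution (sum_squares a u)).

Let lu : clinear u := distribution_clinear du.
Let cu : seq_continuous u := distribution_seq_continuous du.

Lemma growth_expi p : growth 0 p (fun xi => u (expi xi)).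
Proof.
rewrite (_ : (fun xi => _) = test u (fun _ => 1)).
  exact: (growth_test_all a_smooth du su p (CinftyC_cst 1)).
apply/funext => xi; rewrite /test; congr u.
by apply/funext => y; rewrite mul1r.
Qed.

Lemma CinftyC_mode_part k : CinftyC (mode_part u k).
Proof. by apply: CinftyC_density; apply: rapidC_cmode; exact: growth_expi. Qed.

Definition energy j k : R := torus_integral (fun y => normc (Xf a j (mode_part u k) y) ^+ 2).

(** The conjugate of [G_k] has x-frequency [k], and so have its images under [X_j]. Hence [u] may be
    replaced by [G_k] in [u (X_j X_j conj G_k)], and one integration by parts with the real field
    [X_j] gives minus a squared norm. *)
Lemma energy_identity F k :
  (forall phi, CinftyC phi -> sum_squares a u phi = torus_integralC (fun y => F y * phi y)) ->
  torus_integralC (fun y => F y * ((mode_part u k y)^*)%C) = - (\sum_(j < n) energy j k)%:C.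
Proof.
move=> HF; have sG := CinftyC_mode_part k.
have sc := CinftyC_conj sG.
have pm := pmode_conj sG (pmode_mode_part k growth_expi).
rewrite -HF // sum_squaresE // rmorph_sum /= -sumrN; apply: eq_bigr => j _.
have sXc := CinftyC_Xf a_smooth j sc.
have pX := pmode_Xf j sc pm.
rewrite (mode_partP lu cu growth_expi (CinftyC_Xf a_smooth j sXc) (pmode_Xf j sXc pX)).
rewrite -[LHS]opprK -(integralC_Xf_parts a_smooth j sG sXc) (Xf_conj _ _ sG).
by rewrite (integral_normc_sqr (CinftyC_Xf a_smooth j sG)).
Qed.

Lemma energy_decay j (L : nat) : exists2 C : R, 0 <= C & forall k, energy j k * knorm k ^+ L <= C.
Proof.
have [F [sF HF]] := su.
have [M [C [C0 HC]]] := mode_part_bound growth_expi.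
(* Of these powers of [knorm], [M] pay for the polynomial growth of [G_k]. *)
have [D D0 HD] := mode_decay (L + M) sF.
exists (D * C) => [|k]; first exact: mulr_ge0.
have sG := CinftyC_mode_part k.
have pm := pmode_conj sG (pmode_mode_part k growth_expi).
have e0 i : 0 <= energy i k by apply: integral_normc_sqr_ge0; exact: CinftyC_Xf.
have kM : 0 < knorm k ^+ M by rewrite exprn_gt0 // knorm_gt0.
have := HD k _ (C * knorm k ^+ M) (CinftyC_conj sG) pm.
rewrite energy_identity // normc_opp normc_real ger0_norm; last exact: sumr_ge0.
move=> /(_ (mulr_ge0 C0 (ltW kM))) h.
have {}h : \sum_(j < n) energy j k * knorm k ^+ (L + M) <= D * (C * knorm k ^+ M).
  by rewrite -mulr_suml; apply: h => y; rewrite normc_conj.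
rewrite -(ler_pM2r kM) -!mulrA -exprD; apply: le_trans h.
rewrite (bigD1 j) //= lerDl sumr_ge0 // => i _.
by rewrite mulr_ge0 // exprn_ge0 // ltW // knorm_gt0.
Qed.

(** [expi xi] has x-frequency [xi 0 xj], so the value of [X_j u] on it is a Fourier coefficient of
    [X_j G_k] for that mode, and Bessel's inequality applies. *)
Lemma vfield_expi_energy j xi :
  normc (vfield a j u (expi xi)) ^+ 2 <= P * energy j (xi 0 xj).
Proof.
have se := CinftyC_expi (R := R) xi; have sG := CinftyC_mode_part (xi 0 xj).
rewrite (vfieldE a_smooth j lu se).
rewrite (mode_partP lu cu growth_expi (CinftyC_Xf a_smooth j se) (pmode_Xf j se (pmode_expi xi))).
by rewrite -integralC_Xf_parts //; apply: bessel; exact: CinftyC_Xf.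
Qed.

Lemma growth_vfield j p : growth 0 p (fun xi => vfield a j u (expi xi)).
Proof.
(* [X_j] costs one power of [tnorm], taken from the decay of [u] on the test functions, which is
   available to every order. *)
apply: growth_cancel.
rewrite (_ : (fun xi => _) = fun xi => - (imagc (xi 0 (tj j))%:~R * u (expi xi) +
    imagc (xi 0 xj)%:~R * test u (coefA a j) xi)); last first.
  apply/funext => xi; have se := CinftyC_expi (R := R) xi.
  have sA : CinftyC (fun y => coefA a j y * expi xi y).
    by apply: CinftyC_M => //; exact: CinftyC_coefA.
  rewrite vfieldE // Xf_expi lu //; last exact: CinftyC_Z.
  by rewrite clinearZ.
apply: growthN; apply: growthD.
  by apply: growthM; [exact: imagc_tj_bound|exact: growth_expi].
apply: growthM; first exact: imagc_xj_bound.
by apply: (growth_test_all a_smooth du su); exact: CinftyC_coefA.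
Qed.

(* Interpolation between the decay in [xi_t] and the decay in [xi_x]. *)
Lemma rapidC_vfield j : rapidC (fun xi => vfield a j u (expi xi)).
Proof.
(* The target is reached through its square, a product of one factor decaying in k and one decaying
   in xi_t, hence [2 * s]. The energy must also absorb [k ^+ M], and it bounds a square, hence
   [2 * (M + 2 * s)]. *)
move=> s; have [M [C [C0 HC]]] := growth_vfield j (2 * s).
have [D D0 HD] := energy_decay j (2 * (M + 2 * s)).
exists (1 + C * (1 + P * D)) => xi.
set h := normc _; set q : R := tnorm xi; set k : R := xnorm xi.
have h0 : 0 <= h by exact: normc_ge0.
have q1 : 1 <= q := tnorm_ge1 xi; have k1 : 1 <= k := xnorm_ge1 xi.
(* Stands in for square roots: only boundedness matters here. *)
have sq_le (x c : R) : 0 <= c -> x ^+ 2 <= c -> x <= 1 + c.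
  by move=> c0; rewrite expr2 => H; nra.
have P0 : 0 <= P by rewrite ltW // two_piX_gt0.
have k0 m : 0 <= k ^+ m by rewrite exprn_ge0 //; lra.
have q0 m : 0 <= q ^+ m by rewrite exprn_ge0 //; lra.
have b1 : h * k ^+ (M + 2 * s) <= 1 + P * D.
  apply: sq_le; first exact: mulr_ge0.
  rewrite exprMn -exprM mulnC; apply: le_trans (_ : P * energy j (xi 0 xj) * k ^+ (2 * (M + 2 * s)) <= _).
    by apply: ler_wpM2r => //; exact: vfield_expi_energy.
  by rewrite -mulrA; apply: ler_wpM2l => //; exact: HD.
have b2 : h * q ^+ (2 * s) <= C * k ^+ M by have := HC xi; rewrite expr0 mulr1.
apply: (@le_trans _ _ (h * (q * k) ^+ s)).
  apply: ler_wpM2l => //; apply: lerXn2r; rewrite ?nnegrE ?onenorm_le //.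
    by rewrite addr_ge0 ?norm1_ge0.
  by rewrite mulr_ge0 //; lra.
apply: sq_le; first by rewrite mulr_ge0 // addr_ge0 // mulr_ge0.
have -> : (h * (q * k) ^+ s) ^+ 2 = h * k ^+ (2 * s) * (h * q ^+ (2 * s)).
  by rewrite !exprMn -!exprM mulnC; ring.
apply: (@le_trans _ _ (h * k ^+ (2 * s) * (C * k ^+ M))).
  by apply: ler_wpM2l => //; exact: mulr_ge0.
have -> : h * k ^+ (2 * s) * (C * k ^+ M) = C * (h * k ^+ (M + 2 * s)).
  by rewrite exprD; ring.
exact: ler_wpM2l.
Qed.

Lemma vfield_smooth j : is_smooth_distribution (vfield a j u).
Proof.
have rc := rapidC_vfield j.
exists (density (fun xi => vfield a j u (expi xi))); split; first exact: CinftyC_density.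
move=> phi sp; apply: densityP => //; first exact: clinear_vfield.
exact: seq_continuous_vfield.
Qed.

End Modes.

Theorem theorem1p1 (R : realType) (n : nat) (n_gt0 : (0 < n)%N)
    (a : 'I_n -> 'rV[R]_n -> R) (a_smooth : forall j : 'I_n, Cinfty (a j)) :
  (forall u : functional R (n + 1), is_distribution u ->
     (is_smooth_distribution (sum_squares a u) <->
      forall j : 'I_n, is_smooth_distribution (vfield a j u))) /\
  (globally_hypoelliptic [set vfield a j | j in [set: 'I_n]] <->
   globally_hypoelliptic [set sum_squares a]).
Proof.
have equiv (u : functional R (n + 1)) : is_distribution u ->
    (is_smooth_distribution (sum_squares a u) <->
     forall j : 'I_n, is_smooth_distribution (vfield a j u)).
  move=> du; split => [su j|]; first exact: vfield_smooth.
  exact: sum_squares_smooth.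
split=> //; split=> gh u du H; apply: gh => // Q.
  by move=> [j _ <-]; apply: (equiv u du).1; exact: H.
by move=> ->; apply/(equiv u du) => j; apply: H; exists j.
Qed.
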